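(* Let $R$ be a commutative Noetherian ring of finite Krull dimension, $\mathfrak{a}$ an ideal of $R$, and $X,Y\in\mathcal{D}^f_+(R)$. Then $$\mathrm{cd}(\mathfrak{a},X\otimes^{\mathbf{L}}_R Y)=\sup\{\mathrm{cd}(\mathfrak{a},H_t(X)\otimes_R H_\ell(Y))-\ell-t\mid t,\ell\in\mathbb{Z}\}.$$
   Context: Complexes are graded homologically (differentials $X_\ell\to X_{\ell-1}$). $\mathcal{D}(R)$ is the derived category of $R$-modules; $\mathcal{D}^f_+(R)$ is the full subcategory of complexes $X$ with $H_\ell(X)=0$ for $\ell\ll 0$ and every $H_\ell(X)$ finitely generated. $-\otimes^{\mathbf{L}}_R-$ is the derived tensor product. For an $R$-module $M$, $\mathrm{cd}(\mathfrak{a},M)=\sup\{i\in\mathbb{Z}\mid H^i_{\mathfrak{a}}(M)\neq0\}$, where $H^i_{\mathfrak a}$ denotes local cohomology. For a complex $X$, $\mathrm{cd}(\mathfrak{a},X)=\sup\{\mathrm{cd}(\mathfrak{a},H_\ell(X))-\ell\mid \ell\in\mathbb{Z}\}$. All sups are taken in $\mathbb{Z}\cup\{\pm\infty\}$, with $\sup\emptyset=-\infty$. *)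

(* Defs.v *)
From HB Require Import structures.
From mathcomp Require Import all_boot all_order all_algebra.
From mathcomp Require Import finmap generic_quotient ring_quotient.
From mathcomp Require Import all_classical constructive_ereal.

Set Implicit Arguments.
Unset Strict Implicit.
Unset Printing Implicit Defensive.

Import Order.TTheory GRing.Theory Num.Theory.

Local Open Scope classical_set_scope.
Local Open Scope ring_scope.
Local Open Scope quotient_scope.

(** * Submodules, quotients, direct sums *)

(* Submodules are the library's [submodClosed V]: membership predicates
   [V -> bool] closed under the module operations.  Thanks to boolp every
   classical subset that is a submodule is one of them.  An ideal of [R] is a
   submodule of the regular module [R^o]; the unit ideal is allowed, unlike in
   [ring_quotient.idealr]. *)
Notation ideal R := (submodClosed R^o).

Lemma mk_submod (R : pzRingType) (V : lmodType R) (S : V -> bool) :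
  S 0 -> (forall x y, S x -> S y -> S (x + y)) ->
  (forall c x, S x -> S (c *: x)) -> GRing.subsemimod_closed S.
Proof.
move=> S0 SD SZ; split; last by move=> c x; exact: SZ.
by split=> // x y; exact: SD.
Qed.

Section Submodules.
Variables (R : pzRingType) (V : lmodType R).

Definition subm (N : submodClosed V) := {x : V | x \in N}.
HB.instance Definition _ (N : submodClosed V) := Choice.on (subm N).
HB.instance Definition _ (N : submodClosed V) := SubChoice.on (subm N).
HB.instance Definition _ (N : submodClosed V) :=
  [SubChoice_isSubLmodule of subm N by <:].

Definition submod_zmod (N : submodClosed V) : zmodClosed V :=
  HB.pack (GRing.SubmodClosed.sort N) (GRing.isZmodClosed.Build V _
    (GRing.subsemimod_closedB (GRing.subsemimodClosedP N))).
Definition quotm (N : submodClosed V) := Quotient.quot (submod_zmod N).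
HB.instance Definition _ (N : submodClosed V) := GRing.Zmodule.on (quotm N).
Definition quot_pi (N : submodClosed V) (x : V) : quotm N := \pi_(Quotient.quot (submod_zmod N)) x.
Definition quot_repr (N : submodClosed V) (x : quotm N) : V := repr (x : Quotient.quot (submod_zmod N)).

Lemma quot_reprK N : cancel (@quot_repr N) (@quot_pi N).
Proof. by move=> x; rewrite /quot_pi /quot_repr reprK. Qed.
Lemma quot_piP N (x y : V) :
  reflect (quot_pi N x = quot_pi N y) (x - y \in N).
Proof.
rewrite -[x - y \in N]/(x - y \in submod_zmod N) Quotient.idealrBE; exact: eqP.
Qed.
Lemma quot_piD N x y : quot_pi N (x + y) = quot_pi N x + quot_pi N y.
Proof. by rewrite /quot_pi !piE. Qed.

Definition quot_scale N (c : R) (x : quotm N) := quot_pi N (c *: quot_repr x).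
Lemma quot_scale_pi N c x : quot_scale c (quot_pi N x) = quot_pi N (c *: x).
Proof.
apply/quot_piP; rewrite -scalerBr rpredZ //.
by apply/quot_piP; rewrite quot_reprK.
Qed.

Lemma quot_scaleA N a b (v : quotm N) :
  quot_scale a (quot_scale b v) = quot_scale (a * b) v.
Proof. by rewrite -(quot_reprK v) !quot_scale_pi scalerA. Qed.
Lemma quot_scale1 N : left_id 1 (@quot_scale N).
Proof. by move=> v; rewrite -(quot_reprK v) !quot_scale_pi scale1r. Qed.
Lemma quot_scaleDr N : right_distributive (@quot_scale N) +%R.
Proof.
move=> a u v; rewrite -(quot_reprK u) -(quot_reprK v).
by rewrite -quot_piD !quot_scale_pi scalerDr quot_piD.
Qed.
Lemma quot_scaleDl N (v : quotm N) : {morph (@quot_scale N)^~ v : a b / a + b}.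
Proof.
by move=> a b; rewrite -(quot_reprK v) !quot_scale_pi scalerDl quot_piD.
Qed.
HB.instance Definition _ N := GRing.Zmodule_isLmodule.Build R (quotm N)
  (@quot_scaleA N) (@quot_scale1 N) (@quot_scaleDr N) (@quot_scaleDl N).

Lemma quot_pi_linear N : linear (quot_pi N).
Proof. by move=> c x y; rewrite quot_piD -quot_scale_pi. Qed.
HB.instance Definition _ N :=
  GRing.isLinear.Build R V (quotm N) *:%R (quot_pi N) (quot_pi_linear N).

Lemma quot_pi0 (N : submodClosed V) x : x \in N -> quot_pi N x = 0.
Proof. by move=> Nx; rewrite -(linear0 (quot_pi N)); apply/quot_piP; rewrite subr0. Qed.

(* The submodule spanned by a set *)
Definition span_pred (S : set V) (x : V) : bool :=
  `[< forall N : submodClosed V, S `<=` [set` N] -> x \in N >].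
Lemma span_closed S : GRing.subsemimod_closed (span_pred S).
Proof.
apply: mk_submod => [|x y /asboolP Sx /asboolP Sy|c x /asboolP Sx];
  apply/asboolP => N SN.
- exact: rpred0.
- by rewrite rpredD ?Sx ?Sy.
- by rewrite rpredZ ?Sx.
Qed.
HB.instance Definition _ S :=
  GRing.isSubmodClosed.Build R V (span_pred S) (span_closed S).
Definition submod_span (S : set V) : submodClosed V :=
  GRing.SubmodClosed.clone _ _ (span_pred S) _.

Lemma mem_span (S : set V) x : S x -> x \in submod_span S.
Proof. by move=> Sx; apply/asboolP => N; exact. Qed.
Lemma span_sub (S : set V) (N : submodClosed V) x :
  S `<=` [set` N] -> x \in submod_span S -> x \in N.
Proof. by move=> SN /asboolP; exact. Qed.

End Submodules.

Section LinearMaps.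
Variables (R : pzRingType) (U V : lmodType R).

Definition ker_pred (f : {linear U -> V}) (x : U) : bool := f x == 0.
Lemma ker_closed f : GRing.subsemimod_closed (ker_pred f).
Proof.
rewrite /ker_pred; apply: mk_submod => [|x y /eqP fx /eqP fy|c x /eqP fx].
- by rewrite linear0.
- by rewrite linearD fx fy addr0.
- by rewrite linearZ_LR fx scaler0.
Qed.
HB.instance Definition _ f :=
  GRing.isSubmodClosed.Build R U (ker_pred f) (ker_closed f).
Definition kerm (f : {linear U -> V}) : submodClosed U :=
  GRing.SubmodClosed.clone _ _ (ker_pred f) _.

Section Restrict.
Variables (f : {linear U -> V}) (A : submodClosed U) (B : submodClosed V).
Hypothesis fAB : forall x, x \in A -> f x \in B.
Definition restr (x : subm A) : subm B := exist _ (f (val x)) (fAB (valP x)).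
Lemma restr_linear : linear restr.
Proof. by move=> c x y; apply: val_inj; rewrite /= !linearP. Qed.
HB.instance Definition _ :=
  GRing.isLinear.Build R (subm A) (subm B) *:%R restr restr_linear.
End Restrict.

Section QuotLift.
Variables (N : submodClosed U) (f : {linear U -> V}).
Hypothesis fN : forall x, x \in N -> f x = 0.
(* [fN] is kept as an argument so that linearity can be inferred. *)
Definition quot_lift (x : quotm N) : V := let _ := fN in f (quot_repr x).
Lemma quot_liftE x : quot_lift (quot_pi N x) = f x.
Proof.
apply/eqP; rewrite -subr_eq0 -linearB fN //.
by apply/quot_piP; rewrite quot_reprK.
Qed.
Lemma quot_lift_linear : linear quot_lift.
Proof.
move=> c x y; rewrite -(quot_reprK x) -(quot_reprK y) -linearP.
by rewrite !quot_liftE linearP.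
Qed.
HB.instance Definition _ :=
  GRing.isLinear.Build R (quotm N) V *:%R quot_lift quot_lift_linear.
End QuotLift.

End LinearMaps.
Arguments quot_lift {R U V N f} fN x.
Arguments restr {R U V f A B} fAB x.

(* Direct products as dependent functions *)
Section Product.
Variables (R : pzRingType) (I : Type) (M : I -> lmodType R).

Definition prodm := forall i, M i.
HB.instance Definition _ := Choice.on prodm.

Definition prodm_add (x y : prodm) : prodm := fun i => x i + y i.
Definition prodm_opp (x : prodm) : prodm := fun i => - x i.
Definition prodm_zero : prodm := fun i => 0.
Definition prodm_scale (c : R) (x : prodm) : prodm := fun i => c *: x i.

Fact prodm_addA : associative prodm_add.
Proof. by move=> x y z; apply: functional_extensionality_dep => i; exact: addrA. Qed.
Fact prodm_addC : commutative prodm_add.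
Proof. by move=> x y; apply: functional_extensionality_dep => i; exact: addrC. Qed.
Fact prodm_add0 : left_id prodm_zero prodm_add.
Proof. by move=> x; apply: functional_extensionality_dep => i; exact: add0r. Qed.
Fact prodm_addN : left_inverse prodm_zero prodm_opp prodm_add.
Proof. by move=> x; apply: functional_extensionality_dep => i; exact: addNr. Qed.
HB.instance Definition _ :=
  GRing.isZmodule.Build prodm prodm_addA prodm_addC prodm_add0 prodm_addN.

Fact prodm_scaleA a b v : prodm_scale a (prodm_scale b v) = prodm_scale (a * b) v.
Proof. by apply: functional_extensionality_dep => i; exact: scalerA. Qed.
Fact prodm_scale1 : left_id 1 prodm_scale.
Proof. by move=> v; apply: functional_extensionality_dep => i; exact: scale1r. Qed.
Fact prodm_scaleDr : right_distributive prodm_scale +%R.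
Proof. by move=> a u v; apply: functional_extensionality_dep => i; exact: scalerDr. Qed.
Fact prodm_scaleDl v : {morph prodm_scale^~ v : a b / a + b}.
Proof. by move=> a b; apply: functional_extensionality_dep => i; exact: scalerDl. Qed.
HB.instance Definition _ := GRing.Zmodule_isLmodule.Build R prodm
  prodm_scaleA prodm_scale1 prodm_scaleDr prodm_scaleDl.

Lemma prodmDE (x y : prodm) i : (x + y) i = x i + y i. Proof. by []. Qed.
Lemma prodmZE c (x : prodm) i : (c *: x) i = c *: x i. Proof. by []. Qed.
Lemma prodm0E i : (0 : prodm) i = 0. Proof. by []. Qed.

(* The submodule of families that are finitely supported inside [A]; it is the
   direct sum of the [M i] for [i] in [A]. *)
Definition dsum_pred (A : set I) (x : prodm) : bool :=
  `[< finite_set [set i | x i <> 0] /\ [set i | x i <> 0] `<=` A >].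
Lemma dsum_closed A : GRing.subsemimod_closed (dsum_pred A).
Proof.
apply: mk_submod => [|x y /asboolP[fx Ax] /asboolP[fy Ay]|c x /asboolP[fx Ax]];
  apply/asboolP.
- split=> [|i /=]; last by [].
  by apply: (sub_finite_set _ (finite_set0 I)) => i /=.
- have sxy : [set i | (x + y) i <> 0] `<=`
             [set i | x i <> 0] `|` [set i | y i <> 0].
    move=> i /= xyi; have [x0|] := pselect (x i = 0); last by left.
    by right=> y0; apply: xyi; rewrite /= /GRing.add /= /prodm_add x0 y0 addr0.
  split; first by apply: sub_finite_set sxy _; rewrite finite_setU.
  by move=> i /sxy[/Ax|/Ay].
- have sx : [set i | (c *: x) i <> 0] `<=` [set i | x i <> 0].
    by move=> i /= cx x0; apply: cx; rewrite /GRing.scale /= /prodm_scale x0 scaler0.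
  split; first exact: sub_finite_set sx fx.
  by move=> i /sx /Ax.
Qed.
HB.instance Definition _ A :=
  GRing.isSubmodClosed.Build R prodm (dsum_pred A) (dsum_closed A).
Definition dsum (A : set I) : submodClosed prodm :=
  GRing.SubmodClosed.clone _ _ (dsum_pred A) _.

End Product.

(** * Free modules and tensor products *)

Section Free.
Variables (R : pzRingType) (T : choiceType).

Definition freem : lmodType R := subm (dsum (fun _ : T => R^o) setT).

Definition delta_fun (t : T) : prodm (fun _ : T => R^o) := fun s => (s == t)%:R.
Lemma delta_in t : delta_fun t \in dsum (fun _ : T => R^o) setT.
Proof.
apply/asboolP; split=> //; apply: (sub_finite_set _ (finite_set1 t)) => s /=.
by rewrite /delta_fun; case: eqP.
Qed.
Definition delta (t : T) : freem := exist _ (delta_fun t) (delta_in t).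

Section FreeLift.
Variables (V : lmodType R) (f : T -> V).
Definition freelift (x : freem) : V := \sum_(t \in setT) (val x t : R) *: f t.

Lemma freeliftE (x : freem) (A : {fset T}) :
  (forall t, t \notin A -> val x t = 0) ->
  freelift x = \sum_(t <- A) (val x t : R) *: f t.
Proof.
by move=> xA; apply: fsbigTE => t /xA ->; rewrite scale0r.
Qed.

Lemma free_supp (x : freem) :
  exists A : {fset T}, forall t, t \notin A -> val x t = 0.
Proof.
have /asboolP[/finite_fsetP[A xA] _] := valP x; exists A => t tA.
apply/eqP/negP => /negP/eqP xt; move/negP: tA; apply.
by have : [set` A] t by rewrite -xA.
Qed.

Lemma freelift_linear : linear freelift.
Proof.
move=> c x y; have [A xA] := free_supp x; have [B yB] := free_supp y.
pose C := (A `|` B)%fset.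
have xC t : t \notin C -> val x t = 0.
  by rewrite inE negb_or => /andP[/xA].
have yC t : t \notin C -> val y t = 0.
  by rewrite inE negb_or => /andP[_ /yB].
rewrite (freeliftE xC) (freeliftE yC) (@freeliftE _ C); last first.
  move=> t tC; rewrite /= [LHS]/GRing.add /= /prodm_add yC // addr0.
  by rewrite /GRing.scale /= /prodm_scale xC // scaler0.
rewrite scaler_sumr -big_split /=; apply: eq_bigr => t _.
by rewrite scalerA -scalerDl.
Qed.
HB.instance Definition _ :=
  GRing.isLinear.Build R freem V *:%R freelift freelift_linear.

Lemma freelift_delta t : freelift (delta t) = f t.
Proof.
rewrite (@freeliftE _ [fset t]%fset) => [|s].
  by rewrite big_seq_fset1 /= /delta_fun eqxx scale1r.
by rewrite inE /= /delta_fun => /negbTE ->.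
Qed.
End FreeLift.

Lemma free_delta (x : freem) : x = freelift delta x.
Proof.
apply: val_inj; have [A xA] := free_supp x; rewrite (freeliftE _ xA).
rewrite linear_sum /=; apply: functional_extensionality_dep => t.
have -> (F : T -> prodm (fun _ : T => R^o)) :
    (\sum_(s <- A) F s) t = \sum_(s <- A) F s t.
  by elim/big_rec2: _ => // s u v _ <-.
have [tA|tA] := boolP (t \in A).
  rewrite (big_fsetD1 t) //= big1_fset => [|s].
    rewrite addr0 /= /GRing.scale /= /prodm_scale /delta_fun eqxx.
    by rewrite /GRing.scale /= mulr1.
  rewrite !inE => /andP[st _] _; rewrite /GRing.scale /= /prodm_scale /delta_fun.
  by rewrite eq_sym (negbTE st) scaler0.
rewrite xA // big1_fset // => s sA _.
rewrite /GRing.scale /= /prodm_scale /delta_fun.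
case: eqP => [ts|_]; last by rewrite scaler0.
by rewrite -ts (negbTE tA) in sA.
Qed.

Lemma free_ext (V : lmodType R) (f g : {linear freem -> V}) :
  (forall t, f (delta t) = g (delta t)) -> f =1 g.
Proof.
move=> fg x; have [A xA] := free_supp x.
rewrite (free_delta x) (freeliftE _ xA) !linear_sum /=.
by apply: eq_bigr => t _; rewrite !linearZ /= fg.
Qed.
End Free.

Section Tensor.
Variable R : comPzRingType.

Definition tensor_rel (M N : lmodType R) : set (freem R (M * N)%type) :=
  let e m n := delta R (m, n) in
  [set z | (exists m m' n, z = e (m + m') n - e m n - e m' n) \/
           (exists m n n', z = e m (n + n') - e m n - e m n') \/
           (exists r m n, z = e (r *: m) n - r *: e m n) \/
           (exists r m n, z = e m (r *: n) - r *: e m n)].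

Definition tensor (M N : lmodType R) : lmodType R :=
  quotm (submod_span (@tensor_rel M N)).

Definition tens (M N : lmodType R) (m : M) (n : N) : tensor M N :=
  quot_pi _ (delta R (m, n)).

Section PureTensors.
Variables M N : lmodType R.
Lemma tensor_rel0 z : @tensor_rel M N z ->
  quot_pi (submod_span (@tensor_rel M N)) z = 0.
Proof. by move=> zz; apply/quot_pi0/mem_span. Qed.
Lemma tensDl (m m' : M) (n : N) : tens (m + m') n = tens m n + tens m' n.
Proof.
apply/eqP; rewrite -subr_eq0 opprD addrA /tens -!linearB; apply/eqP.
by apply: tensor_rel0; left; exists m, m', n.
Qed.
Lemma tensDr (m : M) (n n' : N) : tens m (n + n') = tens m n + tens m n'.
Proof.
apply/eqP; rewrite -subr_eq0 opprD addrA /tens -!linearB; apply/eqP.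
by apply: tensor_rel0; right; left; exists m, n, n'.
Qed.
Lemma tensZl r (m : M) (n : N) : tens (r *: m) n = r *: tens m n.
Proof.
apply/eqP; rewrite -subr_eq0 /tens -linearZ /= -linearB; apply/eqP.
by apply: tensor_rel0; right; right; left; exists r, m, n.
Qed.
Lemma tensZr r (m : M) (n : N) : tens m (r *: n) = r *: tens m n.
Proof.
apply/eqP; rewrite -subr_eq0 /tens -linearZ /= -linearB; apply/eqP.
by apply: tensor_rel0; right; right; right; exists r, m, n.
Qed.

Lemma tensor_ext (W : lmodType R) (f g : {linear tensor M N -> W}) :
  (forall m n, f (tens m n) = g (tens m n)) -> f =1 g.
Proof.
move=> fg x; rewrite -(quot_reprK x).
by apply: (@free_ext _ _ W (f \o quot_pi _) (g \o quot_pi _)) => -[m n]; exact: fg.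
Qed.
End PureTensors.

Section TensorMap.
Variables (M N M' N' : lmodType R) (f : {linear M -> M'}) (g : {linear N -> N'}).

Definition tensor_map0 : {linear freem R (M * N)%type -> tensor M' N'} :=
  freelift (fun p => tens (f p.1) (g p.2)).

Lemma tensor_map0P x : x \in submod_span (@tensor_rel M N) -> tensor_map0 x = 0.
Proof.
move=> xS; suff: x \in kerm tensor_map0 by move/eqP.
apply: span_sub xS => {}x xrel; apply/eqP; move: xrel.
case=> [[m [m' [n ->]]]|[[m [n [n' ->]]]|[[r [m [n ->]]]|[r [m [n ->]]]]]];
  rewrite !linearB /= ?linearZ /= !freelift_delta /= ?linearD ?linearZ /=
    ?tensDl ?tensDr ?tensZl ?tensZr ?subrr //.
- by rewrite addrAC addrK subrr.
- by rewrite addrAC addrK subrr.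
- by rewrite -scalerDr subrr scaler0.
- by rewrite -scalerDr subrr scaler0.
Qed.

Definition tensor_map : tensor M N -> tensor M' N' := quot_lift tensor_map0P.
HB.instance Definition _ := GRing.Linear.copy tensor_map (quot_lift tensor_map0P).

Lemma tensor_map_tens m n : tensor_map (tens m n) = tens (f m) (g n).
Proof.
rewrite /tensor_map /tens quot_liftE; exact: freelift_delta.
Qed.
End TensorMap.


Lemma tensor_map_comp (M N M' N' M'' N'' : lmodType R)
    (f : {linear M -> M'}) (g : {linear N -> N'})
    (f' : {linear M' -> M''}) (g' : {linear N' -> N''}) x :
  tensor_map f' g' (tensor_map f g x) = tensor_map (f' \o f) (g' \o g) x.
Proof.
apply: (@tensor_ext _ _ _ (tensor_map f' g' \o tensor_map f g)) => m n.
by rewrite /= !tensor_map_tens.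
Qed.

Lemma tensor_map_swap (M N M' N' : lmodType R)
    (f : {linear M -> M'}) (g : {linear N -> N'}) x :
  tensor_map f (@idfun N') (tensor_map (@idfun M) g x) =
  tensor_map (@idfun M') g (tensor_map f (@idfun N) x).
Proof.
apply: (@tensor_ext _ _ _ (tensor_map f (@idfun N') \o tensor_map (@idfun M) g)
  (tensor_map (@idfun M') g \o tensor_map f (@idfun N))) => m n.
by rewrite /= !tensor_map_tens.
Qed.

Lemma tensor_map_eq0 (M N M' N' : lmodType R)
    (f : {linear M -> M'}) (g : {linear N -> N'}) x :
  (forall m n, tens (f m) (g n) = 0) -> tensor_map f g x = 0.
Proof.
move=> fg0; apply: (@tensor_ext _ _ _ (tensor_map f g) \0) => m n.
by rewrite /= tensor_map_tens fg0.
Qed.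

Lemma tens0l (M N : lmodType R) (n : N) : tens (0 : M) n = 0.
Proof. by rewrite -(scale0r (0 : M)) tensZl scale0r. Qed.
Lemma tens0r (M N : lmodType R) (m : M) : tens m (0 : N) = 0.
Proof. by rewrite -(scale0r (0 : N)) tensZr scale0r. Qed.

End Tensor.

(** * Complexes *)

Definition trivial_module (R : pzRingType) (M : lmodType R) : Prop :=
  forall x : M, x = 0.

Definition finitely_generated (R : pzRingType) (M : lmodType R) : Prop :=
  exists s : seq M, forall x, x \in submod_span [set` s].

(* Homological grading.  The differential is given for all pairs of degrees,
   only [dif i j] with [i = j + 1] being possibly nonzero; this avoids casts
   between [X (n - 1 + 1)] and [X n]. *)
Record complex (R : pzRingType) := Complex {
  obj :> int -> lmodType R;
  dif : forall i j, {linear obj i -> obj j};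
  dif_shape : forall i j, i != j + 1 -> forall x, dif i j x = 0;
  dif_dif : forall i j k x, dif j k (dif i j x) = 0
}.
Arguments dif {R} X i j : rename.

Section Homology.
Variables (R : pzRingType) (X : complex R) (n : int).

Definition cycles : submodClosed (X n) := kerm (dif X n (n - 1)).

Definition boundary_pred (x : subm cycles) : bool :=
  `[< exists y, val x = dif X (n + 1) n y >].
Lemma boundary_closed : GRing.subsemimod_closed boundary_pred.
Proof.
apply: mk_submod => [|x y /asboolP[x' xx'] /asboolP[y' yy']|c x /asboolP[x' xx']];
  apply/asboolP.
- by exists 0; rewrite linear0.
- by exists (x' + y'); rewrite linearD -xx' -yy'.
- by exists (c *: x'); rewrite linearZ_LR -xx'.
Qed.
HB.instance Definition _ :=
  GRing.isSubmodClosed.Build R (subm cycles) boundary_pred boundary_closed.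
Definition boundaries : submodClosed (subm cycles) :=
  GRing.SubmodClosed.clone _ _ boundary_pred _.

Definition homology : lmodType R := quotm boundaries.
End Homology.

Record chain_map (R : pzRingType) (X Y : complex R) := ChainMap {
  cmap :> forall n, {linear X n -> Y n};
  cmap_d : forall i j x, cmap j (dif X i j x) = dif Y i j (cmap i x)
}.

Section HomologyMap.
Variables (R : pzRingType) (X Y : complex R) (f : chain_map X Y) (n : int).

Lemma cycles_map x : x \in cycles X n -> f n x \in cycles Y n.
Proof. by move=> /eqP xZ; apply/eqP; rewrite -cmap_d xZ linear0. Qed.

Definition cycles_homology : {linear subm (cycles X n) -> homology Y n} :=
  quot_pi (boundaries Y n) \o restr cycles_map.

Lemma boundaries_map x : x \in boundaries X n -> cycles_homology x = 0.
Proof.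
move=> /asboolP[y xy]; apply/quot_pi0/asboolP; exists (f (n + 1) y).
by rewrite /= -cmap_d -xy.
Qed.

Definition homology_map : homology X n -> homology Y n :=
  quot_lift boundaries_map.
HB.instance Definition _ :=
  GRing.Linear.copy homology_map (quot_lift boundaries_map).
End HomologyMap.
Arguments homology_map {R X Y} f n x.

Definition acyclic (R : pzRingType) (X : complex R) : Prop :=
  forall n, trivial_module (homology X n).

Definition quasi_iso (R : pzRingType) (X Y : complex R) (f : chain_map X Y) :
  Prop := forall n, bijective (homology_map f n).

Section ZeroComplex.
Variable R : pzRingType.
Let Z0 : lmodType R := 'cV[R]_0.
Definition zero_complex : complex R :=
  @Complex R (fun=> Z0) (fun _ _ => idfun)
    (fun _ _ _ x => flatmx0 x) (fun _ _ _ x => flatmx0 x).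
End ZeroComplex.

(* Some complex satisfying [P]; the zero complex is only returned when there is
   none, which never happens for the resolutions below. *)
Definition choose_complex (R : pzRingType) (P : complex R -> Prop) : complex R :=
  if pselect (exists X, P X) is left h then projT1 (cid h) else zero_complex R.

(** * Derived tensor product *)

Section TensorComplex.
Variables (R : comPzRingType) (X Y : complex R).

(* The total module: families indexed by all bidegrees. *)
Definition bimod (p : int * int) : lmodType R := tensor (X p.1) (Y p.2).

Definition tensor_obj (n : int) : submodClosed (prodm bimod) :=
  dsum bimod [set p | p.1 + p.2 = n].

(* d (x (x) y) = d x (x) y + (-1)^|x| x (x) d y *)
Definition tensor_diff (x : prodm bimod) : prodm bimod := fun p =>
  tensor_map (dif X (p.1 + 1) p.1) idfun (x (p.1 + 1, p.2)) +
  (-1) ^+ absz p.1 *: tensor_map idfun (dif Y (p.2 + 1) p.2) (x (p.1, p.2 + 1)).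

Lemma tensor_diffE x p : tensor_diff x p =
  tensor_map (dif X (p.1 + 1) p.1) idfun (x (p.1 + 1, p.2)) +
  (-1) ^+ absz p.1 *: tensor_map idfun (dif Y (p.2 + 1) p.2) (x (p.1, p.2 + 1)).
Proof. by []. Qed.

Lemma tensor_diff_linear : linear tensor_diff.
Proof.
move=> c x y; apply: functional_extensionality_dep => p.
pose u := tensor_map (dif X (p.1 + 1) p.1) (@idfun (Y p.2)).
pose v := tensor_map (@idfun (X p.1)) (dif Y (p.2 + 1) p.2).
pose e : R := (-1) ^+ absz p.1.
pose x1 := x (p.1 + 1, p.2); pose x2 := x (p.1, p.2 + 1).
pose y1 := y (p.1 + 1, p.2); pose y2 := y (p.1, p.2 + 1).
change (u (c *: x1 + y1) + e *: v (c *: x2 + y2) =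
        c *: (u x1 + e *: v x2) + (u y1 + e *: v y2)).
have lin (U U' W : lmodType R) (f : {linear U -> W}) (g : {linear U' -> W}) s s' t t' :
    f (c *: s + s') + e *: g (c *: t + t') =
    c *: (f s + e *: g t) + (f s' + e *: g t').
  by rewrite !linearP scalerDr addrACA.
exact: (lin _ _ _ (tensor_map (dif X (p.1 + 1) p.1) (@idfun (Y p.2)))
                  (tensor_map (@idfun (X p.1)) (dif Y (p.2 + 1) p.2))).
Qed.
HB.instance Definition _ :=
  GRing.isLinear.Build R _ _ *:%R tensor_diff tensor_diff_linear.

Lemma sign_absz_succ (i : int) :
  (-1) ^+ absz (i + 1) = - (-1) ^+ absz i :> R.
Proof.
case: i => [k|k]; first by rewrite -PoszD /= addn1 exprS mulN1r.
have -> : Negz k + 1 = - k%:Z by rewrite NegzE -addn1 PoszD opprD addrNK.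
by rewrite abszN /= exprS mulN1r opprK.
Qed.

Lemma tensor_diff_diff x : tensor_diff (tensor_diff x) = 0.
Proof.
apply: functional_extensionality_dep => -[i j].
pose A := tensor_map (dif X (i + 1) i) (@idfun (Y j)).
pose A1 := tensor_map (dif X (i + 1 + 1) (i + 1)) (@idfun (Y j)).
pose A2 := tensor_map (dif X (i + 1) i) (@idfun (Y (j + 1))).
pose B := tensor_map (@idfun (X i)) (dif Y (j + 1) j).
pose B1 := tensor_map (@idfun (X (i + 1))) (dif Y (j + 1) j).
pose B2 := tensor_map (@idfun (X i)) (dif Y (j + 1 + 1) (j + 1)).
pose e : R := (-1) ^+ absz i; pose e1 : R := (-1) ^+ absz (i + 1).
pose x20 := x (i + 1 + 1, j); pose x11 := x (i + 1, j + 1).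
pose x02 := x (i, j + 1 + 1).
change (A (A1 x20 + e1 *: B1 x11) + e *: B (A2 x11 + e *: B2 x02) = 0).
have AA : A (A1 x20) = 0.
  by rewrite /A /A1 tensor_map_comp tensor_map_eq0 // => m n; rewrite /= dif_dif tens0l.
have BB : B (B2 x02) = 0.
  by rewrite /B /B2 tensor_map_comp tensor_map_eq0 // => m n; rewrite /= dif_dif tens0r.
have AB : A (B1 x11) = B (A2 x11) by exact: tensor_map_swap.
have -> : e1 = - e by exact: sign_absz_succ.
have lin (U U' W : lmodType R) (f : {linear U -> W}) (g : {linear U' -> W}) s t s' t' :
    f s = 0 -> g t' = 0 -> f t = g s' ->
    f (s + - e *: t) + e *: g (s' + e *: t') = 0.
  move=> fs gt ft; rewrite (linearD f) (linearD g) (linearZ_LR f) (linearZ_LR g).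
  by rewrite fs gt ft scaler0 add0r addr0 scaleNr addNr.
exact: (lin _ _ _ (tensor_map (dif X (i + 1) i) (@idfun (Y j)))
                  (tensor_map (@idfun (X i)) (dif Y (j + 1) j)) _ _ _ _ AA BB AB).
Qed.

Lemma tensor_diff_deg n x :
  x \in tensor_obj (n + 1) -> tensor_diff x \in tensor_obj n.
Proof.
move=> /asboolP[xfin xdeg]; apply/asboolP.
have sx : [set p | tensor_diff x p <> 0] `<=`
    (fun p => (p.1 - 1, p.2)) @` [set p | x p <> 0] `|`
    (fun p => (p.1, p.2 - 1)) @` [set p | x p <> 0].
  move=> p /= xp; have [x1|x1] := pselect (x (p.1 + 1, p.2) = 0); last first.
    by left; exists (p.1 + 1, p.2) => //=; rewrite addrK -surjective_pairing.
  have [x2|x2] := pselect (x (p.1, p.2 + 1) = 0); last first.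
    by right; exists (p.1, p.2 + 1) => //=; rewrite addrK -surjective_pairing.
  case: xp; rewrite tensor_diffE x1 x2.
  by rewrite !(linear0 (tensor_map _ _)) scaler0 addr0.
split.
  by apply: sub_finite_set sx _; rewrite finite_setU; split; exact: finite_image.
move=> p /sx[] [q /xdeg /= qn <-] /=; apply: (addIr 1); rewrite -qn.
  by rewrite addrAC addrNK.
by rewrite -addrA addrNK.
Qed.

Definition tensor_dfun (i j : int) (x : prodm bimod) : prodm bimod :=
  if i == j + 1 then tensor_diff x else 0.
Lemma tensor_dfun_linear i j : linear (tensor_dfun i j).
Proof.
move=> c x y; rewrite /tensor_dfun; case: eqP => _; first exact: linearP.
by rewrite scaler0 addr0.
Qed.
HB.instance Definition _ i j :=
  GRing.isLinear.Build R _ _ *:%R (tensor_dfun i j) (@tensor_dfun_linear i j).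
Lemma tensor_dfun_deg i j x :
  x \in tensor_obj i -> tensor_dfun i j x \in tensor_obj j.
Proof.
rewrite /tensor_dfun; case: eqP => [->|_ _]; first exact: tensor_diff_deg.
exact: rpred0.
Qed.

Definition tensor_d i j : {linear subm (tensor_obj i) -> subm (tensor_obj j)} :=
  restr (@tensor_dfun_deg i j).

Lemma tensor_d_shape i j : i != j + 1 -> forall x, tensor_d i j x = 0.
Proof.
by move=> /negbTE ij x; apply: val_inj; rewrite /= /tensor_dfun ij.
Qed.
Lemma tensor_d_d i j k x : tensor_d j k (tensor_d i j x) = 0.
Proof.
apply: val_inj; rewrite /= /tensor_dfun; case: eqP => // _; case: eqP => _.
  exact: tensor_diff_diff.
by rewrite linear0.
Qed.

Definition tensor_complex : complex R := Complex tensor_d_shape tensor_d_d.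
End TensorComplex.

(* K-flat in the sense of Spaltenstein: tensoring preserves acyclicity. *)
Definition K_flat (R : comPzRingType) (P : complex R) : Prop :=
  forall A : complex R, acyclic A -> acyclic (tensor_complex P A).

Definition K_flat_resolution (R : comPzRingType) (X P : complex R) : Prop :=
  K_flat P /\ exists f : chain_map P X, quasi_iso f.

(* The derived tensor product, up to isomorphism in the derived category: every
   complex has a K-flat resolution and any two give isomorphic results. *)
Definition Ltensor (R : comPzRingType) (X Y : complex R) : complex R :=
  tensor_complex (choose_complex (K_flat_resolution X)) Y.

(** * Local cohomology *)

Definition injective_module (R : pzRingType) (E : lmodType R) : Prop :=
  forall (U V : lmodType R) (i : {linear U -> V}) (f : {linear U -> E}),
    injective i -> exists g : {linear V -> E}, forall u, g (i u) = f u.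

(* 0 -> M -> I_0 -> I_(-1) -> I_(-2) -> ... is exact with injective I_n *)
Definition injective_resolution (R : pzRingType) (M : lmodType R)
    (I : complex R) : Prop :=
  [/\ forall n, injective_module (I n),
      forall n, 0 < n -> trivial_module (I n),
      exists eps : {linear M -> I 0}, injective eps /\
        forall x, dif I 0 (-1) x = 0 <-> exists m, eps m = x &
      forall n, n < 0 -> trivial_module (homology I n)].

Section Torsion.
Variables (R : comPzRingType) (a : ideal R).

Definition ideal_pow (n : nat) : ideal R :=
  submod_span [set r : R^o | exists f : 'I_n -> R,
    (forall i, (f i : R^o) \in a) /\ r = \prod_i f i].

Lemma ideal_powS m n r : (m <= n)%N -> r \in ideal_pow n -> r \in ideal_pow m.
Proof.
move=> mn; apply: span_sub => _ [f [fa ->]].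
move: f fa; rewrite -(subnKC mn) => f fa.
rewrite big_split_ord /= mulrC.
apply: (@rpredZ _ R^o) (\prod_i f (rshift m i)) _ _.
by apply: mem_span; exists (fun i => f (lshift _ i)).
Qed.

Section Module.
Variable M : lmodType R.
Definition torsion_pred (x : M) : bool :=
  `[< exists n, forall r : R, (r : R^o) \in ideal_pow n -> r *: x = 0 >].
Lemma torsion_closed : GRing.subsemimod_closed torsion_pred.
Proof.
apply: mk_submod => [|x y /asboolP[m xm] /asboolP[n yn]|c x /asboolP[n xn]];
  apply/asboolP.
- by exists 0%N => r _; rewrite scaler0.
- exists (maxn m n) => r rmn; rewrite scalerDr xm ?yn ?addr0 //.
    by apply: ideal_powS rmn; exact: leq_maxr.
  by apply: ideal_powS rmn; exact: leq_maxl.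
- by exists n => r rn; rewrite scalerA mulrC -scalerA xn // scaler0.
Qed.
HB.instance Definition _ :=
  GRing.isSubmodClosed.Build R M torsion_pred torsion_closed.
Definition torsion : submodClosed M :=
  GRing.SubmodClosed.clone _ _ torsion_pred _.
End Module.

Lemma torsion_map (M N : lmodType R) (f : {linear M -> N}) x :
  x \in torsion M -> f x \in torsion N.
Proof.
move=> /asboolP[n xn]; apply/asboolP; exists n => r rn.
by rewrite -linearZ_LR xn // linear0.
Qed.

(* The functor Gamma_a applied degreewise *)
Definition torsion_d (X : complex R) i j :
    {linear subm (torsion (X i)) -> subm (torsion (X j))} :=
  restr (@torsion_map _ _ (dif X i j)).
Lemma torsion_d_shape (X : complex R) i j :
  i != j + 1 -> forall x, torsion_d X i j x = 0.
Proof. by move=> ij x; apply: val_inj; rewrite /= dif_shape. Qed.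
Lemma torsion_d_d (X : complex R) i j k x :
  torsion_d X j k (torsion_d X i j x) = 0.
Proof. by apply: val_inj; rewrite /= dif_dif. Qed.
Definition torsion_complex (X : complex R) : complex R :=
  Complex (@torsion_d_shape X) (@torsion_d_d X).

Definition local_cohomology (i : int) (M : lmodType R) : lmodType R :=
  homology (torsion_complex (choose_complex (injective_resolution M))) (- i).

(** * Cohomological dimension *)

(* The order-theoretic supremum in [\bar int], with [sup set0 = -oo] *)
Definition sup_int (S : set (\bar int)) : \bar int := supremum -oo%E S.

Definition cd (M : lmodType R) : \bar int :=
  sup_int [set i%:E | i in [set i | ~ trivial_module (local_cohomology i M)]].

Definition cdC (X : complex R) : \bar int :=
  sup_int [set (cd (homology X l) - l%:E)%E | l in setT].
End Torsion.

(** * Hypotheses on rings and complexes *)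

Definition noetherian (R : pzRingType) : Prop :=
  forall I : ideal R, exists s : seq R^o, forall x, (x \in I) = (x \in submod_span [set` s]).

Definition prime_ideal (R : comPzRingType) (p : ideal R) : Prop :=
  (1 : R^o) \notin p /\
  forall x y : R, (x * y : R^o) \in p -> (x : R^o) \in p \/ (y : R^o) \in p.

(* There is a bound on the lengths of strictly increasing chains of primes. *)
Definition finite_krull_dim (R : comPzRingType) : Prop :=
  exists N : nat, forall (n : nat) (p : 'I_n.+1 -> ideal R),
    (forall i, prime_ideal (p i)) ->
    (forall i j : 'I_n.+1, (i < j)%N -> [set` p i] `<` [set` p j]) ->
    (n <= N)%N.

Definition Df_plus (R : pzRingType) (X : complex R) : Prop :=
  (exists n0 : int, forall l, l < n0 -> trivial_module (homology X l)) /\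
  (forall l, finitely_generated (homology X l)).

(* Main.v *)
From HB Require Import structures.
Require Import Defs.
From mathcomp Require Import all_boot all_order all_algebra.
From mathcomp Require Import zify.
From mathcomp Require Import all_classical constructive_ereal.
Set Implicit Arguments.
Unset Strict Implicit.
Unset Printing Implicit Defensive.
Import Order.TTheory GRing.Theory Num.Theory.
Local Open Scope classical_set_scope.
Local Open Scope ring_scope.

(** Write W for the derived tensor product of X and Y.  The cohomological dimension
    of a finitely generated module only depends on its support, and the supports of
    the homology of W in low degrees are the supports of the modules H_t(X) (x) H_l(Y)
    in low total degrees.  Precisely, a prime p in the support of H_n(W) lies in the
    support of some H_t(X) (x) H_l(Y) with t + l <= n, and a prime in the support of
    H_t(X) (x) H_l(Y) lies in the support of some H_n(W) with n <= t + l
    ([supp_homology_tensor], [supp_tensor_homology]).  This makes the upper bounds of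
    the two families of integers the same.  After localisation at p the reason is
    that the first nonzero homology of W sits in the sum of the first degrees t and
    l where the homology of X and Y is nonzero, and is H_t(X) (x) H_l(Y), nonzero by
    Nakayama.

    Localisation is avoided throughout: p lies in the support of M when every element
    killing M is in p.  The homology of X and Y below t and l is killed by some s
    outside p.  W is computed by bounded below complexes P and Q of finitely generated
    free modules ([Ltensor_resolutions]), and on P a power of s is homotopic to zero
    below t ([kill_homotopy]).  Hence a power of s kills the homology of W below t + l
    ([kill_tensor_homology]); in degree t + l, what kills the homology of W also
    kills H_t(X) (x) H_l(Y) up to a power of s ([kill_bottom_tensor]).  Nakayama's lemma
    takes the form of a nonzero map from a finitely generated module to R/p
    ([supp_map]).

    The dependence on supports ([van_support]) is a devissage: if H^j vanishes, for
    all j >= i, on modules whose supports cover that of N, then H^i(N) = 0.  It uses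
    descending induction on i and Noetherian induction on the annihilators of cyclic
    modules, the case of R/p being settled by the nonzero map from a module of the
    family to R/p.  The descending induction starts because local cohomology vanishes
    above the number of generators of the ideal ([van_bound]), which is proved one
    generator at a time on an injective resolution.

    Vanishing of local cohomology is handled by the predicate [van], defined by
    dimension shifting over all embeddings into injective modules.  It is independent
    of choices by Schanuel's lemma, satisfies the two halves of the long exact sequence
    that are needed ([van_ext], [van_quot]), and agrees with the vanishing of the
    chosen local cohomology modules ([local_cohomology_van]).  Enough injectives come
    from divisible groups; free resolutions are built degree by degree. *)

(** * Submodules, linear maps and finite generation *)

Definition submodule_set (R : pzRingType) (V : lmodType R) (S : V -> Prop) :=
  [/\ S 0, forall x y, S x -> S y -> S (x + y) &
      forall (c : R) x, S x -> S (c *: x)].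

Section MakeSubmodule.
Variables (R : pzRingType) (V : lmodType R) (S : V -> Prop).
Hypothesis SP : submodule_set S.

Lemma sub_of_closed : GRing.subsemimod_closed (fun x : V => `[< S x >]).
Proof.
have [S0 SD SZ] := SP; apply: mk_submod; first exact/asboolP.
  by move=> x y /asboolP Sx /asboolP Sy; apply/asboolP; exact: SD.
by move=> c x /asboolP Sx; apply/asboolP; exact: SZ.
Qed.

Definition sub_of : submodClosed V :=
  HB.pack (fun x : V => `[< S x >])
    (GRing.isSubmodClosed.Build R V (fun x : V => `[< S x >]) sub_of_closed).

Lemma sub_ofP x : reflect (S x) (x \in sub_of).
Proof. exact: asboolP. Qed.
End MakeSubmodule.

Section SubmoduleOpp.
Variables (R : pzRingType) (V : lmodType R) (N : submodClosed V).
Lemma submodN x : x \in N -> - x \in N.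
Proof. by move=> xN; rewrite -scaleN1r rpredZ. Qed.
Lemma submodB x y : x \in N -> y \in N -> x - y \in N.
Proof. by move=> xN yN; rewrite rpredD // submodN. Qed.
End SubmoduleOpp.

Lemma quot_pi_eq0 (R : pzRingType) (V : lmodType R) (N : submodClosed V) x :
  (quot_pi N x = 0) <-> (x \in N).
Proof.
split=> [x0|]; last exact: quot_pi0.
by rewrite -[x]subr0; apply/quot_piP; rewrite x0 linear0.
Qed.

Definition subm_mk (R : pzRingType) (V : lmodType R) (N : submodClosed V) (x : V)
  (xN : x \in N) : subm N := exist _ x xN.

Lemma val_submP (R : pzRingType) (V : lmodType R) (N : submodClosed V) (c : R)
  (x y : subm N) : val (c *: x + y) = c *: val x + val y.
Proof. exact: linearP. Qed.

Section MakeLinear.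
Variables (R : pzRingType) (U V : lmodType R) (f : U -> V) (lin_f : linear f).
Definition lin_of : {linear U -> V} :=
  HB.pack f (GRing.isLinear.Build R U V *:%R f lin_f).
Lemma lin_ofE x : lin_of x = f x. Proof. by []. Qed.
End MakeLinear.

Definition surj (U V : Type) (f : U -> V) := forall y, exists x, f x = y.

Lemma span_consP (R : pzRingType) (V : lmodType R) (m : V) (s : seq V) x :
  x \in submod_span [set` m :: s] <->
  exists r, exists2 y, y \in submod_span [set` s] & x = r *: m + y.
Proof.
split=> [|[r [y ys ->]]]; last first.
  rewrite rpredD // ?rpredZ //; first by apply: mem_span; exact: mem_head.
  apply: span_sub ys => z /= zs; apply: mem_span => /=.
  by rewrite in_cons zs orbT.
pose S x := exists r, exists2 y, y \in submod_span [set` s] & x = r *: m + y.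
have SP : submodule_set S.
  split=> [|u v|c u].
  - by exists 0, 0; [exact: rpred0 | rewrite scale0r addr0].
  - move=> [a [y ys ->]] [b [z zs ->]]; exists (a + b), (y + z).
      exact: rpredD.
    by rewrite scalerDl addrACA.
  - move=> [a [y ys ->]]; exists (c * a), (c *: y); first exact: rpredZ.
    by rewrite scalerDr scalerA.
move=> /(span_sub (N := sub_of SP)) h; apply/(sub_ofP SP)/h.
move=> z /=; rewrite in_cons => /orP[/eqP ->|zs]; apply/(sub_ofP SP).
  by exists 1, 0; [exact: rpred0 | rewrite scale1r addr0].
by exists 0, z; [exact: mem_span | rewrite scale0r add0r].
Qed.

Lemma span_nilP (R : pzRingType) (V : lmodType R) (x : V) :
  x \in submod_span [set` [::]] -> x = 0.
Proof.
have SP : submodule_set (fun x : V => x = 0).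
  split=> // [u v -> ->|c u ->]; first by rewrite addr0.
  by rewrite scaler0.
by move=> /(span_sub (N := sub_of SP)) h; apply/(sub_ofP SP)/h.
Qed.

Lemma span_map (R : pzRingType) (U V : lmodType R) (f : {linear U -> V})
    (s : seq U) x :
  x \in submod_span [set` s] -> f x \in submod_span [set` map f s].
Proof.
have SP : submodule_set (fun x => f x \in submod_span [set` map f s]).
  split=> [|u v uS vS|c u uS]; first by rewrite linear0 rpred0.
    by rewrite linearD rpredD.
  by rewrite linearZ_LR rpredZ.
move=> xs; apply/(sub_ofP SP); apply: span_sub xs => z /= zs.
by apply/(sub_ofP SP); apply: mem_span => /=; exact: map_f.
Qed.

Section FiniteGeneration.
Variable R : comPzRingType.
Implicit Types U V : lmodType R.

Definition lincomb V (s : seq V) (v : 'rV[R]_(size s)) : V :=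
  \sum_(i < size s) v 0 i *: s`_i.
Lemma lincomb_linear V (s : seq V) : linear (@lincomb V s).
Proof.
move=> c u v; rewrite /lincomb scaler_sumr -big_split /=.
by apply: eq_bigr => i _; rewrite !mxE scalerDl scalerA.
Qed.
HB.instance Definition _ V (s : seq V) :=
  GRing.isLinear.Build R _ V *:%R (@lincomb V s) (@lincomb_linear V s).

Lemma lincomb_span V (s : seq V) x :
  x \in submod_span [set` s] <-> exists v, lincomb (s := s) v = x.
Proof.
split=> [|[v <-]]; last first.
  by apply: rpred_sum => i _; rewrite rpredZ //; apply/mem_span/mem_nth.
elim: s x => [|m s IH] x.
  by move=> /span_nilP ->; exists 0; rewrite linear0.
move=> /span_consP[r [y /IH[v vy] ->]].
exists (\row_(i < (size s).+1)
          if unlift ord0 i is Some j then v 0 j else r) => /=.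
rewrite /lincomb big_ord_recl !mxE unlift_none -vy; congr (_ + _).
by apply: eq_bigr => i _; rewrite !mxE liftK.
Qed.

Lemma fg_rowP V : finitely_generated V <->
  exists k (f : {linear 'rV[R]_k -> V}), surj f.
Proof.
split=> [[s sV]|[k [f fV]]].
  by exists (size s), (@lincomb V s) => x; apply/lincomb_span.
exists [seq f (delta_mx 0 i) | i <- enum 'I_k] => y; have [x <-] := fV y.
rewrite [x]row_sum_delta linear_sum; apply: rpred_sum => i _.
rewrite linearZ_LR rpredZ //; apply: mem_span => /=.
by apply: map_f; rewrite mem_enum.
Qed.

Lemma fg_image U V (f : {linear U -> V}) :
  surj f -> finitely_generated U -> finitely_generated V.
Proof.
move=> fV /fg_rowP[k [g gU]]; apply/fg_rowP; exists k, (f \o g) => y.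
by have [x <-] := fV y; have [z <-] := gU x; exists z.
Qed.

Definition fg_sub V (N : submodClosed V) : Prop :=
  exists s : seq V, forall x, (x \in N) = (x \in submod_span [set` s]).

Lemma fg_subm V (N : submodClosed V) : fg_sub N -> finitely_generated (subm N).
Proof.
move=> [s sN]; apply/fg_rowP.
have inN v : @lincomb V s v \in N by rewrite sN; apply/lincomb_span; exists v.
have lin : linear (fun v => exist _ (@lincomb V s v) (inN v) : subm N).
  by move=> c u v; apply: val_inj; rewrite /= linearP.
exists (size s), (lin_of lin) => x.
have := valP x; rewrite sN => /lincomb_span[v vx].
by exists v; apply: val_inj.
Qed.

Hypothesis noethR : noetherian R.

(** Hilbert's basis argument, one generator at a time: the coefficients of the
    first generator [m] in elements of [N] form a finitely generated ideal
    [sub_of bP], and what remains lies in the span of the other generators. *)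
Lemma noetherian_span V (s : seq V) (N : submodClosed V) :
  (forall x, x \in N -> x \in submod_span [set` s]) -> fg_sub N.
Proof.
elim: s N => [|m s IH] N Ns.
  exists [::] => x; apply/idP/idP=> [/Ns //|/span_nilP ->]; exact: rpred0.
pose S := submod_span [set` s].
have bP : submodule_set (fun r : R^o => exists2 y, y \in S & r *: m + y \in N).
  split=> [|r r' [y ys yN] [y' ys' yN']|c r [y ys yN]].
  - by exists 0; rewrite ?scale0r ?addr0 rpred0.
  - exists (y + y'); first exact: rpredD.
    by rewrite scalerDl addrACA rpredD.
  - exists (c *: y); first exact: rpredZ.
    by rewrite -[c *: r]/(c * r) -scalerA -scalerDr rpredZ.
have NSP : submodule_set (fun x : V => x \in N /\ x \in S).
  split=> [|x y [xN xS] [yN yS]|c x [xN xS]]; first by rewrite !rpred0.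
    by rewrite !rpredD.
  by rewrite !rpredZ.
have [t tP] : fg_sub (sub_of NSP) by apply: IH => x /sub_ofP[].
have [q qP] := noethR (sub_of bP).
have [q' [q'N q'P]] : exists q' : seq V, (forall x, x \in q' -> x \in N) /\
    forall r, r \in submod_span [set` q] ->
      exists2 z, z \in submod_span [set` q'] & z - r *: m \in S.
  have : forall r, r \in q -> r \in sub_of bP.
    by move=> r rq; rewrite qP; exact: mem_span.
  elim: (q) => [|r l IHl] lb.
    exists [::]; split=> // r /span_nilP ->.
    by exists 0; rewrite ?scale0r ?subr0 rpred0.
  have [|l' [l'N l'P]] := IHl; first by move=> z zl; rewrite lb // in_cons zl orbT.
  have /sub_ofP[y yS yN] := lb r (mem_head _ _).
  exists ((r *: m + y) :: l'); split=> [x|x].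
    by rewrite in_cons => /orP[/eqP -> //|/l'N].
  move=> /span_consP[c [r' /l'P[z zl' zr'] ->]].
  exists (c *: (r *: m + y) + z).
    by apply/span_consP; exists c, z.
  rewrite -[c *: r]/(c * r) scalerDl -scalerA scalerDr opprD addrACA.
  by rewrite [c *: _ + _]addrC addrK rpredD // rpredZ.
exists (q' ++ t) => x; apply/idP/idP => [xN|]; last first.
  apply: span_sub => z /=; rewrite mem_cat => /orP[/q'N //|zt].
  have : z \in sub_of NSP by rewrite tP; exact: mem_span.
  by move=> /sub_ofP[].
have sub1 z : z \in submod_span [set` q'] -> z \in submod_span [set` q' ++ t].
  by apply: span_sub => w /= wq; apply: mem_span; rewrite /= mem_cat wq.
have sub2 z : z \in submod_span [set` t] -> z \in submod_span [set` q' ++ t].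
  by apply: span_sub => w /= wq; apply: mem_span; rewrite /= mem_cat wq orbT.
have /span_consP[r [y yS xE]] := Ns _ xN.
have /q'P[z zq' zr] : r \in submod_span [set` q].
  by rewrite -qP; apply/sub_ofP; exists y; rewrite -?xE.
have zN : z \in N by apply: span_sub zq' => w /=; exact: q'N.
rewrite -[x](subrK z) rpredD //; last exact: sub1.
apply: sub2; rewrite -tP; apply/sub_ofP; split; first exact: submodB.
by rewrite xE addrAC -opprB addrC submodB.
Qed.

Lemma fg_submodule V (N : submodClosed V) :
  finitely_generated V -> fg_sub N.
Proof. by move=> [s sV]; apply: (noetherian_span (s := s)) => x _. Qed.

Lemma fg_subm_noeth V (N : submodClosed V) :
  finitely_generated V -> finitely_generated (subm N).
Proof. by move=> /fg_submodule/fg_subm. Qed.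

End FiniteGeneration.

(** * Supports detected by maps to a domain *)

Definition kills (R : pzRingType) (M : lmodType R) (r : R) : Prop :=
  forall x : M, r *: x = 0.

(** For finitely generated [M] and prime [p] this says that [p] lies in the
    support of [M]. *)
Definition supp (R : comPzRingType) (p : ideal R) (M : lmodType R) : Prop :=
  forall r : R, kills M r -> (r : R^o) \in p.

Section Homothety.
Variables (R : comPzRingType) (V : lmodType R) (c : R).
Definition homothety (x : V) : V := c *: x.
Lemma homothety_linear : linear homothety.
Proof. by move=> a x y; rewrite /homothety scalerDr !scalerA mulrC. Qed.
HB.instance Definition _ :=
  GRing.isLinear.Build R V V *:%R homothety homothety_linear.
End Homothety.

Section PrimeQuotient.
Variables (R : comPzRingType) (p : ideal R).

Lemma kills_quot (r : R) : (r : R^o) \in p -> kills (quotm p) r.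
Proof.
move=> rp x; rewrite -(quot_reprK x) -linearZ_LR; apply: quot_pi0.
by rewrite -[_ *: _]/(r * _) mulrC -[_ * r]/(_ *: (r : R^o)) rpredZ.
Qed.

Hypothesis pp : prime_ideal p.

Lemma quot_prime_eq0 (r : R) (x : quotm p) :
  r *: x = 0 -> (r : R^o) \in p \/ x = 0.
Proof.
rewrite -(quot_reprK x) -linearZ_LR => /quot_pi_eq0 rxp.
by have [_ /(_ r _ rxp)[]] := pp; [left | right; apply: quot_pi0].
Qed.

(** Induction on the generators.  If the class of the last generator [m] modulo
    the others is killed by [p] only, that cyclic quotient maps onto [R/p].
    Otherwise some [c] outside [p] moves the module into the span of the other
    generators, and composing with multiplication by [c] does not kill a
    nonzero map, [R/p] being a domain. *)
Lemma supp_span_map (V : lmodType R) (s : seq V) :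
  (forall r : R, (forall x, x \in submod_span [set` s] -> r *: x = 0) ->
     (r : R^o) \in p) ->
  exists (g : {linear subm (submod_span [set` s]) -> quotm p}) x, g x <> 0.
Proof.
have [p1 pM] := pp; elim: s => [|m s IH] sp.
  by case/negP: p1; apply: sp => x /span_nilP ->; rewrite scaler0.
set S := submod_span [set` s] in IH *; set T := submod_span _.
have ST y : y \in S -> y \in T.
  by move=> yS; apply/span_consP; exists 0, y; rewrite // scale0r add0r.
have [bp|] := pselect (forall r : R, r *: m \in S -> (r : R^o) \in p).
  have ex (x : subm T) : exists r : R, val x - r *: m \in S.
    have /span_consP[r [y yS xE]] := valP x; exists r.
    by rewrite [\val x]xE addrAC subrr add0r.
  have [h hP] := choice ex.
  have hE r x : \val x - r *: m \in S -> quot_pi p (h x) = quot_pi p r.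
    move=> rx; apply/quot_piP/bp; rewrite scalerBl.
    have -> : h x *: m - r *: m = (\val x - r *: m) - (\val x - h x *: m).
      by rewrite opprB [RHS]addrC addrA subrK.
    exact: submodB.
  have lin : linear (fun x => quot_pi p (h x)).
    move=> c x y; rewrite -linearP; apply: hE.
    rewrite linearP /= [c *: _ + _ : R^o]/(c * h x + h y) scalerDl -scalerA.
    rewrite opprD addrACA -scalerBr.
    by apply: rpredD; [apply: rpredZ|]; exact: hP.
  have mT : m \in T by apply: mem_span; exact: mem_head.
  exists (lin_of lin), (exist _ m mT); rewrite lin_ofE (@hE 1).
    by move=> /quot_pi_eq0; apply/negP.
  by rewrite scale1r subrr rpred0.
move=> /existsNP[c /not_implyP[cm cp]].
have cT x : x \in T -> homothety c x \in S.
  move=> /span_consP[r [y yS ->]]; rewrite /homothety scalerDr.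
  by rewrite scalerA mulrC -scalerA rpredD // rpredZ.
have [d dS|g [x gx]] := IH.
  have /pM[] // : (d * c : R^o) \in p.
  by apply: sp => x xT; rewrite -scalerA; apply: dS; exact: cT.
exists (g \o restr cT), (exist _ (val x) (ST _ (valP x))) => /= gcx.
have : c *: g x = 0.
  by rewrite -linearZ_LR -gcx; congr (g _); apply: val_inj.
by case/quot_prime_eq0.
Qed.

Lemma supp_map (M : lmodType R) : finitely_generated M -> supp p M ->
  exists (g : {linear M -> quotm p}) x, g x <> 0.
Proof.
move=> [s sM] Mp; have [r rs|g [x gx]] := @supp_span_map M s.
  by apply: Mp => x; exact: rs.
have lin : linear (fun x => exist _ x (sM x) : subm _).
  by move=> c u v; apply: val_inj.
exists (g \o lin_of lin), (val x) => /=.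
by move=> g0; apply: gx; rewrite -g0; congr (g _); apply: val_inj.
Qed.
End PrimeQuotient.

Section TensorLift.
Variables (R : comPzRingType) (M N W : lmodType R) (f : M -> N -> W).
Hypotheses (fl : forall n, linear (f^~ n)) (fr : forall m, linear (f m)).

Lemma tensor_lift :
  exists F : {linear tensor M N -> W}, forall m n, F (tens m n) = f m n.
Proof.
pose F0 : {linear freem R (M * N)%type -> W} := freelift (fun p => f p.1 p.2).
have F0P x : x \in submod_span (@tensor_rel R M N) -> F0 x = 0.
  move=> xS; suff: x \in kerm F0 by move/eqP.
  apply: span_sub xS => {}x xrel; apply/eqP; move: xrel.
  pose Fl n := lin_of (fl n); pose Fr m := lin_of (fr m).
  have lE m n : f m n = Fl n m by []. have rE m n : f m n = Fr m n by [].
  case=> [[m [m' [n ->]]]|[[m [n [n' ->]]]|[[r [m [n ->]]]|[r [m [n ->]]]]]];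
    rewrite !linearB /= ?linearZ_LR /= !freelift_delta /=.
  - by rewrite !lE linearD addrAC addrK subrr.
  - by rewrite !rE linearD addrAC addrK subrr.
  - by rewrite !lE linearZ_LR scalerN subrr.
  - by rewrite !rE linearZ_LR scalerN subrr.
exists (quot_lift F0P) => m n; have := quot_liftE F0P (delta R (m, n)).
by rewrite [RHS]freelift_delta.
Qed.
End TensorLift.

(** Nakayama's lemma for tensor products: nonzero maps to the domain [R/p] multiply
    to a nonzero map out of the tensor product. *)
Lemma supp_tensor (R : comPzRingType) (p : ideal R) (M N : lmodType R) :
  prime_ideal p -> finitely_generated M -> finitely_generated N ->
  supp p M -> supp p N -> supp p (tensor M N).
Proof.
move=> pp fM fN Mp Np; have [g [x gx]] := supp_map pp fM Mp.
have [h [y hy]] := supp_map pp fN Np.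
pose mul (u v : quotm p) := quot_repr u *: v.
have mulr (u : quotm p) : linear (mul u).
  by move=> c v w; rewrite /mul scalerDr !scalerA mulrC.
have mulE r (u v : quotm p) : quot_pi p r = u -> mul u v = r *: v.
  move=> <-; apply/eqP; rewrite -subr_eq0 -scalerBl; apply/eqP.
  by apply: kills_quot; apply/quot_piP; rewrite quot_reprK.
have mull (v : quotm p) : linear (mul^~ v).
  move=> c u w; rewrite (@mulE (c * quot_repr u + quot_repr w)).
    by rewrite scalerDl scalerA.
  by rewrite -[X in quot_pi p X]/(c *: quot_repr u + quot_repr w) linearP /= !quot_reprK.
have [F FE] := tensor_lift mull mulr.
move=> r /(_ (tens x y)) rxy.
have : F (tensor_map g h (r *: tens x y)) = 0 by rewrite rxy !linear0.
rewrite !linearZ_LR /= tensor_map_tens FE /mul => /(quot_prime_eq0 pp)[//|].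
move=> /(quot_prime_eq0 pp)[/quot_pi_eq0|//].
by rewrite quot_reprK.
Qed.

(** * Enough injective modules *)

Definition divisible (D : zmodType) : Prop :=
  forall (d : D) (n : nat), (0 < n)%N -> exists e, e *+ n = d.

Section MorphSub.
Variables (U V : zmodType) (f : U -> V).
Hypothesis fB : {morph f : x y / x - y}.
Lemma morph_sub0 : f 0 = 0.
Proof. by rewrite -(subr0 0) fB subrr. Qed.
Lemma morph_subD x y : f (x + y) = f x + f y.
Proof.
have fN : f (- y) = - f y by rewrite -[- y]sub0r fB morph_sub0 sub0r.
by have := fB x (- y); rewrite opprK fN opprK.
Qed.
End MorphSub.

Section DivisibleExtension.
Variables (U V D : zmodType) (i : U -> V) (f : U -> D).
Hypotheses (iB : {morph i : x y / x - y}) (fB : {morph f : x y / x - y}).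
Hypotheses (i_inj : injective i) (divD : divisible D).

(* Graphs of partial homomorphisms from V to D that extend f *)
Let partial_ext (G : set (V * D)) : Prop :=
  [/\ forall u, G (i u, f u),
      forall x y, G x -> G y -> G (x.1 - y.1, x.2 - y.2) &
      forall d, G (0, d) -> d = 0].

Let Q G := G = set0 \/ partial_ext G.

Let Q_chain (F : set (set (V * D))) :
  F `<=` Q -> total_on F subset -> Q (\bigcup_(X in F) X).
Proof.
move=> FQ Ftot; have [[X FX [_ XP]]|noX] :=
    pselect (exists2 X, F X & X !=set0 /\ partial_ext X).
- right; split=> [u|x y [A FA Ax] [B FB By]|d [A FA Ad]].
  + by exists X => //; have [] := XP.
  + have [C [FC AC BC]] : exists C, [/\ F C, A `<=` C & B `<=` C].
      by case: (Ftot _ _ FA FB) => AB; [exists B | exists A]; split.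
    exists C => //; have [C0|[_ CB _]] := FQ _ FC.
      by have := AC _ Ax; rewrite C0.
    by apply: CB; [exact: AC | exact: BC].
  + by have [A0|[_ _ h]] := FQ _ FA; [rewrite A0 in Ad | exact: h].
- left; rewrite -subset0 => x [A FA Ax].
  have [A0|AP] := FQ _ FA; first by rewrite A0 in Ax.
  by apply: noX; exists A => //; split=> //; exists x.
Qed.

(** Baer's argument over the integers: a maximal partial extension, taken as a
    graph, is total, since the value of a further element [v] only has to agree
    with the value of its least multiple in the domain, which can be divided. *)
Lemma divisible_extend :
  exists g : V -> D, {morph g : x y / x - y} /\ forall u, g (i u) = f u.
Proof.
have i0 := morph_sub0 iB.
have f0 := morph_sub0 fB.
have fP : partial_ext [set x | exists u, x = (i u, f u)].
  split=> [u|_ _ [u ->] [v ->]|d [u [iu ->]]]; first by exists u.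
    by exists (u - v); rewrite iB fB.
  by have -> : u = 0 by apply: i_inj; rewrite i0.
have [G [GQ Gmax]] := Zorn_bigcup Q_chain.
have {GQ} [Gf GB Gfun] : partial_ext G.
  case: GQ => // G0; exfalso; apply: (Gmax [set x | exists u, x = (i u, f u)]).
    rewrite G0; split; first exact: sub0set.
    by move=> /(_ (i 0, f 0)); apply; exists 0.
  by right.
have G0 : G (0, 0) by rewrite -[X in (X, _)]i0 -f0; exact: Gf.
have GN v d : G (v, d) -> G (- v, - d).
  by move=> Gv; have := GB _ _ G0 Gv; rewrite /= !sub0r.
have GD v d w e : G (v, d) -> G (w, e) -> G (v + w, d + e).
  by move=> Gv /GN Gw; have := GB _ _ Gv Gw; rewrite /= !opprK.
have GMn v d n : G (v, d) -> G (v *+ n, d *+ n).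
  by move=> Gv; elim: n => [|n IH]; rewrite ?mulr0n // !mulrS; exact: GD.
have GMz v d n : G (v, d) -> G (v *~ n, d *~ n).
  by case: n => n Gv; rewrite ?NegzE ?mulrNz; [exact: GMn | exact/GN/GMn].
have Gtot v : exists d, G (v, d).
  have [d dP] : exists d, forall (n : int) c, G (v *~ n, c) -> c = d *~ n.
    have [kP|no] := pselect (exists k : nat, `[< exists c, G (v *+ k.+1, c) >]).
      have [m /asboolP[c Gc] mmin] := ex_minnP kP.
      have [d dc] := divD c (ltn0Sn m); exists d => n e Ge.
      pose q := (n %/ m.+1%:Z)%Z; pose r := (n %% m.+1%:Z)%Z.
      have nE : n = q * m.+1%:Z + r by exact: divz_eq.
      have r0 : 0 <= r by exact: modz_ge0.
      have rm : r < m.+1 by exact: ltz_pmod.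
      move: q r nE r0 rm => q r nE r0 rm.
      have Gr : G (v *~ r, e - c *~ q).
        have := GB _ _ Ge (GMz _ _ q Gc).
        by rewrite /= nE mulrzDr [q * _]mulrC mulrzA addrAC subrr add0r.
      case: r nE r0 rm Gr => // -[|r] nE _ rm Gr; last first.
        have /mmin : `[< exists c, G (v *+ r.+1, c) >] by apply/asboolP; eexists; exact: Gr.
        by move: rm; rewrite ltz_nat ltnS => /leq_trans/[apply]; rewrite ltnn.
      have /eqP := Gfun _ Gr; rewrite subr_eq0 => /eqP ->.
      by rewrite nE addr0 -dc mulrC mulrzA.
    exists 0 => n c; rewrite mul0rz => Gc.
    case: n Gc => [[|n]|n] Gc; first exact: Gfun.
      by exfalso; apply: no; exists n; apply/asboolP; exists c.
    exfalso; apply: no; exists n; apply/asboolP; exists (- c).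
    by have := GN _ _ Gc; rewrite NegzE mulrNz opprK.
  pose G' := [set x | exists n y, G y /\ x = (y.1 + v *~ n, y.2 + d *~ n)].
  have GG' : G `<=` G'.
    by move=> x Gx; exists 0, x; rewrite !mulr0z !addr0 -surjective_pairing.
  have G'v : G' (v, d) by exists 1, (0, 0); rewrite !mulr1z !add0r.
  exists d; apply: contrapT => Gvd; apply: (Gmax G').
    by split=> // /(_ _ G'v).
  right; split=> [u|_ _ [n [y [Gy ->]]] [m [z [Gz ->]]]|c [n [y [Gy [y1 ->]]]]].
  - exact/GG'/Gf.
  - exists (n - m), (y.1 - z.1, y.2 - z.2); split; first exact: GB.
    by rewrite /= !mulrzBr !opprD; congr (_, _); exact: addrACA.
  - case: y Gy y1 => w e /GN Gw /= w1; apply/eqP; rewrite addrC addr_eq0.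
    have wE : - w = v *~ n by apply/eqP; rewrite eq_sym -addr_eq0 addrC -w1.
    by rewrite wE in Gw; rewrite (dP _ _ Gw).
have [g gP] := choice Gtot.
have Gfun2 v d e : G (v, d) -> G (v, e) -> d = e.
  move=> Gd Ge; have := GB _ _ Gd Ge; rewrite /= subrr => /Gfun/eqP.
  by rewrite subr_eq0 => /eqP.
exists g; split=> [x y|u]; last exact: Gfun2 (gP _) (Gf u).
by apply: Gfun2 (gP _) _; exact: GB (gP x) (gP y).
Qed.
End DivisibleExtension.

Section DivisibleHull.
Variable M : zmodType.
Let Mz : lmodType int := zmodule M.
Let QM : lmodType int := prodm (fun _ : M => zmodule rat).

Let rel_set (g : QM) : Prop := exists2 c : freem int M,
  freelift (fun x : M => (x : Mz)) c = 0 & forall m, g m = (val c m : int)%:~R.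

Let relP : submodule_set rel_set.
Proof.
split=> [|g h [c c0 gc] [d d0 hd]|n g [c c0 gc]].
- by exists 0; rewrite ?linear0.
- exists (c + d); first by rewrite linearD /= c0 d0 addr0.
  by move=> m; rewrite prodmDE gc hd -intrD.
- exists (n *: c); first by rewrite linearZ_LR /= c0 scaler0.
  move=> m; rewrite prodmZE gc scalezrE.
  by rewrite -[RHS]/((n * (val c m : int))%:~R) mulrC intrM mulrzr.
Qed.

(** [M] is a quotient of a free abelian group, which sits inside a rational
    vector space; the quotient of the latter by the same relations is
    divisible. *)
Lemma divisible_hull : exists (D : zmodType) (e : M -> D),
  [/\ divisible D, injective e & {morph e : x y / x - y}].
Proof.
pose D := quotm (sub_of relP).
pose emb (m : M) : QM := fun x => (x == m)%:R.
have bi (b : bool) : (b%:R : int)%:~R = b%:R :> rat by case: b.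
exists D, (fun m => quot_pi (sub_of relP) (emb m)); split.
- move=> d n n0; exists (quot_pi (sub_of relP) (fun x => quot_repr d x / n%:R)).
  rewrite -raddfMn -[RHS]quot_reprK; congr quot_pi.
  apply: functional_extensionality_dep => x.
  have -> (g : QM) k : (g *+ k) x = g x *+ k.
    by elim: k => [|k IH] //; rewrite !mulrS prodmDE IH.
  have divK (q : rat) : (q / n%:R) *+ n = q.
    by rewrite -mulr_natr divfK // pnatr_eq0 -lt0n.
  exact: divK.
- move=> m m' /quot_piP/sub_ofP[c c0 cE].
  have cD : c = delta int m - delta int m'.
    apply: val_inj; apply: functional_extensionality_dep => x.
    apply: (@intr_inj rat); rewrite -cE.
    rewrite -[RHS]/(((x == m)%:R - (x == m')%:R : int)%:~R) intrB.
    by rewrite !bi.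
  by apply/eqP; rewrite -subr_eq0; move: c0; rewrite cD linearB /= !freelift_delta => ->.
- move=> m m'; rewrite -linearB; apply/quot_piP/sub_ofP.
  exists (delta int (m - m') - (delta int m - delta int m')).
    by rewrite !linearB /= !freelift_delta -opprD; exact: subrr.
  move=> x; rewrite -[LHS]/((x == m - m')%:R - ((x == m)%:R - (x == m')%:R)).
  rewrite -[val _ x]/((x == m - m')%:R - ((x == m)%:R - (x == m')%:R) : int).
  by rewrite !intrB !bi.
Qed.
End DivisibleHull.

(** The coinduced module Hom(R, D) of additive maps, on which [R] acts by
    translating the argument. *)
Section Coinduced.
Variables (R : comPzRingType) (D : zmodType).
Let Dz : lmodType int := zmodule D.
Let FD : lmodType int := prodm (fun _ : R => Dz).

Let add_set (g : FD) : Prop := forall r s, g (r - s) = g r - g s.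
Let addP : submodule_set add_set.
Proof.
split=> [r s|g h gB hB r s|n g gB r s]; rewrite ?prodm0E ?subr0 //.
  by rewrite !prodmDE gB hB opprD addrACA.
by rewrite !prodmZE gB scalerBr.
Qed.

Definition coind := subm (sub_of addP).
HB.instance Definition _ := GRing.Zmodule.on coind.
Definition coind_fun (g : coind) : R -> D := val g.

Lemma coind_ext (g h : coind) : coind_fun g =1 coind_fun h -> g = h.
Proof. by move=> gh; apply/val_inj/functional_extensionality_dep. Qed.
Lemma coindB (g : coind) r s : coind_fun g (r - s) = coind_fun g r - coind_fun g s.
Proof. by case: g => g gP; have /sub_ofP := gP; apply. Qed.
Lemma coindD (g : coind) r s : coind_fun g (r + s) = coind_fun g r + coind_fun g s.
Proof. exact: (morph_subD (coindB g)). Qed.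
Lemma coind_addE (g h : coind) r : coind_fun (g + h) r = coind_fun g r + coind_fun h r.
Proof. by []. Qed.
Definition coind_mk (g : R -> D) (gB : {morph g : r s / r - s}) : coind :=
  exist _ (g : FD) (introT (sub_ofP addP g) gB).

Fact coind_scale_subproof (c : R) (g : coind) :
  {morph (fun r => coind_fun g (r * c)) : r s / r - s}.
Proof. by move=> r s; rewrite mulrBl coindB. Qed.
Definition coind_scale c g := coind_mk (coind_scale_subproof c g).
Fact coind_scaleA a b v : coind_scale a (coind_scale b v) = coind_scale (a * b) v.
Proof. by apply: coind_ext => r; rewrite /coind_fun /= mulrA. Qed.
Fact coind_scale1 : left_id 1 coind_scale.
Proof. by move=> v; apply: coind_ext => r; rewrite /coind_fun /= mulr1. Qed.
Fact coind_scaleDr : right_distributive coind_scale +%R.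
Proof. by move=> a u v; apply: coind_ext. Qed.
Fact coind_scaleDl v : {morph coind_scale^~ v : a b / a + b}.
Proof.
move=> a b; apply: coind_ext => r.
by rewrite coind_addE -[LHS]/(coind_fun v (r * (a + b))) mulrDr coindD.
Qed.
HB.instance Definition _ := GRing.Zmodule_isLmodule.Build R coind
  coind_scaleA coind_scale1 coind_scaleDr coind_scaleDl.

Lemma coind_scaleE (c : R) (g : coind) r : coind_fun (c *: g) r = coind_fun g (r * c).
Proof. by []. Qed.

(** Evaluation at 1 turns extending an [R]-linear map to the coinduced module into
    extending an additive map to [D]. *)
Lemma coind_injective : divisible D -> injective_module coind.
Proof.
move=> divD U V i f i_inj.
have iB : {morph i : x y / x - y} by move=> x y; rewrite linearB.
have fB : {morph (fun u => coind_fun (f u) 1) : x y / x - y}.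
  by move=> x y; rewrite linearB.
have [g [gB gi]] := divisible_extend iB fB i_inj divD.
have hB v : {morph (fun r : R => g (r *: v)) : r s / r - s}.
  by move=> r s; rewrite scalerBl gB.
have lin : linear (fun v => coind_mk (hB v)).
  move=> c v w; apply: coind_ext => r.
  rewrite coind_addE coind_scaleE -[LHS]/(g (r *: (c *: v + w))).
  by rewrite scalerDr (morph_subD gB) scalerA.
exists (lin_of lin) => u; apply: coind_ext => r.
rewrite -[LHS]/(g (r *: i u)) -linearZ_LR gi linearZ_LR /=.
by rewrite coind_scaleE mul1r.
Qed.
End Coinduced.

Section EnoughInjectives.
Variable R : comPzRingType.

(** [M] embeds in Hom(R, M), hence in Hom(R, D) for a divisible [D] containing [M]. *)
Lemma enough_injectives (M : lmodType R) :
  exists (E : lmodType R) (i : {linear M -> E}), injective_module E /\ injective i.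
Proof.
have [D [e [divD e_inj eB]]] := divisible_hull M.
have hB (m : M) : {morph (fun r : R => e (r *: m)) : r s / r - s}.
  by move=> r s; rewrite scalerBl eB.
have lin : linear (fun m => coind_mk (hB m)).
  move=> c v w; apply: coind_ext => r.
  rewrite coind_addE coind_scaleE -[LHS]/(e (r *: (c *: v + w))).
  by rewrite scalerDr (morph_subD eB) scalerA.
exists (coind R D), (lin_of lin); split; first exact: coind_injective.
move=> m m' /(congr1 (fun g => coind_fun g 1)).
rewrite -[coind_fun _ _]/(e (1 *: m)) -[RHS]/(e (1 *: m')) !scale1r.
exact: e_inj.
Qed.

Lemma injective_retract (E F : lmodType R) (i : {linear E -> F}) (r : {linear F -> E}) :
  (forall x, r (i x) = x) -> injective_module F -> injective_module E.
Proof.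
move=> ri injF U V j f j_inj; have [g gj] := injF U V j (i \o f) j_inj.
by exists (r \o g) => u; rewrite /= gj /= ri.
Qed.

Lemma injective_prod (E F : lmodType R) :
  injective_module E -> injective_module F -> injective_module (E * F)%type.
Proof.
move=> injE injF U V j f j_inj.
have lin1 : linear (fun u => (f u).1) by move=> c u v; rewrite linearP.
have lin2 : linear (fun u => (f u).2) by move=> c u v; rewrite linearP.
have [g gj] := injE U V j (lin_of lin1) j_inj.
have [h hj] := injF U V j (lin_of lin2) j_inj.
have lin : linear (fun v => (g v, h v)) by move=> c u v; rewrite !linearP.
by exists (lin_of lin) => u; rewrite lin_ofE gj hj -surjective_pairing.
Qed.
End EnoughInjectives.

(** * Vanishing of local cohomology by dimension shifting *)

Section ExactSequences.
Variable R : comPzRingType.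
Implicit Types A B C E F P Q : lmodType R.

Definition ses A B C (i : {linear A -> B}) (p : {linear B -> C}) : Prop :=
  [/\ injective i, forall b, p b = 0 <-> exists a, i a = b & surj p].

Lemma linear_inj A B (f : {linear A -> B}) :
  (forall x, f x = 0 -> x = 0) -> injective f.
Proof.
move=> f0 x y fxy; apply/eqP; rewrite -subr_eq0; apply/eqP/f0.
by rewrite linearB fxy subrr.
Qed.

Lemma linear_inj0 A B (f : {linear A -> B}) x : injective f -> f x = 0 -> x = 0.
Proof. by move=> fI fx; apply: fI; rewrite fx linear0. Qed.

Lemma ses_comp0 A B C (i : {linear A -> B}) (p : {linear B -> C}) a :
  ses i p -> p (i a) = 0.
Proof. by case=> _ ip _; apply/ip; exists a. Qed.

Lemma image_submodule A B (f : {linear A -> B}) :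
  submodule_set (fun y => exists x, f x = y).
Proof.
split=> [|_ _ [x <-] [y <-]|c _ [x <-]].
- by exists 0; rewrite linear0.
- by exists (x + y); rewrite linearD.
- by exists (c *: x); rewrite linearZ_LR.
Qed.

Lemma quot_pi_surj A (N : submodClosed A) : surj (quot_pi N).
Proof. by move=> y; exists (quot_repr y); rewrite quot_reprK. Qed.

Lemma ses_coker A B (i : {linear A -> B}) : injective i ->
  exists C (p : {linear B -> C}), ses i p.
Proof.
move=> i_inj; exists (quotm (sub_of (image_submodule i))), (quot_pi _).
split=> // [b|]; last exact: quot_pi_surj.
by rewrite quot_pi_eq0; split=> [/sub_ofP|?]; last exact/sub_ofP.
Qed.

Lemma factor_through_surj A B C (p : {linear A -> B}) (f : {linear A -> C}) :
  surj p -> (forall x, p x = 0 -> f x = 0) ->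
  exists g : {linear B -> C}, forall x, g (p x) = f x.
Proof.
move=> /choice[s sK] pf.
have fE x y : p x = p y -> f x = f y.
  move=> pxy; apply/eqP; rewrite -subr_eq0 -linearB; apply/eqP/pf.
  by rewrite linearB pxy subrr.
have lin : linear (f \o s).
  by move=> c x y; rewrite /= -linearP; apply: fE; rewrite linearP !sK.
by exists (lin_of lin) => x; apply: fE; rewrite sK.
Qed.

Lemma enough_ses A : exists E C (i : {linear A -> E}) (p : {linear E -> C}),
  injective_module E /\ ses i p.
Proof.
have [E [i [injE i_inj]]] := enough_injectives A.
by have [C [p ip]] := ses_coker i_inj; exists E, C, i, p.
Qed.

Lemma ses_split E B C (i : {linear E -> B}) (p : {linear B -> C}) :
  ses i p -> injective_module E ->
  exists (r : {linear B -> E}) (s : {linear C -> B}),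
    [/\ forall x, r (i x) = x, forall c, p (s c) = c & forall c, r (s c) = 0].
Proof.
move=> ip injE; have [i_inj ipE p_surj] := ip.
have [r ri] := injE _ _ i idfun i_inj.
have lin : linear (fun b => b - i (r b)).
  by move=> c x y; rewrite !linearP /= addrACA -scalerDr.
have [|s sp] := @factor_through_surj _ _ _ p (lin_of lin) p_surj.
  by move=> x /ipE[e <-]; rewrite lin_ofE ri subrr.
exists r, s; split=> // c; have [b <-] := p_surj c; rewrite sp lin_ofE linearB.
  by rewrite (ses_comp0 _ ip) subr0.
by rewrite ri subrr.
Qed.

(** Schanuel's comparison of two embeddings of [A]: their pushout is an extension
    of each cokernel by the middle term of the other sequence. *)
Lemma ses_pushout A E1 C1 E2 C2 (i1 : {linear A -> E1}) (p1 : {linear E1 -> C1})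
    (i2 : {linear A -> E2}) (p2 : {linear E2 -> C2}) : ses i1 p1 -> ses i2 p2 ->
  exists (P : lmodType R) (j1 : {linear E1 -> P}) (q1 : {linear P -> C2})
           (j2 : {linear E2 -> P}) (q2 : {linear P -> C1}), ses j1 q1 /\ ses j2 q2.
Proof.
move=> ip1 ip2; have [i1I ip1E p1S] := ip1; have [i2I ip2E p2S] := ip2.
have lin : linear (fun a => (i1 a, i2 a)) by move=> c x y; rewrite !linearP.
have [|P [q qP]] := @ses_coker _ _ (lin_of lin); first by move=> x y [/i1I].
have [_ qE qS] := qP.
have linl : linear (fun e : E1 => (e, 0 : E2)).
  by move=> c x y; congr (_, _); rewrite /= scaler0 addr0.
have linr : linear (fun e : E2 => (0 : E1, e)).
  by move=> c x y; congr (_, _); rewrite /= scaler0 addr0.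
have [|q1 q1E] := @factor_through_surj _ _ _ q (p2 \o snd) qS.
  by move=> x /qE[a <-] /=; exact: ses_comp0.
have [|q2 q2E] := @factor_through_surj _ _ _ q (p1 \o fst) qS.
  by move=> x /qE[a <-] /=; exact: ses_comp0.
exists P, (q \o lin_of linl), q1, (q \o lin_of linr), q2; split; split.
- apply: linear_inj => e /= /qE[a] /= [] <- /(linear_inj0 i2I) ->.
  by rewrite linear0.
- move=> x; have [[e1 e2] <-] := qS x; rewrite q1E /=; split=> [/ip2E[a <-]|[e]].
    exists (e1 - i1 a); apply/eqP; rewrite -subr_eq0 -linearB; apply/eqP/qE.
    exists (- a); rewrite !lin_ofE !linearN /=; congr (_, _); last by rewrite sub0r.
    by rewrite addrAC subrr add0r.
  move=> /eqP; rewrite -subr_eq0 -linearB => /eqP/qE[a] [_].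
  rewrite sub0r => /eqP; rewrite -eqr_oppLR => /eqP <-.
  by rewrite linearN (ses_comp0 _ ip2) oppr0.
- by move=> c; have [e <-] := p2S c; exists (q (0, e)); rewrite q1E.
- apply: linear_inj => e /= /qE[a] /= [] /(linear_inj0 i1I) -> <-.
  by rewrite linear0.
- move=> x; have [[e1 e2] <-] := qS x; rewrite q2E /=; split=> [/ip1E[a <-]|[e]].
    exists (e2 - i2 a); apply/eqP; rewrite -subr_eq0 -linearB; apply/eqP/qE.
    exists (- a); rewrite !lin_ofE !linearN /=; congr (_, _); first by rewrite sub0r.
    by rewrite addrAC subrr add0r.
  move=> /eqP; rewrite -subr_eq0 -linearB => /eqP/qE[a] [].
  rewrite sub0r => /eqP; rewrite -eqr_oppLR => /eqP <- _.
  by rewrite linearN (ses_comp0 _ ip1) oppr0.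
- by move=> c; have [e <-] := p1S c; exists (q (e, 0)); rewrite q2E.
Qed.

(** One step of the horseshoe lemma.  The map from [B] to [E1] extending [iA] is
    where injectivity enters; the formulas for [i'] and [p'] are kept because
    torsion elements have to be followed through them. *)
Lemma ses_horseshoe A B C E1 A' E2 C' (i : {linear A -> B}) (p : {linear B -> C})
    (iA : {linear A -> E1}) (pA : {linear E1 -> A'})
    (iC : {linear C -> E2}) (pC : {linear E2 -> C'}) :
  ses i p -> ses iA pA -> ses iC pC -> injective_module E1 ->
  exists (B' : lmodType R) (j : {linear B -> (E1 * E2)%type}) (q : {linear (E1 * E2)%type -> B'})
         (i' : {linear A' -> B'}) (p' : {linear B' -> C'}),
    [/\ ses j q, ses i' p', forall e, i' (pA e) = q (e, 0) &
        forall e, p' (q e) = pC e.2].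
Proof.
move=> ip ipA ipC injE1; have [iI ipE pS] := ip.
have [iAI ipAE pAS] := ipA; have [iCI ipCE pCS] := ipC.
have [h hi] := injE1 _ _ i iA iI.
have lin : linear (fun b => (h b, iC (p b))) by move=> c x y; rewrite !linearP.
have [|B' [q qP]] := @ses_coker _ _ (lin_of lin).
  apply: linear_inj => b [hb /(linear_inj0 iCI)/ipE[a ab]].
  by move: hb; rewrite -ab hi => /(linear_inj0 iAI) ->; rewrite linear0.
have [_ qE qS] := qP.
have linl : linear (fun e : E1 => (e, 0 : E2)).
  by move=> c x y; congr (_, _); rewrite /= scaler0 addr0.
have [|i' i'E] := @factor_through_surj _ _ _ pA (q \o lin_of linl) pAS.
  move=> _ /ipAE[a <-]; apply: (iffRL (qE _)); exists (i a).
  by rewrite !lin_ofE hi (ses_comp0 _ ip) linear0.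
have [|p' p'E] := @factor_through_surj _ _ _ q (pC \o snd) qS.
  by move=> _ /qE[b <-] /=; exact: ses_comp0.
exists B', (lin_of lin), q, i', p'; split=> //; split.
- apply: linear_inj => x; have [e <-] := pAS x; rewrite i'E /=.
  move=> /qE[b [hb /(linear_inj0 iCI)/ipE[a ab]]].
  by apply/ipAE; exists a; rewrite -hb -ab hi.
- move=> x; have [[e1 e2] <-] := qS x; rewrite p'E /=; split.
    move=> /ipCE[c]; have [b <-] := pS c => ce.
    exists (pA (e1 - h b)); rewrite i'E /=; apply/eqP.
    rewrite -subr_eq0 -linearB; apply/eqP/qE; exists (- b).
    rewrite !lin_ofE !linearN -ce /=; congr (_, _); last by rewrite sub0r.
    by rewrite addrAC subrr add0r.
  move=> [a]; have [e <-] := pAS a; rewrite i'E /= => /eqP.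
  rewrite -subr_eq0 -linearB => /eqP/qE[b] [_].
  rewrite sub0r => /eqP; rewrite -eqr_oppLR => /eqP <-.
  by rewrite linearN (ses_comp0 _ ipC) oppr0.
- by move=> c; have [e <-] := pCS c; exists (q (0, e)); rewrite p'E.
Qed.
End ExactSequences.

Section Vanishing.
Variables (R : comPzRingType) (a : ideal R).
Implicit Types A B C E F P Q : lmodType R.

Lemma torsion_inj A B (f : {linear A -> B}) x :
  injective f -> f x \in torsion a B -> x \in torsion a A.
Proof.
move=> fI /asboolP[n fn]; apply/asboolP; exists n => r rn.
by apply: (linear_inj0 fI); rewrite linearZ_LR fn.
Qed.

Definition torsion_surj B C (p : {linear B -> C}) : Prop :=
  forall c, c \in torsion a C -> exists2 b, b \in torsion a B & p b = c.

(** [vanS k A] says that H^(k+1)(A) vanishes.  Quantifying over all embeddings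
    into injective modules makes the condition visibly independent of choices;
    that one embedding suffices is [vanS_ex] below. *)
Fixpoint vanS (k : nat) A : Prop :=
  forall E C (i : {linear A -> E}) (p : {linear E -> C}),
    injective_module E -> ses i p ->
    if k is k'.+1 then vanS k' C else torsion_surj p.

Definition vanS_via (k : nat) E C (p : {linear E -> C}) : Prop :=
  if k is k'.+1 then vanS k' C else torsion_surj p.

Lemma vanSE k A : vanS k A <->
  forall E C (i : {linear A -> E}) (p : {linear E -> C}),
    injective_module E -> ses i p -> vanS_via k p.
Proof. by case: k. Qed.

(** An extension by an injective module splits, so a resolution of [C] gives one of
    [P] with the same first cokernel, and conversely. *)
Lemma vanS_ext_injective k E P C (j : {linear E -> P}) (q : {linear P -> C}) :
  ses j q -> injective_module E -> vanS k P <-> vanS k C.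
Proof.
move=> jq injE; have [jI qE qS] := jq.
have [r [s [rj qs rs]]] := ses_split jq injE.
rewrite !vanSE; split=> van F D i p injF ip; have [iI pE pS] := ip.
- have lin : linear (fun x => (r x, i (q x))) by move=> c x y; rewrite !linearP.
  have /van : ses (lin_of lin) (p \o (snd : {linear (E * F)%type -> F})).
    split.
    + apply: linear_inj => x [rx /(linear_inj0 iI)/qE[e ex]].
      by move: rx; rewrite -ex rj => ->; rewrite linear0.
    + move=> [e f] /=; split=> [/pE[c <-]|[x [_ <-]]]; last exact: ses_comp0.
      exists (j e + s c); rewrite !linearD rj rs qs addr0.
      by rewrite (ses_comp0 _ jq) linear0 add0r.
    + by move=> d; have [f <-] := pS d; exists (0, f).
  move=> /(_ (injective_prod injE injF)); case: k {van} => //= van c /van[b bt <-].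
  by exists b.2 => //; exact: (torsion_map (snd : {linear (E * F)%type -> F})).
- have [|Q [t tP]] := @ses_coker _ _ _ (i \o j); first exact: inj_comp.
  have [_ tE tS] := tP; have [r' [s' [_ ts _]]] := ses_split tP injE.
  have injQ : injective_module Q by exact: injective_retract ts injF.
  have [x /qE[e <-]|i' i'E] := @factor_through_surj _ _ _ _ q (t \o i) qS.
    by rewrite -[LHS]/(t ((i \o j) e)) (ses_comp0 _ tP).
  have [f /tE[e <-]|p' p'E] := @factor_through_surj _ _ _ _ t p tS.
    by rewrite /= (ses_comp0 _ ip).
  have /van : ses i' p'.
    split.
    + apply: linear_inj => c; have [x <-] := qS c; rewrite i'E /=.
      by move=> /tE[e /iI <-]; apply/qE; exists e.
    + move=> y; have [f <-] := tS y; rewrite p'E; split=> [/pE[x <-]|[c]].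
        by exists (q x); rewrite i'E.
      have [x <-] := qS c; rewrite i'E /= => itf; rewrite -p'E -itf p'E.
      exact: ses_comp0.
    + by move=> d; have [f <-] := pS d; exists (t f).
  move=> /(_ injQ); case: k {van} => //= van d /van[y yt <-].
  exists (s' y); first exact: torsion_map.
  by rewrite -p'E ts.
Qed.

(** For [k = 0] the two embeddings are compared by a map of the injective modules;
    in higher degrees the cokernels are compared by Schanuel's pushout. *)
Lemma vanS_ex k A E C (i : {linear A -> E}) (p : {linear E -> C}) :
  injective_module E -> ses i p -> vanS_via k p -> vanS k A.
Proof.
move=> injE ip van; rewrite vanSE => E2 C2 i2 p2 injE2 ip2.
case: k van => [|k] van.
  have [iI pE pS] := ip; have [iI2 pE2 pS2] := ip2.
  have [h hi] := injE _ _ i2 i iI2.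
  have [x /pE2[b <-]|g gE] := @factor_through_surj _ _ _ _ p2 (p \o h) pS2.
    by rewrite /= hi (ses_comp0 _ ip).
  move=> c ct; have [e ec] := pS2 c; have [t tt pt] := van _ (torsion_map g ct).
  have /pE[b bE] : p (h e - t) = 0.
    by rewrite linearB -[p (h e)]/((p \o h) e) -gE ec pt subrr.
  exists (e - i2 b); last by rewrite linearB (ses_comp0 _ ip2) subr0.
  (* h (e - i2 b) = t is torsion, and h detects the part of E2 in A *)
  move: ct tt => /asboolP[m cm] /asboolP[n tn]; apply/asboolP.
  exists (maxn m n) => r rmn.
  have /pE2[b' b'E] : p2 (r *: (e - i2 b)) = 0.
    rewrite linearZ_LR linearB (ses_comp0 _ ip2) subr0 ec cm //.
    by apply: ideal_powS rmn; exact: leq_maxl.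
  suff b'0 : i b' = 0 by rewrite -b'E (linear_inj0 iI b'0) linear0.
  rewrite -hi b'E linearZ_LR linearB hi bE opprB addrC subrK tn //.
  by apply: ideal_powS rmn; exact: leq_maxr.
have [P [j1 [q1 [j2 [q2 [jq1 jq2]]]]]] := ses_pushout ip ip2.
by apply/(vanS_ext_injective k jq1 injE)/(vanS_ext_injective k jq2 injE2).
Qed.

(** The definition only speaks of embeddings of [A] into injective modules.  Any
    [B] containing [A] embeds in one, and a torsion lift found there differs from
    an element of [B] by an element of [A]. *)
Lemma torsion_surj_vanS A B C (i : {linear A -> B}) (p : {linear B -> C}) :
  vanS 0 A -> ses i p -> torsion_surj p.
Proof.
move=> van ip; have [iI pE pS] := ip; have [F [j [injF jI]]] := enough_injectives B.
have [|Q [q qP]] := @ses_coker _ _ _ (j \o i); first exact: inj_comp.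
have [_ qE qS] := qP; have tq := van _ _ _ _ injF qP.
have [x /pE[b <-]|g gE] := @factor_through_surj _ _ _ _ p (q \o j) pS.
  by rewrite -[LHS]/(q ((j \o i) b)) (ses_comp0 _ qP).
move=> c ct; have [b bc] := pS c; have [t tt qt] := tq _ (torsion_map g ct).
have /qE[x xE] : q (t - j b) = 0.
  by rewrite linearB -[q (j b)]/((q \o j) b) -gE bc qt subrr.
exists (b + i x); last by rewrite linearD (ses_comp0 _ ip) addr0.
by apply: (torsion_inj jI); rewrite linearD -[j (i x)]/((j \o i) x) xE addrC subrK.
Qed.

Lemma vanS_ext k A B C (i : {linear A -> B}) (p : {linear B -> C}) :
  ses i p -> vanS k A -> vanS k C -> vanS k B.
Proof.
elim: k A B C i p => [|k IH] A B C i p ip vA vC;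
  have [E1 [A' [iA [pA [injE1 ipA]]]]] := enough_ses A;
  have [E2 [C' [iC [pC [injE2 ipC]]]]] := enough_ses C;
  have [B' [j [q [i' [p' [jq ip' i'E p'E]]]]]] := ses_horseshoe ip ipA ipC injE1;
  have {}vA := vA _ _ _ _ injE1 ipA; have {}vC := vC _ _ _ _ injE2 ipC;
  apply: (vanS_ex (injective_prod injE1 injE2) jq) => /=; last exact: IH ip' vA vC.
move=> c ct; have [e2 e2t e2c] := vC _ (torsion_map p' ct).
have [_ pE' _] := ip'; have [iI' _ _] := ip'.
have linr : linear (fun e : E2 => (0 : E1, e)).
  by move=> d x y; congr (_, _); rewrite /= scaler0 addr0.
have linl : linear (fun e : E1 => (e, 0 : E2)).
  by move=> d x y; congr (_, _); rewrite /= scaler0 addr0.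
have rt := torsion_map (lin_of linr) e2t.
have /pE'[y yE] : p' (c - q (0, e2)) = 0 by rewrite linearB p'E /= e2c subrr.
have yt : y \in torsion a A'.
  by apply: (torsion_inj iI'); rewrite yE submodB // torsion_map.
have [e1 e1t e1y] := vA _ yt.
exists ((0, e2) + (e1, 0)); last by rewrite linearD -i'E e1y yE addrC subrK.
by apply: rpredD => //; exact: (torsion_map (lin_of linl) e1t).
Qed.

Lemma vanS_quot k A B C (i : {linear A -> B}) (p : {linear B -> C}) :
  ses i p -> vanS k B -> vanS k.+1 A -> vanS k C.
Proof.
elim: k A B C i p => [|k IH] A B C i p ip vB vA;
  have [E1 [A' [iA [pA [injE1 ipA]]]]] := enough_ses A;
  have [E2 [C' [iC [pC [injE2 ipC]]]]] := enough_ses C;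
  have [B' [j [q [i' [p' [jq ip' i'E p'E]]]]]] := ses_horseshoe ip ipA ipC injE1;
  have {}vA := vA _ _ _ _ injE1 ipA;
  have {}vB := vB _ _ _ _ (injective_prod injE1 injE2) jq;
  apply: (vanS_ex injE2 ipC) => /=; last exact: IH ip' vB vA.
move=> c /(torsion_surj_vanS vA ip')[b /vB[e et <-] <-].
exists e.2; last by rewrite p'E.
exact: (torsion_map (snd : {linear (E1 * E2)%type -> E2})).
Qed.

(** [van k A] says that H^k(A) vanishes. *)
Definition van (k : nat) A : Prop :=
  if k is k'.+1 then vanS k' A else forall x : A, x \in torsion a A -> x = 0.

(** Half of the long exact sequence: H^k(A) -> H^k(B) -> H^k(C). *)
Lemma van_ext k A B C (i : {linear A -> B}) (p : {linear B -> C}) :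
  ses i p -> van k A -> van k C -> van k B.
Proof.
case: k => [|k]; last exact: vanS_ext.
move=> [iI pE _] /= vA vC b bt.
have /pE[x xb] : p b = 0 by apply: vC; exact: torsion_map.
by rewrite -xb (vA x) ?linear0 //; apply: (torsion_inj iI); rewrite xb.
Qed.

(** The other half that is used: H^k(B) -> H^k(C) -> H^(k+1)(A). *)
Lemma van_quot k A B C (i : {linear A -> B}) (p : {linear B -> C}) :
  ses i p -> van k B -> van k.+1 A -> van k C.
Proof.
case: k => [|k]; last exact: vanS_quot.
move=> ip /= vB vA c /(torsion_surj_vanS vA ip)[b bt <-].
by rewrite (vB b) ?linear0.
Qed.

Lemma van_trivial k A : trivial_module A -> van k A.
Proof.
move=> A0; case: k => [x _|k] /=; first exact: A0.
have injA : injective_module A.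
  by move=> U V i f _; exists \0 => u; rewrite [RHS]A0.
have id_ses : ses (idfun : {linear A -> A}) (idfun : {linear A -> A}).
  by split=> [//|b|b]; [split=> // _; exists b | exists b].
elim: k => [|k IH]; apply: (vanS_ex injA id_ses) => //= c ct.
by exists c.
Qed.

Lemma van_iso k A B (f : {linear A -> B}) : bijective f -> van k A -> van k B.
Proof.
move=> fB vA; have f_inj := bij_inj fB; have [g fg gf] := fB.
have ip : ses (\0 : {linear 'cV[R]_0 -> A}) f.
  split=> [x y _|x|y]; [by rewrite [x]flatmx0 [y]flatmx0| |by exists (g y)].
  split=> [/(linear_inj0 f_inj) ->|[? <-]]; last exact: linear0.
  by exists 0.
by apply: (van_quot ip vA); apply: van_trivial => x; exact: flatmx0.
Qed.
End Vanishing.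

(** * Complexes from sequences of modules; injective resolutions *)

Section Transport.
Variables (R : pzRingType) (I : eqType) (X : I -> lmodType R).

(** The identity of [X i] seen as a map to [X j], or zero when [i] and [j]
    differ; being defined for all pairs it needs no equality proof. *)
Definition tr (i j : I) : {linear X i -> X j} :=
  match i =P j with
  | ReflectT e => eq_rect i (fun k => {linear X i -> X k}) idfun j e
  | ReflectF _ => \0
  end.

Lemma tr_id i x : tr i i x = x.
Proof. by rewrite /tr; case: eqP => // e; rewrite (eq_axiomK e). Qed.

Lemma tr_neq i j x : i != j -> tr i j x = 0.
Proof. by rewrite /tr; case: eqP. Qed.

End Transport.

Section HomologyTrivial.
Variable R : pzRingType.
Implicit Type X : complex R.

(** The neighbours of [n] are variables so that no index has to be cast. *)
Lemma homology_trivialP X (n m m' : int) : m = n + 1 -> m' = n - 1 ->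
  trivial_module (homology X n) <->
  forall z, dif X n m' z = 0 -> exists y, dif X m n y = z.
Proof.
move=> -> ->; split=> [X0 z zc|Xex x].
  have zC : z \in cycles X n by apply/eqP.
  have /asboolP[y yz] : (exist _ z zC : subm (cycles X n)) \in boundaries X n.
    by apply/quot_pi_eq0; exact: X0.
  by exists y; rewrite -yz.
rewrite -(quot_reprK x); apply/quot_pi_eq0/asboolP.
have [y yz] := Xex (val (quot_repr x)) (eqP (valP (quot_repr x))).
by exists y.
Qed.
End HomologyTrivial.

Section NatComplex.
Variables (R : comPzRingType) (A : nat -> lmodType R).
Variable dn : forall k l, {linear A k -> A l}.
Variable idx : int -> option nat.

Let oA (o : option nat) : lmodType R := if o is Some k then A k else 'cV[R]_0.
Let od (o o' : option nat) : {linear oA o -> oA o'} :=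
  match o, o' with Some k, Some l => dn k l | _, _ => \0 end.

Hypothesis dn_shape : forall i j k l, i != j + 1 ->
  idx i = Some k -> idx j = Some l -> forall x, dn k l x = 0.
Hypothesis dn_dn : forall k l m x, dn l m (dn k l x) = 0.

Lemma nat_complex_shape i j : i != j + 1 -> forall x, od (idx i) (idx j) x = 0.
Proof.
move=> ij; case Ei: (idx i) => [k|//]; case Ej: (idx j) => [l|//] x.
exact: dn_shape ij Ei Ej x.
Qed.
Lemma nat_complex_dd i j k x : od (idx j) (idx k) (od (idx i) (idx j) x) = 0.
Proof.
case: (idx i) x => [a|] x; case: (idx j) => [b|]; case: (idx k) => [c|] //=;
  by rewrite ?linear0 ?dn_dn.
Qed.
Definition nat_complex : complex R :=
  Complex nat_complex_shape nat_complex_dd.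
End NatComplex.

Section InjectiveResolution.
Variable R : comPzRingType.
Implicit Type M : lmodType R.

Record embedding M := Embedding {
  emb_mod : lmodType R;
  emb_coker : lmodType R;
  emb_in : {linear M -> emb_mod};
  emb_out : {linear emb_mod -> emb_coker};
  emb_inj : injective_module emb_mod;
  emb_ses : ses emb_in emb_out }.

Lemma embedding_exists M : exists _ : embedding M, True.
Proof.
have [E [C [i [p [injE ip]]]]] := enough_ses M.
by exists (Embedding injE ip).
Qed.
Definition embed M : embedding M := projT1 (cid (embedding_exists M)).

Variable M : lmodType R.
Fixpoint cosyzygy (k : nat) : lmodType R :=
  if k is k'.+1 then emb_coker (embed (cosyzygy k')) else M.
Let J k := emb_mod (embed (cosyzygy k)).
Let d k : {linear J k -> J k.+1} :=
  emb_in (embed (cosyzygy k.+1)) \o emb_out (embed (cosyzygy k)).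
Let dn k l : {linear J k -> J l} := tr J k.+1 l \o d k.

Definition neg_index (n : int) : option nat :=
  match n with Posz 0 => Some 0 | Posz _ => None | Negz k => Some k.+1 end.

Let dn_shape i j k l : i != j + 1 ->
  neg_index i = Some k -> neg_index j = Some l -> forall x, dn k l x = 0.
Proof.
have negE n q : neg_index n = Some q -> n = - q%:Z.
  by case: n => [[|n]|n] //= [<-]; rewrite ?NegzE.
move=> ij /negE iE /negE jE x; rewrite /= tr_neq //.
apply: contra ij; rewrite iE jE => /eqP <-.
by rewrite -addn1 PoszD opprD addrNK.
Qed.
Let dn_dn k l m x : dn l m (dn k l x) = 0.
Proof.
rewrite /=; have [kl|kl] := eqVneq k.+1 l; last first.
  by rewrite (tr_neq (X := J) _ kl) !linear0.
by case: l / kl; rewrite tr_id /= (ses_comp0 _ (emb_ses _)) !linear0.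
Qed.

(** Splice the embeddings of the successive cosyzygies. *)
Lemma injective_resolution_exists : exists I, injective_resolution M I.
Proof.
have trivial_inj : injective_module ('cV[R]_0 : lmodType R).
  by move=> U V i f _; exists \0 => u; rewrite [RHS]flatmx0 [LHS]flatmx0.
have dnE k x : dn k k.+1 x = d k x by rewrite /= tr_id.
have ker_d k x : d k x = 0 -> exists m, emb_in (embed (cosyzygy k)) m = x.
  have [iI _ _] := emb_ses (embed (cosyzygy k.+1)).
  have [_ pE _] := emb_ses (embed (cosyzygy k)).
  by move=> /(linear_inj0 iI)/pE.
exists (nat_complex dn_shape dn_dn); split.
- by case=> [[|n]|n] /=; rewrite ?/J; [exact: emb_inj | exact: trivial_inj | exact: emb_inj].
- by case=> [[|n]|n] //= _ x; exact: flatmx0.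
- exists (emb_in (embed M)); have [iI pE pS] := emb_ses (embed M); split=> // x.
  rewrite -[dif _ _ _ _]/(dn 0 1 x) dnE; split=> [/ker_d //|[m <-]].
  by rewrite /= (ses_comp0 _ (emb_ses (embed M))) linear0.
have ex k y : d k.+1 y = 0 -> exists x, d k x = y.
  move=> /ker_d[m my]; have [_ _ pS] := emb_ses (embed (cosyzygy k)).
  by have [x xm] := pS m; exists x; rewrite /= xm.
case=> [//|[|k] _].
  apply/(@homology_trivialP _ _ _ 0 (Negz 1)) => // z.
  rewrite -[dif _ _ _ z]/(dn 1 2 z) dnE => /ex[y yz].
  by exists y; exact: etrans (dnE 0%N y) yz.
apply/(@homology_trivialP _ _ _ (Negz k) (Negz k.+2)).
- by rewrite !NegzE -[k.+2]addn1 PoszD opprD addrNK.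
- by rewrite !NegzE -[k.+3]addn1 PoszD opprD.
move=> z; rewrite -[dif _ _ _ z]/(dn k.+2 k.+3 z) dnE => /ex[y yz].
by exists y; exact: etrans (dnE k.+1 y) yz.
Qed.
End InjectiveResolution.

Section LocalCohomology.
Variables (R : comPzRingType) (a : ideal R).

Lemma vanS_shift k (A E C : lmodType R) (i : {linear A -> E}) (p : {linear E -> C}) :
  injective_module E -> ses i p -> vanS a k A <-> vanS_via a k p.
Proof.
move=> injE ip; split; last exact: vanS_ex injE ip.
by rewrite vanSE => h; exact: h injE ip.
Qed.

Lemma torsion_homologyP (X : complex R) (n m m' : int) : m = n + 1 -> m' = n - 1 ->
  trivial_module (homology (torsion_complex a X) n) <->
  forall z, z \in torsion a (X n) -> dif X n m' z = 0 ->
    exists2 y, y \in torsion a (X m) & dif X m n y = z.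
Proof.
move=> mE m'E; rewrite (homology_trivialP _ mE m'E); split=> h z.
  move=> zt dz; have [|[y yt] /(congr1 val) /= yz] := h (exist _ z zt).
    exact: val_inj.
  by exists y.
case: z => z zt /(congr1 val) /= dz; have [y yt yz] := h z zt dz.
by exists (exist _ y yt); apply: val_inj.
Qed.

(** Dimension shifting along the resolution: with [Z q] the cycles in cohomological
    degree [q], each 0 -> Z q -> I q -> Z q.+1 -> 0 is exact, so that H^(k+1)(M) is
    the failure of torsion to lift from [I k] to [Z k.+1]. *)
Lemma van_resolution (M : lmodType R) (I : complex R) k :
  injective_resolution M I ->
  trivial_module (homology (torsion_complex a I) (- k%:Z)) <-> van a k M.
Proof.
move=> [injI I0 [eps [eI epsE]] Iex].
pose o k : int := - k%:Z.
have oS q : o q = o q.+1 + 1 by rewrite /o -addn1 PoszD opprD addrNK.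
have oP q : o q.+1 = o q - 1 by rewrite /o -addn1 PoszD opprD.
pose Z q : lmodType R := subm (kerm (dif I (o q) (o q.+1))).
have ZP q (z : Z q) : dif I (o q) (o q.+1) (val z) = 0 by apply/eqP/(valP z).
have inL q : linear (fun z : Z q => val z) by move=> c x y; rewrite linearP.
have dZ q x : dif I (o q) (o q.+1) x \in kerm (dif I (o q.+1) (o q.+2)).
  by apply/eqP; rewrite dif_dif.
have outL q : linear (fun x => exist _ (dif I (o q) (o q.+1) x) (dZ q x) : Z q.+1).
  by move=> c x y; apply: val_inj; rewrite /= linearP.
have Zses q : ses (lin_of (inL q)) (lin_of (outL q)).
  split=> [x y|x|z]; first exact: val_inj.
    split=> [/(congr1 val) /= /eqP dx|[z <-]]; first by exists (exist _ x dx).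
    by apply: val_inj; rewrite /= ZP.
  have oq : o q.+1 < 0 by rewrite /o oppr_lt0.
  have /(homology_trivialP _ (oS q) (oP q.+1))/(_ _ (ZP _ z))[x xz] := Iex _ oq.
  by exists x; apply: val_inj.
have epsZ m : eps m \in kerm (dif I (o 0) (o 1)).
  by apply/eqP/epsE; exists m.
have epsL : linear (fun m => exist _ (eps m) (epsZ m) : Z 0%N).
  by move=> c x y; apply: val_inj; rewrite /= linearP.
have /choice[inv invK] (z : Z 0%N) : exists m, eps m = val z.
  by apply/epsE; exact: (ZP 0%N z).
have epsB : bijective (lin_of epsL).
  exists inv => [m|z]; last by apply: val_inj; rewrite lin_ofE /= invK.
  by apply: eI; rewrite invK.
have invL : linear inv by move=> c x y; apply: eI; rewrite linearP !invK linearP.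
have invB : bijective (lin_of invL).
  exists (lin_of epsL) => [z|m]; last by apply: eI; rewrite lin_ofE invK.
  by apply: val_inj; rewrite lin_ofE /= invK.
have -> : van a k M <-> van a k (Z 0%N).
  by split; [exact: van_iso epsB | exact: van_iso invB].
case: k => [|k] /=.
  rewrite (torsion_homologyP _ (_ : 1 = o 0%N + 1) (oP 0%N)) //; split=> h z zt.
    have {}zt : val z \in torsion a (I (o 0%N)) by exact: (torsion_map (lin_of (inL 0%N))).
    have [y _ yz] := h _ zt (ZP _ z); apply: val_inj; rewrite -yz.
    by rewrite (I0 1 _ y) ?linear0.
  move=> /eqP dz; have z0 : exist _ z dz = 0 :> Z 0%N.
    by apply: h; exact: (torsion_inj (f := lin_of (inL 0%N)) val_inj).
  by exists 0; rewrite ?rpred0 // linear0 -[LHS]/(val (0 : Z 0%N)) -z0.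
have shift j q : vanS a j (Z q) <-> vanS a 0 (Z (j + q)%N).
  elim: j q => [|j IH] q //; rewrite (vanS_shift _ (injI _) (Zses q)) addSnnS.
  exact: IH.
rewrite shift addn0 {shift}.
rewrite (vanS_shift _ (injI _) (Zses k)) /=.
rewrite (torsion_homologyP _ (oS k) (oP k.+1)); split=> h.
  move=> z zt; have {}zt : val z \in torsion a (I (o k.+1)).
    exact: (torsion_map (lin_of (inL k.+1))).
  by have [y yt yz] := h _ zt (ZP _ z); exists y => //; apply: val_inj.
move=> z zt /eqP dz.
have [|y yt /(congr1 val) /= yz] := h (exist _ z dz); last by exists y.
exact: (torsion_inj (f := lin_of (inL k.+1)) val_inj).
Qed.

Definition chosen_resolution (M : lmodType R) := choose_complex (injective_resolution M).

Lemma chosen_resolutionP (M : lmodType R) : injective_resolution M (chosen_resolution M).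
Proof.
rewrite /chosen_resolution /choose_complex; case: pselect => [h|[]].
  by case: cid.
exact: injective_resolution_exists.
Qed.

Lemma local_cohomology_van (M : lmodType R) (k : nat) :
  trivial_module (local_cohomology a k M) <-> van a k M.
Proof. exact/van_resolution/chosen_resolutionP. Qed.

Lemma local_cohomology_neg (M : lmodType R) (i : int) :
  i < 0 -> trivial_module (local_cohomology a i M).
Proof.
move=> i0; have [_ I0 _ _] := chosen_resolutionP M.
have mE : - i + 1 = - i + 1 by []. have m'E : - i - 1 = - i - 1 by [].
apply/(torsion_homologyP _ mE m'E) => z _ _; exists 0; rewrite ?rpred0 // linear0.
by rewrite (I0 _ _ z) // oppr_gt0.
Qed.
End LocalCohomology.

(** * Local cohomology vanishes above the number of generators *)

Section ListTorsion.
Variable R : comPzRingType.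
Implicit Types (M N : lmodType R) (l : seq R) (b : ideal R) (y : R).

Definition ltors l M (x : M) : Prop :=
  forall y : R, y \in l -> exists k, y ^+ k *: x = 0.

Lemma pow_kill_le M (y : R) j k (x : M) :
  (j <= k)%N -> y ^+ j *: x = 0 -> y ^+ k *: x = 0.
Proof. by move=> /subnK <- yx; rewrite exprD -scalerA yx scaler0. Qed.

Lemma ltors_submodule l M : submodule_set (@ltors l M).
Proof.
split=> [y _|x x' tx tx' y yl|c x tx y yl]; first by exists 0%N; rewrite scaler0.
  have [j yj] := tx y yl; have [k yk] := tx' y yl; exists (maxn j k).
  rewrite scalerDr (pow_kill_le (leq_maxl _ _) yj).
  by rewrite (pow_kill_le (leq_maxr _ _) yk) addr0.
by have [j yj] := tx y yl; exists j; rewrite scalerA mulrC -scalerA yj scaler0.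
Qed.

Lemma ltorsB l M (x x' : M) : ltors l x -> ltors l x' -> ltors l (x - x').
Proof.
move=> /(sub_ofP (ltors_submodule l M)) tx /(sub_ofP (ltors_submodule l M)) tx'.
exact/(sub_ofP (ltors_submodule l M))/submodB.
Qed.

Lemma ltorsZ l M c (x : M) : ltors l x -> ltors l (c *: x).
Proof. by have [_ _] := ltors_submodule l M; apply. Qed.

Lemma ltors_map l M N (f : {linear M -> N}) x : ltors l x -> ltors l (f x).
Proof. by move=> tx y /tx[k yk]; exists k; rewrite -linearZ_LR yk linear0. Qed.

Lemma ltors_consP y l M (x : M) :
  ltors (y :: l) x <-> (exists k, y ^+ k *: x = 0) /\ ltors l x.
Proof.
split=> [tx|[yx tx] z]; first by split=> [|z zl]; apply: tx; rewrite ?mem_head // in_cons zl orbT.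
by rewrite in_cons => /orP[/eqP ->|/tx].
Qed.

(** Expanding a product of j + k factors c y + z leaves at least j factors y or
   at least k factors z in every term. *)
Lemma kill_prod_cons M y l (s : seq R) j k (x : M) :
  y ^+ j *: x = 0 ->
  (forall t : seq R, size t = k ->
     (forall r, r \in t -> (r : R^o) \in submod_span [set` (l : seq R^o)]) ->
     (\prod_(r <- t) r) *: x = 0) ->
  size s = (j + k)%N ->
  (forall r, r \in s -> (r : R^o) \in submod_span [set` ((y :: l) : seq R^o)]) ->
  (\prod_(r <- s) r) *: x = 0.
Proof.
elim: s j k x => [|r s IH] j k x yx lx.
  by case: j yx => // yx _ _; move: yx; rewrite expr0 scale1r => ->; rewrite scaler0.
case: j yx => [|j] yx; first by move: yx; rewrite expr0 scale1r => ->; rewrite !scaler0.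
case: k lx => [|k] lx.
  by have := lx [::] erefl; rewrite big_nil scale1r => -> //; rewrite !scaler0.
move=> ss sl; rewrite big_cons mulrC -scalerA.
have /span_consP[c [z zl ->]] := sl r (mem_head _ _).
have sl' r' : r' \in s -> (r' : R^o) \in submod_span [set` ((y :: l) : seq R^o)].
  by move=> r's; apply: sl; rewrite in_cons r's orbT.
rewrite scalerDl scalerDr -[c *: (y : R^o)]/(c * y).
have ss1 : size s = (j + k.+1)%N by case: ss.
have -> : (\prod_(r' <- s) r') *: ((c * y) *: x) = 0.
  apply: (IH j k.+1) => // [|t tk tl].
    by rewrite scalerA mulrCA -exprSr -scalerA yx scaler0.
  by rewrite scalerA mulrC -scalerA lx // scaler0.
rewrite add0r (IH j.+1 k) //; last by rewrite ss1 addnS.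
  by rewrite scalerA mulrC -scalerA yx scaler0.
move=> t tk tl; have := lx (z :: t); rewrite /= tk big_cons mulrC -scalerA.
by apply=> // w; rewrite in_cons => /orP[/eqP ->|/tl].
Qed.

Lemma ltors_kill_prod M l (x : M) : ltors l x -> exists n, forall t : seq R,
  size t = n -> (forall r, r \in t -> (r : R^o) \in submod_span [set` (l : seq R^o)]) ->
  (\prod_(r <- t) r) *: x = 0.
Proof.
elim: l => [|y l IH] => [_|/ltors_consP[[j yx] /IH[k lx]]].
  exists 1%N => -[//|r []] //= _ rl.
  have /span_nilP r0 := rl r (mem_head _ _).
  by rewrite big_cons big_nil [r]r0 mul0r scale0r.
by exists (j + k)%N => t; exact: kill_prod_cons.
Qed.

(** Torsion with respect to a finitely generated ideal can be tested on powers of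
    the generators separately, which allows induction on their number. *)
Lemma torsion_ltors (a : ideal R) l M (x : M) :
  (forall r, (r \in a) = (r \in submod_span [set` (l : seq R^o)])) ->
  x \in torsion a M <-> ltors l x.
Proof.
move=> aE; split=> [/asboolP[n xn] y yl|/ltors_kill_prod[n xn]].
  exists n; apply: xn; apply: mem_span; exists (fun=> y).
  by split=> [_|]; [rewrite aE; exact: mem_span | rewrite prodr_const card_ord].
apply/asboolP; exists n.
have annP : submodule_set (fun r : R^o => (r : R) *: x = 0).
  split=> [|r s rx sx|c r rx]; first by rewrite scale0r.
    by rewrite scalerDl rx sx addr0.
  by rewrite -[c *: r]/(c * r) -scalerA rx scaler0.
move=> r rn; apply/(sub_ofP annP); apply: span_sub rn => _ [f [fa ->]].
apply/(sub_ofP annP).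
have -> : \prod_i f i = \prod_(r <- [seq f i | i <- enum 'I_n]) r.
  by rewrite big_map big_enum.
apply: xn => [|_ /mapP[i _ ->]]; last by rewrite -aE.
by rewrite size_map size_enum_ord.
Qed.
End ListTorsion.

Section Bound.
Variable R : comPzRingType.
Hypothesis noethR : noetherian R.
Implicit Types (M I : lmodType R) (l : seq R) (b : ideal R) (y : R).

(** The colon ideals of [b] by the powers of [y] increase, hence stabilise. *)
Lemma colon_stable b y : exists m0, forall m (r : R),
  (y ^+ m * r : R^o) \in b -> (y ^+ m0 * r : R^o) \in b.
Proof.
have SP : submodule_set (fun r : R^o => exists m, (y ^+ m * r : R^o) \in b).
  have up m k (r : R) : (m <= k)%N -> (y ^+ m * r : R^o) \in b -> (y ^+ k * r : R^o) \in b.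
    move=> /subnK <- rb; rewrite exprD -mulrA.
    exact: (@rpredZ _ R^o b (y ^+ (k - m)) _ rb).
  split=> [|r s [m rm] [k sk]|c r [m rm]]; first by exists 0%N; rewrite mulr0 rpred0.
    exists (maxn m k); rewrite mulrDr rpredD //.
      by apply: up rm; exact: leq_maxl.
    by apply: up sk; exact: leq_maxr.
  exists m; rewrite -[c *: r]/(c * r) mulrCA; exact: (@rpredZ _ R^o b c _ rm).
have [s sP] := noethR (sub_of SP).
have [m0 m0P] : exists m0, forall r : R, r \in s -> (y ^+ m0 * r : R^o) \in b.
  have : forall r : R, r \in s -> exists m, (y ^+ m * r : R^o) \in b.
    by move=> r rs; apply/(sub_ofP SP); rewrite sP; exact: mem_span.
  elim: (s) => [|r t IH] h; first by exists 0%N.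
  have [m rm] := h r (mem_head _ _).
  have [|k tk] := IH; first by move=> z zt; apply: h; rewrite in_cons zt orbT.
  exists (m + k)%N => z; rewrite in_cons => /orP[/eqP ->|/tk zk].
    rewrite exprD -mulrA mulrCA; exact: (@rpredZ _ R^o b (y ^+ k) _ rm).
  by rewrite exprD -mulrA; exact: (@rpredZ _ R^o b (y ^+ m) _ zk).
have mulP : submodule_set (fun r : R^o => (y ^+ m0 * r : R^o) \in b).
  split=> [|r t rb tb|c r rb]; first by rewrite mulr0 rpred0.
    by rewrite mulrDr rpredD.
  by rewrite -[c *: r]/(c * r) mulrCA; exact: (@rpredZ _ R^o b c _ rb).
exists m0 => m r rm; have : (r : R^o) \in sub_of SP by apply/sub_ofP; exists m.
rewrite sP => rs; apply/(sub_ofP mulP); apply: span_sub rs => z /= zs.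
by apply/(sub_ofP mulP); exact: m0P.
Qed.

(** Baer's condition survives the passage to torsion elements.  Let [y] be the first
    element of the list and [y ^+ K] kill the values of [f].  By stability of the
    colon ideals (Artin-Rees for a principal ideal), [f] extends by zero to the
    ideal generated by [b] and a high power of [y], so that the value at 1 found
    by induction is killed by that power. *)
Lemma baer_ltors I l b (f : {linear subm b -> I}) : injective_module I ->
  (forall r, ltors l (f r)) ->
  exists2 e : I, ltors l e & forall r, f r = (val r : R) *: e.
Proof.
move=> injI; elim: l b f => [|y l IH] b f fl.
  have lin : linear (fun r : subm b => (val r : R^o)) by move=> c u v; rewrite linearP.
  have [g gE] := injI _ _ (lin_of lin) f val_inj.
  exists (g (1 : R)) => // r; rewrite -gE lin_ofE -linearZ_LR; congr (g _).
  by rewrite -[RHS]/((val r : R) * 1) mulr1.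
have {}fl r : (exists k, y ^+ k *: f r = 0) /\ ltors l (f r) by apply/ltors_consP.
have [K KP] : exists K, forall r, y ^+ K *: f r = 0.
  have [s sb] : finitely_generated (subm b).
    by apply/fg_subm/(@fg_submodule R noethR (R^o)); exists [:: (1 : R^o)] => x;
      apply/span_consP; exists x, 0; rewrite ?rpred0 // addr0 -[LHS]mulr1.
  have [K KP] : exists K, forall r, r \in s -> y ^+ K *: f r = 0.
    elim: (s) => [|r t [K KP]]; first by exists 0%N.
    have [[k rk] _] := fl r; exists (k + K)%N => z.
    rewrite in_cons => /orP[/eqP ->|/KP zK]; first exact: pow_kill_le (leq_addr _ _) rk.
    exact: pow_kill_le (leq_addl _ _) zK.
  exists K => r; suff: r \in kerm (homothety (y ^+ K) \o f) by move/eqP.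
  by apply: span_sub (sb r) => z /= /KP zK; apply/eqP.
have [m0 m0P] := colon_stable b y; pose m := (m0 + K)%N.
have b'P : submodule_set (fun x : R^o => exists (r : subm b) (t : R), x = val r + y ^+ m * t).
  split=> [|_ _ [r [t ->]] [r' [t' ->]]|c _ [r [t ->]]].
  - by exists 0, 0; rewrite mulr0 addr0.
  - by exists (r + r'), (t + t'); rewrite linearD mulrDr addrACA.
  - exists (c *: r), (c * t).
    by rewrite linearZ_LR scalerDr -[c *: (y ^+ m * t : R^o)]/(c * (y ^+ m * t)) mulrCA.
have wd (r : subm b) (t : R) : (val r : R) + y ^+ m * t = 0 -> f r = 0.
  move=> rt; have rE : (val r : R) = y ^+ m * - t.
    by rewrite mulrN; apply/eqP; rewrite -addr_eq0 rt.
  have tb : (y ^+ m0 * - t : R^o) \in b by apply: (m0P m); rewrite -rE; exact: valP.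
  have -> : r = y ^+ K *: (exist _ (y ^+ m0 * - t) tb : subm b).
    apply: val_inj; rewrite linearZ_LR [LHS]rE /m exprD [_ ^+ m0 * _]mulrC -mulrA.
    by [].
  by rewrite linearZ_LR KP.
have /choice[rr /choice[tt rtE]] (x : subm (sub_of b'P)) :
    exists (r : subm b) (t : R), val x = val r + y ^+ m * t :> R^o.
  by apply/(sub_ofP b'P); exact: valP.
have wd2 (r : subm b) (t : R) x : val x = val r + y ^+ m * t :> R^o -> f (rr x) = f r.
  rewrite rtE => E; apply/eqP; rewrite -subr_eq0 -linearB; apply/eqP.
  apply: (wd _ (tt x - t)); rewrite linearB mulrBr addrACA -opprD.
  by apply/eqP; rewrite subr_eq0; apply/eqP.
have lin : linear (fun x => f (rr x)).
  move=> c x x'; rewrite -linearP; apply: (wd2 _ (c * tt x + tt x')).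
  rewrite !val_submP !rtE scalerDr mulrDr addrACA.
  by rewrite -[c *: (y ^+ m * tt x : R^o)]/(c * (y ^+ m * tt x)) mulrCA.
have [|e el eE] := IH _ (lin_of lin); first by move=> x; have [_] := fl (rr x).
have rb' (r : subm b) : (val r : R^o) \in sub_of b'P.
  by apply/sub_ofP; exists r, 0; rewrite mulr0 addr0.
have yb' : (y ^+ m : R^o) \in sub_of b'P.
  by apply/sub_ofP; exists 0, 1; rewrite mulr1 add0r.
exists e => [|r]; last first.
  rewrite -(eE (exist _ (val r) (rb' r) : subm (sub_of b'P))) lin_ofE (wd2 r 0) //.
  by rewrite mulr0 addr0.
apply/ltors_consP; split=> //; exists m.
rewrite -(eE (exist _ (y ^+ m : R^o) yb' : subm (sub_of b'P))) lin_ofE (wd2 0 1) ?linear0 //.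
by rewrite mulr1 add0r.
Qed.

(** With [n] such that the annihilators of [y ^+ n] and [y ^+ n.+1] agree, the map
    sending [y ^+ n.+1 * r] to [y ^+ n * r *: e] is well defined on the ideal
    generated by [y ^+ n.+1]; extend it and take the value at 1. *)
Lemma ltors_divide I l y (e : I) : injective_module I -> ltors l e ->
  exists2 e' : I, ltors l e' & exists k, y ^+ k *: (e - y *: e') = 0.
Proof.
move=> injI el; have zP : submodule_set (fun r : R^o => r = 0).
  by split=> // [r s -> ->|c r ->]; rewrite ?addr0 ?scaler0.
have [n nP] := colon_stable (sub_of zP) y.
have nE r : y ^+ n.+1 * r = 0 -> y ^+ n * r = 0.
  by move=> yr; apply/(sub_ofP zP)/(nP n.+1)/sub_ofP.
have bP : submodule_set (fun x : R^o => exists t, y ^+ n.+1 * t = x).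
  split=> [|_ _ [t <-] [t' <-]|c _ [t <-]].
  - by exists 0; rewrite mulr0.
  - by exists (t + t'); rewrite mulrDr.
  - by exists (c * t); rewrite mulrCA.
have /choice[tt ttE] (x : subm (sub_of bP)) : exists t, y ^+ n.+1 * t = val x :> R^o.
  by apply/(sub_ofP bP); exact: valP.
have wd x t : y ^+ n.+1 * t = val x :> R^o -> y ^+ n * tt x = y ^+ n * t.
  move=> tx; apply/eqP; rewrite -subr_eq0 -mulrBr; apply/eqP/nE.
  by rewrite mulrBr ttE tx subrr.
have lin : linear (fun x => (y ^+ n * tt x) *: e).
  move=> c x x'; rewrite (wd _ (c * tt x + tt x')); last first.
    by rewrite mulrDr mulrCA !ttE val_submP.
  by rewrite mulrDr mulrCA scalerDl scalerA.
have [|e' e'l e'E] := @baer_ltors I l _ (lin_of lin) injI.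
  by move=> r; exact: ltorsZ.
exists e' => //; exists n; rewrite scalerBr scalerA -exprSr.
have yb : (y ^+ n.+1 : R^o) \in sub_of bP by apply/sub_ofP; exists 1; rewrite mulr1.
rewrite -[y ^+ n.+1]/(val (exist _ (y ^+ n.+1 : R^o) yb : subm (sub_of bP))) -e'E.
by rewrite lin_ofE (wd _ 1) mulr1 ?subrr.
Qed.

Lemma ltors_divide_pow I l y (e : I) k : injective_module I -> ltors l e ->
  exists2 e' : I, ltors l e' & exists j, y ^+ j *: (e - y ^+ k *: e') = 0.
Proof.
move=> injI el; elim: k => [|k [e' e'l [j ej]]].
  by exists e => //; exists 0%N; rewrite expr0 !scale1r subrr.
have [e'' e''l [i ei]] := ltors_divide y injI e'l; exists e'' => //.
exists (i + j)%N; have -> : e - y ^+ k.+1 *: e'' =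
    (e - y ^+ k *: e') + y ^+ k *: (e' - y *: e'').
  by rewrite scalerBr addrA subrK exprSr scalerA.
rewrite scalerDr (pow_kill_le (leq_addl _ _) ej) add0r scalerA mulrC -scalerA.
by rewrite (pow_kill_le (leq_addr _ _) ei) scaler0.
Qed.

(** Each generator [y] costs one degree.  A torsion cycle [z] is the boundary of some
    [w] which is torsion for the other generators; a multiple [y ^+ k *: w] is a
    cycle, hence a boundary, and dividing its primitive by [y ^+ k] corrects [w]
    to a [y]-torsion element. *)
Lemma ltors_exact (I : complex R) l (n m m' : int) :
  (forall n, injective_module (I n)) ->
  (forall n, n < 0 -> trivial_module (homology I n)) ->
  m = n + 1 -> m' = n - 1 -> n + (size l)%:Z < 0 ->
  forall z, ltors l z -> dif I n m' z = 0 -> exists2 y, ltors l y & dif I m n y = z.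
Proof.
move=> injI Iex; elim: l n m m' => [|y l IH] n m m' mE m'E nl z zl dz.
  rewrite addr0 in nl; have /(homology_trivialP _ mE m'E)/(_ z dz)[y yz] := Iex _ nl.
  by exists y.
have {}nl : m + (size l)%:Z < 0 by rewrite mE -addrA -PoszD add1n.
have nl' : n + (size l)%:Z < 0 by apply: lt_trans nl; rewrite mE addrAC ltrDl.
have /ltors_consP[[k yz] zl'] := zl.
have [w wl wz] := IH n m m' mE m'E nl' z zl' dz.
have nE : n = m - 1 by rewrite mE addrK.
have [|v vl vw] := IH m (m + 1) n erefl nE nl (y ^+ k *: w) (ltorsZ _ wl).
  by rewrite linearZ_LR wz.
have [v' v'l [j vj]] := ltors_divide_pow y k (injI _) vl.
exists (w - dif I (m + 1) m v'); last by rewrite linearB wz dif_dif subr0.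
apply/ltors_consP; split; last exact/ltorsB/ltors_map.
exists (j + k)%N; rewrite exprD -scalerA scalerBr -vw -linearZ_LR -linearB.
by rewrite -linearZ_LR vj linear0.
Qed.

Lemma van_bound (a : ideal R) :
  exists n0, forall (M : lmodType R) k, (n0 < k)%N -> van a k M.
Proof.
have [l aE] := noethR a; exists (size l) => M k kl.
have [injI _ _ Iex] := chosen_resolutionP M.
apply/(van_resolution a k (chosen_resolutionP M)).
apply/(torsion_homologyP a (chosen_resolution M) (erefl (- k%:Z + 1)) (erefl (- k%:Z - 1))) => z.
move=> /(torsion_ltors _ aE) zl dz.
have kl0 : - k%:Z + (size l)%:Z < 0 by rewrite addrC subr_lt0 ltz_nat.
have [y yl yz] := ltors_exact injI Iex erefl erefl kl0 zl dz.
by exists y => //; apply/(torsion_ltors _ aE).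
Qed.
End Bound.

(** * Vanishing depends on supports only *)

Section Devissage.
Variable R : comPzRingType.
Hypothesis noethR : noetherian R.
Implicit Types (M N : lmodType R) (b : ideal R).

(** A counterexample would start a strictly increasing sequence of ideals, whose
    union is finitely generated. *)
Lemma noetherian_ind (P : ideal R -> Prop) :
  (forall b : ideal R, (forall b' : ideal R, [set` b] `<` [set` b'] -> P b') -> P b) ->
  forall b : ideal R, P b.
Proof.
move=> Pind b0; apply: contrapT => Pb0.
pose bad := {b : ideal R | ~ P b}.
have /choice[f fP] (x : bad) : exists y : bad, [set` sval x] `<` [set` sval y].
  case: x => b Pb /=; apply: contrapT => no; apply: Pb; apply: Pind => b' bb'.
  by apply: contrapT => Pb'; apply: no; exists (exist _ b' Pb').
pose u n := sval (iter n f (exist _ b0 Pb0)).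
have uS n : [set` u n] `<` [set` u n.+1] by exact: fP.
have u_mono m n x : (m <= n)%N -> x \in u m -> x \in u n.
  move=> /subnK <-; elim: (n - m)%N => [//|k IH] /IH.
  by have [h _] := uS (k + m)%N; exact: h.
have UP : submodule_set (fun x => exists n, x \in u n).
  split=> [|x y [m xm] [n yn]|c x [n xn]]; first by exists 0%N; rewrite rpred0.
    exists (maxn m n); rewrite rpredD //.
      by apply: u_mono xm; exact: leq_maxl.
    by apply: u_mono yn; exact: leq_maxr.
  by exists n; rewrite rpredZ.
have [s sP] := noethR (sub_of UP).
have [n sn] : exists n, forall x, x \in s -> x \in u n.
  have : forall x, x \in s -> exists n, x \in u n.
    by move=> x xs; apply/(sub_ofP UP); rewrite sP; exact: mem_span.
  elim: (s) => [|x t IH] h; first by exists 0%N.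
  have [m xm] := h x (mem_head _ _).
  have [|n tn] := IH; first by move=> z zt; apply: h; rewrite in_cons zt orbT.
  exists (maxn m n) => z; rewrite in_cons => /orP[/eqP ->|/tn zn].
    by apply: u_mono xm; exact: leq_maxl.
  by apply: u_mono zn; exact: leq_maxr.
have [_] := uS n; apply=> x xn.
have : x \in sub_of UP by apply/sub_ofP; exists n.+1.
by rewrite sP; apply: span_sub.
Qed.

Lemma supp_surj (p : ideal R) M N (f : {linear M -> N}) :
  surj f -> supp p N -> supp p M.
Proof.
move=> fS Np r rM; apply: Np => y; have [x <-] := fS y.
by rewrite -linearZ_LR rM linear0.
Qed.

Lemma supp_inj (p : ideal R) M N (f : {linear M -> N}) :
  injective f -> supp p M -> supp p N.
Proof.
move=> fI Mp r rN; apply: Mp => x; apply: (linear_inj0 fI).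
by rewrite linearZ_LR rN.
Qed.

Definition image M N (f : {linear M -> N}) : lmodType R :=
  subm (sub_of (image_submodule f)).

Lemma image_factor M N (f : {linear M -> N}) :
  exists (g : {linear M -> image f}) (i : {linear image f -> N}),
    [/\ surj g, injective i & forall x, i (g x) = f x].
Proof.
have inI x : f x \in sub_of (image_submodule f) by apply/sub_ofP; exists x.
have glin : linear (fun x => exist _ (f x) (inI x) : image f).
  by move=> c x y; apply: val_inj; rewrite /= linearP.
have ilin : linear (fun y : image f => val y) by move=> c x y; exact: val_submP.
exists (lin_of glin), (lin_of ilin); split=> [y|y z|//]; last exact: val_inj.
have /(sub_ofP (image_submodule f))[x xy] := valP y.
by exists x; apply: val_inj.
Qed.

Variable a : ideal R.
Variables (Fam : lmodType R -> Prop) (i : nat).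
Hypothesis Fam_fg : forall M, Fam M -> finitely_generated M.
Hypothesis Fam_van : forall M j, Fam M -> (i <= j)%N -> van a j M.

Let covered N := forall p : ideal R, prime_ideal p -> supp p N ->
  exists2 M, Fam M & supp p M.

Let covered_surj M N (f : {linear M -> N}) : surj f -> covered M -> covered N.
Proof. by move=> fS Mc p pp /(supp_surj fS); exact: Mc. Qed.
Let covered_inj M N (f : {linear M -> N}) : injective f -> covered N -> covered M.
Proof. by move=> fI Mc p pp /(supp_inj fI); exact: Mc. Qed.

Section Step.
Variable j : nat.
Hypothesis ij : (i <= j)%N.
Hypothesis IHj : forall N, finitely_generated N -> covered N -> van a j.+1 N.

(** Noetherian induction on the annihilator [b] of the cyclic module [N].  If [b] is
    proper but not prime, [N] is an extension of cyclic modules with larger annihilators.  If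
    it is prime, a member of the family maps onto a nonzero submodule of [N], the
    kernel being dealt with in degree [j.+1], and the quotient of [N] by that
    submodule again has a larger annihilator. *)
Lemma van_cyclic b : forall N (g : {linear R^o -> N}), surj g ->
  (forall r, (r \in b) <-> g r = 0) -> covered N -> van a j N.
Proof.
elim/noetherian_ind: b => b IH N g gS gb Nc.
have grow N' (g' : {linear R^o -> N'}) r : surj g' -> covered N' ->
    (forall s, s \in b -> g' s = 0) -> r \notin b -> g' r = 0 -> van a j N'.
  move=> gS' cN' g'b rb g'r; apply: (IH (kerm g') _ _ g') => //.
    split=> [s /g'b/eqP //|]; move=> /(_ r).
    by move/negP: rb => rb; move=> h; apply: rb; apply: h; apply/eqP.
  by move=> s; split=> /eqP.
have [b1|b1] := boolP ((1 : R^o) \in b).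
  apply: van_trivial => x; have [r <-] := gS x; apply/gb.
  by rewrite -[r]mulr1 -[_ * _]/(r *: (1 : R^o)) rpredZ.
have [bM|] := pselect (forall x y : R, (x * y : R^o) \in b ->
    (x : R^o) \in b \/ (y : R^o) \in b); last first.
  move=> /existsNP[x /existsNP[y /not_implyP[xyb /not_orP[/negP xb /negP yb]]]].
  pose gx : {linear R^o -> N} := g \o homothety x.
  have [h [k [hS kI kh]]] := image_factor gx; have [C [q kq]] := ses_coker kI.
  have [_ qE qS] := kq; apply: (van_ext kq).
    apply: (grow _ h y hS (covered_inj kI Nc)) => // [s sb|].
      by apply: (linear_inj0 kI); rewrite kh; apply/gb; rewrite rpredZ.
    by apply: (linear_inj0 kI); rewrite kh; apply/gb.
  apply: (grow _ (q \o g) x) => //.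
  - by move=> c; have [n <-] := qS c; have [r <-] := gS n; exists r.
  - exact: covered_surj qS Nc.
  - by move=> s /gb /= ->; rewrite linear0.
  - apply/qE; exists (h 1); rewrite kh /= /homothety.
    by rewrite -[x *: _]/(x * 1) mulr1.
have bp : prime_ideal b by [].
have [M FM Mb] : exists2 M, Fam M & supp b M.
  apply: Nc bp _ => r rN; apply/gb.
  by rewrite -[r]mulr1 -[_ * _]/(r *: (1 : R^o)) linearZ_LR rN.
have [h [x hx]] := supp_map bp (Fam_fg FM) Mb.
have [th thE] := @factor_through_surj _ _ _ _ (quot_pi b) g (@quot_pi_surj _ _ b)
  (fun r => iffLR (iff_trans (quot_pi_eq0 b r) (gb r))).
have thI : injective th.
  apply: linear_inj => y; have [r <-] := quot_pi_surj y.
  by rewrite thE => /gb/quot_pi0.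
have [u [k [uS kI ku]]] := image_factor (th \o h).
have [C [q kq]] := ses_coker kI; have [_ qE qS] := kq.
apply: (van_ext kq).
  have inK : linear (fun z : subm (kerm u) => val z).
    by move=> c y z; exact: val_submP.
  have Kses : ses (lin_of inK) u.
    split=> [y z|m|//]; first exact: val_inj.
    split=> [/eqP um|[z <-]]; first by exists (exist _ m um).
    by apply/eqP/(valP z).
  apply: (van_quot Kses (Fam_van FM ij)); apply: IHj.
    exact: fg_subm_noeth (Fam_fg FM).
  move=> p pp /(@supp_inj _ _ _ (lin_of inK) (@val_inj _ _ _)) Mp.
  by exists M.
have [t tE] := quot_pi_surj (h x).
apply: (grow _ (q \o g) t) => //.
- by move=> c; have [n <-] := qS c; have [r <-] := gS n; exists r.
- exact: covered_surj qS Nc.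
- by move=> s /gb /= ->; rewrite linear0.
- by apply/negP => /quot_pi_eq0 t0; apply: hx; rewrite -tE.
- by apply/qE; exists (u x); rewrite ku /= -tE thE.
Qed.

Lemma van_covered N : finitely_generated N -> covered N -> van a j N.
Proof.
move=> [s]; have [n] := ubnP (size s).
elim: n N s => [//|n IH] N [|m s] /= sn sN Nc.
  by apply: van_trivial => x; exact/span_nilP/sN.
have mlin : linear (fun r : R^o => (r : R) *: m).
  by move=> c x y; rewrite scalerDl -scalerA.
have [h [k [hS kI kh]]] := image_factor (lin_of mlin).
have [C [q kq]] := ses_coker kI; have [_ qE qS] := kq.
apply: (van_ext kq).
  apply: (@van_cyclic (kerm h) _ h hS _ (covered_inj kI Nc)) => r.
  by split=> /eqP.
apply: (IH C (map q s) _ _ (covered_surj qS Nc)); first by rewrite size_map.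
move=> c; have [x <-] := qS c.
have /span_consP[r [y ys ->]] := span_map q (sN x).
have -> : q m = 0 by apply/qE; exists (h 1); rewrite kh lin_ofE scale1r.
by rewrite scaler0 add0r.
Qed.
End Step.

(** Descending induction on the degree, starting above the number of generators of
    [a], where all local cohomology vanishes. *)
Theorem van_support N : finitely_generated N -> covered N -> van a i N.
Proof.
have [n0 n0P] := van_bound noethR a.
have main d : forall j N', (i <= j)%N -> (n0 < j + d)%N ->
    finitely_generated N' -> covered N' -> van a j N'.
  elim: d => [|d IH] j N' ij; first by rewrite addn0 => /n0P van_j _ _; exact: van_j.
  rewrite addnS -addSn => jd; apply: van_covered => // N'' fN cN.
  by apply: IH => //; exact: leqW.
by apply: (main n0.+1 i N (leqnn i)); rewrite addnS ltnS leq_addl.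
Qed.
End Devissage.

(** * Quasi-isomorphisms and mapping cones *)

Section QuasiIso.
Variable R : pzRingType.
Implicit Types X Y : complex R.

(** Bijectivity in homology, spelled out on cycles and boundaries; the neighbours of
    [n] are variables so that no index has to be cast. *)
Lemma quasi_isoP X Y (f : chain_map X Y) : quasi_iso f <->
  forall n m m', m = n + 1 -> m' = n - 1 ->
   (forall x, dif X n m' x = 0 -> (exists w, dif Y m n w = f n x) ->
      exists x', dif X m n x' = x) /\
   (forall y, dif Y n m' y = 0 -> exists2 x, dif X n m' x = 0 &
      exists w, dif Y m n w = y - f n x).
Proof.
have mapE n (z : subm (cycles X n)) : homology_map f n (quot_pi _ z) =
    quot_pi (boundaries Y n) (restr (@cycles_map _ _ _ f n) z).
  by rewrite /homology_map quot_liftE.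
split=> [fQ n _ _ -> ->|fE n].
  have [g fK gK] := fQ n; split=> [x /eqP xc [w wx]|y /eqP yc].
    pose z : subm (cycles X n) := exist _ x xc.
    have /quot_pi_eq0/asboolP[x' xx'] : quot_pi (boundaries X n) z = 0.
      apply: (can_inj fK); rewrite mapE linear0; apply/quot_pi_eq0/asboolP.
      by exists w.
    by exists x'; rewrite -xx'.
  pose z : subm (cycles Y n) := exist _ y yc.
  pose u := quot_repr (g (quot_pi _ z)).
  exists (val u); first exact/eqP/(valP u).
  have : quot_pi (boundaries Y n) z = quot_pi _ (restr (@cycles_map _ _ _ f n) u).
    by rewrite -mapE quot_reprK gK.
  by move=> /quot_piP/asboolP[w /= wE]; exists w; rewrite -wE.
have [finj fsurj] := fE n _ _ erefl erefl.
have inj0 h : homology_map f n h = 0 -> h = 0.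
  rewrite -(quot_reprK h) mapE => /quot_pi_eq0/asboolP[w wE].
  have [|x xE] := finj (val (quot_repr h)) (eqP (valP (quot_repr h))).
    by exists w; rewrite -wE.
  by apply/quot_pi_eq0/asboolP; exists x.
have inj : injective (homology_map f n).
  by move=> h h' /eqP; rewrite -subr_eq0 -linearB => /eqP/inj0/eqP; rewrite subr_eq0 => /eqP.
have /choice[g gK] h : exists h', homology_map f n h' = h.
  have [x xc [w wE]] := fsurj (val (quot_repr h)) (eqP (valP (quot_repr h))).
  have xC : x \in cycles X n by apply/eqP.
  exists (quot_pi (boundaries X n) (exist _ x xC)); rewrite mapE -[RHS]quot_reprK.
  apply/esym/quot_piP/asboolP; exists w; rewrite wE.
  by [].
by exists g => // h; apply: inj.
Qed.

Definition isom (M N : lmodType R) : Prop := exists f : {linear M -> N}, bijective f.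

Lemma isom_sym M N : isom M N -> isom N M.
Proof.
move=> [f [g fK gK]].
have lin : linear g by move=> c x y; apply: (can_inj fK); rewrite linearP !gK.
by exists (lin_of lin); exists f.
Qed.

Lemma isom_trans M N P : isom M N -> isom N P -> isom M P.
Proof. by move=> [f fB] [g gB]; exists (g \o f); exact: bij_comp. Qed.

Lemma isom_surj M N : isom M N -> exists2 f : {linear M -> N}, surj f & injective f.
Proof.
by move=> [f [g fK gK]]; exists f; [move=> y; exists (g y) | exact: can_inj fK].
Qed.

Lemma quasi_iso_isom X Y (f : chain_map X Y) n :
  quasi_iso f -> isom (homology X n) (homology Y n).
Proof. by move=> fQ; exists (homology_map f n); exact: fQ. Qed.

Section Cone.
Variables (Q Y : complex R) (f : chain_map Q Y).

Let obj_cone (n : int) : lmodType R := (Y n * Q (n - 1))%type.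
Let dif_cone_fun i j (c : obj_cone i) : obj_cone j :=
  (dif Y i j c.1 + tr Y (i - 1) j (f (i - 1) c.2), - dif Q (i - 1) (j - 1) c.2).
Let dif_cone_linear i j : linear (@dif_cone_fun i j).
Proof.
move=> c x y; congr (_, _); rewrite /= !linearP /= ?linearP /=.
  by rewrite addrACA -scalerDr.
by [].
Qed.
Let dif_cone i j : {linear obj_cone i -> obj_cone j} := lin_of (@dif_cone_linear i j).
Let shape_cone i j : i != j + 1 -> forall x, dif_cone i j x = 0.
Proof.
move=> ij x; rewrite /dif_cone lin_ofE /dif_cone_fun dif_shape // dif_shape.
  by rewrite tr_neq ?oppr0 ?addr0 // subr_eq.
by apply: contra ij; rewrite addrAC => /eqP/addIr ->.
Qed.
Let dd_cone i j k x : dif_cone j k (dif_cone i j x) = 0.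
Proof.
have [jk|jk] := eqVneq j (k + 1); last exact: shape_cone.
have [ij|ij] := eqVneq i (j + 1); last by rewrite (shape_cone ij) linear0.
have i1 : i - 1 = j by rewrite ij addrK.
have j1 : j - 1 = k by rewrite jk addrK.
have dQ : dif Q (j - 1) (k - 1) (- dif Q (i - 1) (j - 1) x.2) = 0.
  by rewrite linearN dif_dif oppr0.
have fQ : f (j - 1) (- dif Q (i - 1) (j - 1) x.2) =
    - dif Y (i - 1) (j - 1) (f (i - 1) x.2).
  by rewrite linearN cmap_d.
rewrite /dif_cone !lin_ofE /dif_cone_fun /= dQ fQ oppr0.
have -> : dif Y j k (dif Y i j x.1 + tr Y (i - 1) j (f (i - 1) x.2)) =
    dif Y j k (tr Y (i - 1) j (f (i - 1) x.2)) by rewrite linearD dif_dif add0r.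
rewrite linearN; congr (_, _).
move: (i - 1) i1 {x dQ fQ}(f (i - 1) x.2) => q qj y.
by case: j / qj {jk ij} j1 => j1; case: k / j1; rewrite !tr_id subrr.
Qed.

Definition cone : complex R := Complex shape_cone dd_cone.

Lemma cone_difE i j (y : Y i) (x : Q (i - 1)) : dif cone i j ((y, x) : cone i) =
  (dif Y i j y + tr Y (i - 1) j (f (i - 1) x), - dif Q (i - 1) (j - 1) x).
Proof. by []. Qed.

Lemma cone_acyclic : quasi_iso f -> acyclic cone.
Proof.
move=> /quasi_isoP fE n; apply/(homology_trivialP _ erefl erefl) => -[y x].
rewrite cone_difE tr_id => -[yx /eqP]; rewrite oppr_eq0 => /eqP xc.
have [finj _] := fE (n - 1) n (n - 1 - 1) (esym (subrK 1 n)) erefl.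
have [x' x'E] : exists x', dif Q n (n - 1) x' = x.
  apply: finj => //; exists (- y); rewrite linearN.
  by apply/eqP; rewrite eqr_oppLR -addr_eq0 yx.
have [_ fsurj] := fE n (n + 1) (n - 1) erefl erefl.
have [|z zc [v vE]] := fsurj (y + f n x').
  by rewrite linearD -cmap_d x'E.
have nE : n = n + 1 - 1 by rewrite addrK.
exists ((v, tr Q n (n + 1 - 1) (z - x')) : cone (n + 1)); rewrite cone_difE.
have fzx : f n (z - x') = f n z - f n x' by rewrite linearB.
have dzx : dif Q n (n - 1) (z - x') = - x by rewrite linearB zc x'E sub0r.
case: (n + 1 - 1) / nE; rewrite !tr_id vE fzx dzx opprK.
by rewrite addrA subrK addrK.
Qed.
End Cone.
End QuasiIso.

(** * Tensor products of complexes *)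

Section TensorComplexes.
Variable R : comPzRingType.
Implicit Types P A Q Y : complex R.

Lemma tensor_dif_val P A n (x : tensor_complex P A (n + 1)) :
  val (dif (tensor_complex P A) (n + 1) n x) = tensor_diff (val x).
Proof. by rewrite /= /tensor_dfun eqxx. Qed.

Lemma tensor_dif_val' P A n m (x : tensor_complex P A n) : n = m + 1 ->
  val (dif (tensor_complex P A) n m x) = tensor_diff (val x).
Proof. by move=> /eqP nE; rewrite /= /tensor_dfun nE. Qed.

Lemma tensor_homologyP P A n : trivial_module (homology (tensor_complex P A) n) <->
  forall z, z \in tensor_obj P A n -> tensor_diff z = 0 ->
    exists2 y, y \in tensor_obj P A (n + 1) & tensor_diff y = z.
Proof.
rewrite (homology_trivialP _ erefl erefl); split=> h z.
  move=> zn dz; have [|[y yn] yz] := h (exist _ z zn).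
    by apply: val_inj; rewrite tensor_dif_val' ?subrK.
  by exists y => //; rewrite -[RHS]/(val (exist _ z zn : tensor_complex P A n)) -yz tensor_dif_val.
case: z => z zn /(congr1 val); rewrite tensor_dif_val' ?subrK // => dz.
have [y yn yz] := h z zn dz; exists (exist _ y yn).
by apply: val_inj; rewrite tensor_dif_val.
Qed.

Lemma tensor_obj_deg P A n (z : prodm (bimod P A)) p :
  z \in tensor_obj P A n -> p.1 + p.2 != n -> z p = 0.
Proof.
move=> /asboolP[_ zn] pn; apply: contrapT => zp.
by move/negP: pn; apply; apply/eqP; exact: zn.
Qed.

(** Maps acting componentwise, up to a shift of the indices, keep supports finite. *)
Lemma dsum_shift (I : Type) (M N : I -> lmodType R) (s t : I -> I) (S T : set I)
    (L : prodm M -> prodm N) : cancel s t -> (forall p, S (s p) -> T p) ->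
  (forall x p, x (s p) = 0 -> L x p = 0) ->
  forall x, x \in dsum M S -> L x \in dsum N T.
Proof.
move=> st ST L0 x /asboolP[xfin xS]; apply/asboolP.
have Lx : [set p | L x p <> 0] `<=` t @` [set p | x p <> 0].
  by move=> p /= Lxp; exists (s p) => //= xp; apply/Lxp/L0.
split; first by apply: sub_finite_set Lx _; exact: finite_image.
by move=> p /= Lxp; apply/ST/xS => /= xp; apply/Lxp/L0.
Qed.

Lemma tensor_mapD (M N M' N' : lmodType R) (f : {linear M -> M'})
    (g : {linear N -> N'}) x y :
  tensor_map f g (x + y) = tensor_map f g x + tensor_map f g y.
Proof. exact: linearD. Qed.

Lemma tensor_mapZ (M N M' N' : lmodType R) (f : {linear M -> M'})
    (g : {linear N -> N'}) c x : tensor_map f g (c *: x) = c *: tensor_map f g x.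
Proof. exact: linearZ_LR. Qed.

Lemma tensor_map0 (M N M' N' : lmodType R) (f : {linear M -> M'})
    (g : {linear N -> N'}) : tensor_map f g 0 = 0.
Proof. exact: linear0. Qed.

Lemma tensor_map_eq (M N M' N' : lmodType R) (f f' : {linear M -> M'})
    (g g' : {linear N -> N'}) x : f =1 f' -> g =1 g' ->
  tensor_map f g x = tensor_map f' g' x.
Proof.
by move=> ff gg; apply: tensor_ext x => m n /=; rewrite !tensor_map_tens ff gg.
Qed.

Lemma tensor_map_id (M N : lmodType R) (f : {linear M -> M}) (g : {linear N -> N}) x :
  f =1 id -> g =1 id -> tensor_map f g x = x.
Proof.
move=> fi gi; apply: (tensor_ext (g := idfun)) => m n.
by rewrite /= tensor_map_tens fi gi.
Qed.

Lemma tensor_map_zero (M N M' N' : lmodType R) (f : {linear M -> M'})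
    (g : {linear N -> N'}) x : (forall n, g n = 0) -> tensor_map f g x = 0.
Proof. by move=> g0; apply: tensor_map_eq0 => m n; rewrite g0 tens0r. Qed.

Lemma tensor_mapDr (M N M' N' : lmodType R) (f : {linear M -> M'})
    (g h k : {linear N -> N'}) x : (forall n, g n = h n + k n) ->
  tensor_map f g x = tensor_map f h x + tensor_map f k x.
Proof.
move=> gE; have lin : linear (fun x => tensor_map f h x + tensor_map f k x).
  by move=> c u v; rewrite !tensor_mapD !tensor_mapZ addrACA -scalerDr.
apply: (tensor_ext (g := lin_of lin)) => m n.
by rewrite lin_ofE /= !tensor_map_tens gE tensDr.
Qed.

Definition sgn (i : int) : R := (-1) ^+ absz i.
Lemma sgn_sq i : sgn i * sgn i = 1.
Proof. by rewrite /sgn -expr2 sqrr_sign. Qed.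
Lemma sgnS i : sgn (i + 1) = - sgn i. Proof. exact: sign_absz_succ. Qed.

Lemma tensor_diff_sgn P A (x : prodm (bimod P A)) p q : tensor_diff x (p, q) =
  tensor_map (dif P (p + 1) p) idfun (x (p + 1, q)) +
  sgn p *: tensor_map idfun (dif A (q + 1) q) (x (p, q + 1)).
Proof. by []. Qed.

Lemma tensor_diffD P A (x y : prodm (bimod P A)) :
  tensor_diff (x + y) = tensor_diff x + tensor_diff y.
Proof. exact: linearD. Qed.
Lemma tensor_diffB P A (x y : prodm (bimod P A)) :
  tensor_diff (x - y) = tensor_diff x - tensor_diff y.
Proof. exact: linearB. Qed.
Lemma tensor_diffN P A (x : prodm (bimod P A)) : tensor_diff (- x) = - tensor_diff x.
Proof. exact: linearN. Qed.
Lemma tensor_diffZ P A c (x : prodm (bimod P A)) : tensor_diff (c *: x) = c *: tensor_diff x.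
Proof. exact: linearZ_LR. Qed.
Lemma tensor_diff0 P A : tensor_diff (0 : prodm (bimod P A)) = 0.
Proof. exact: linear0. Qed.

(** Replaces a second index by an equal one without casting the component. *)
Lemma component_eq P A (x : prodm (bimod P A)) p q q' (W : lmodType R)
    (h : forall q, {linear A q -> W}) : q = q' ->
  tensor_map idfun (h q) (x (p, q)) = tensor_map (@idfun (P p)) (h q') (x (p, q')).
Proof. by move=> ->. Qed.

Section TensorCone.
Variables (P Q Y : complex R) (f : chain_map Q Y).
Let C := cone f.

Definition tensor_right (z : prodm (bimod P Q)) : prodm (bimod P Y) :=
  fun p => tensor_map idfun (f p.2) (z p).
Lemma tensor_rightE z p q : tensor_right z (p, q) = tensor_map idfun (f q) (z (p, q)).
Proof. by []. Qed.
Lemma tensor_right_linear : linear tensor_right.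
Proof. by move=> c x y; apply: functional_extensionality_dep => p; case: p => p q; rewrite tensor_rightE prodmDE prodmZE tensor_mapD tensor_mapZ. Qed.
HB.instance Definition _ := GRing.isLinear.Build R _ _ *:%R tensor_right tensor_right_linear.

Lemma tensor_right_deg n z : z \in tensor_obj P Q n -> tensor_right z \in tensor_obj P Y n.
Proof.
by apply: (dsum_shift (s := id) (t := id)) => // x p xp; rewrite /tensor_right xp linear0.
Qed.

Lemma tensor_right_diff z : tensor_right (tensor_diff z) = tensor_diff (tensor_right z).
Proof.
apply: functional_extensionality_dep => -[p q].
rewrite tensor_rightE !tensor_diff_sgn !tensor_rightE tensor_mapD tensor_mapZ.
rewrite !tensor_map_comp.
congr (_ + _ *: _); apply: tensor_map_eq => // x /=; exact: cmap_d.
Qed.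

Let in1_linear q : linear (fun y : Y q => (y, 0) : C q).
Proof. by move=> c x y; congr (_, _); rewrite /= scaler0 addr0. Qed.
Let in1 q : {linear Y q -> C q} := lin_of (@in1_linear q).
Let in2_linear q : linear (fun x : Q (q - 1) => (0, x) : C q).
Proof. by move=> c x y; congr (_, _); rewrite /= scaler0 addr0. Qed.
Let in2 q : {linear Q (q - 1) -> C q} := lin_of (@in2_linear q).
Let pr1_linear q : linear (fun c : C q => c.1 : Y q).
Proof. by []. Qed.
Let pr1 q : {linear C q -> Y q} := lin_of (@pr1_linear q).
Let pr2_linear q : linear (fun c : C (q + 1) => tr Q (q + 1 - 1) q c.2 : Q q).
Proof. by move=> c x y; rewrite linearP. Qed.
Let pr2 q : {linear C (q + 1) -> Q q} := lin_of (@pr2_linear q).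

(* P (x) C is the sum of P (x) Y and a shift of P (x) Q, embedded by incl and jncl.
   The sign in jncl is the one that makes its commutator with the differential
   the map induced by f, as diff_jncl says. *)
Let incl (w : prodm (bimod P Y)) : prodm (bimod P C) :=
  fun p => tensor_map idfun (in1 p.2) (w p).
Let jncl (z : prodm (bimod P Q)) : prodm (bimod P C) :=
  fun p => sgn p.1 *: tensor_map idfun (in2 p.2) (z (p.1, p.2 - 1)).
Let pr_Y (c : prodm (bimod P C)) : prodm (bimod P Y) :=
  fun p => tensor_map idfun (pr1 p.2) (c p).
Let pr_Q (c : prodm (bimod P C)) : prodm (bimod P Q) :=
  fun p => sgn p.1 *: tensor_map idfun (pr2 p.2) (c (p.1, p.2 + 1)).

Let inclE w p q : incl w (p, q) = tensor_map idfun (in1 q) (w (p, q)).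
Proof. by []. Qed.
Let jnclE z p q : jncl z (p, q) = sgn p *: tensor_map idfun (in2 q) (z (p, q - 1)).
Proof. by []. Qed.
Let pr_YE c p q : pr_Y c (p, q) = tensor_map idfun (pr1 q) (c (p, q)).
Proof. by []. Qed.
Let pr_QE c p q : pr_Q c (p, q) = sgn p *: tensor_map idfun (pr2 q) (c (p, q + 1)).
Proof. by []. Qed.

Let incl_linear : linear incl.
Proof. by move=> c x y; apply: functional_extensionality_dep => p; case: p => p q; rewrite inclE prodmDE prodmZE tensor_mapD tensor_mapZ. Qed.
HB.instance Definition _ := GRing.isLinear.Build R _ _ *:%R incl incl_linear.
Let jncl_linear : linear jncl.
Proof.
move=> c x y; apply: functional_extensionality_dep => -[p q].
rewrite jnclE prodmDE prodmZE tensor_mapD tensor_mapZ scalerDr scalerA mulrC.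
by rewrite -scalerA.
Qed.
HB.instance Definition _ := GRing.isLinear.Build R _ _ *:%R jncl jncl_linear.
Let pr_Y_linear : linear pr_Y.
Proof. by move=> c x y; apply: functional_extensionality_dep => p; case: p => p q; rewrite pr_YE prodmDE prodmZE tensor_mapD tensor_mapZ. Qed.
HB.instance Definition _ := GRing.isLinear.Build R _ _ *:%R pr_Y pr_Y_linear.
Let pr_Q_linear : linear pr_Q.
Proof.
move=> c x y; apply: functional_extensionality_dep => -[p q].
rewrite pr_QE prodmDE prodmZE tensor_mapD tensor_mapZ scalerDr scalerA mulrC.
by rewrite -scalerA.
Qed.
HB.instance Definition _ := GRing.isLinear.Build R _ _ *:%R pr_Q pr_Q_linear.

Let pr_QB c d : pr_Q (c - d) = pr_Q c - pr_Q d. Proof. exact: linearB. Qed.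
Let pr_QD c d : pr_Q (c + d) = pr_Q c + pr_Q d. Proof. exact: linearD. Qed.
Let pr_YB c d : pr_Y (c - d) = pr_Y c - pr_Y d. Proof. exact: linearB. Qed.
Let pr_YD c d : pr_Y (c + d) = pr_Y c + pr_Y d. Proof. exact: linearD. Qed.

Let incl_deg n w : w \in tensor_obj P Y n -> incl w \in tensor_obj P C n.
Proof. by apply: (dsum_shift (s := id) (t := id)) => // x p xp; rewrite /incl xp linear0. Qed.
Let pr_Y_deg n c : c \in tensor_obj P C n -> pr_Y c \in tensor_obj P Y n.
Proof. by apply: (dsum_shift (s := id) (t := id)) => // x p xp; rewrite /pr_Y xp linear0. Qed.
Let jncl_deg n z : z \in tensor_obj P Q n -> jncl z \in tensor_obj P C (n + 1).
Proof.
apply: (dsum_shift (s := fun p => (p.1, p.2 - 1)) (t := fun p => (p.1, p.2 + 1))).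
- by move=> [p q] /=; rewrite subrK.
- by move=> [p q] /= <-; rewrite -addrA subrK.
- by move=> x [p q] xp; rewrite jnclE xp tensor_map0 scaler0.
Qed.
Let pr_Q_deg n c : c \in tensor_obj P C (n + 1) -> pr_Q c \in tensor_obj P Q n.
Proof.
apply: (dsum_shift (s := fun p => (p.1, p.2 + 1)) (t := fun p => (p.1, p.2 - 1))).
- by move=> [p q] /=; rewrite addrK.
- by move=> [p q] /=; rewrite addrA => /addIr.
- by move=> x [p q] xp; rewrite pr_QE xp tensor_map0 scaler0.
Qed.

Let pr_Y_incl w : pr_Y (incl w) = w.
Proof.
apply: functional_extensionality_dep => p.
by case: p => p q; rewrite pr_YE inclE tensor_map_comp tensor_map_id.
Qed.
Let pr_Y_jncl z : pr_Y (jncl z) = 0.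
Proof.
apply: functional_extensionality_dep => p.
by case: p => p q; rewrite pr_YE jnclE tensor_mapZ tensor_map_comp tensor_map_zero // scaler0.
Qed.
Let pr_Q_incl w : pr_Q (incl w) = 0.
Proof.
apply: functional_extensionality_dep => p.
case: p => p q; rewrite pr_QE inclE tensor_map_comp tensor_map_zero ?scaler0 // => x.
by rewrite /= linear0.
Qed.
Let pr_Q_jncl z : pr_Q (jncl z) = z.
Proof.
apply: functional_extensionality_dep => -[p q].
rewrite pr_QE jnclE tensor_mapZ scalerA sgn_sq scale1r tensor_map_comp.
rewrite (tensor_map_eq (f' := idfun) (g' := tr Q (q + 1 - 1) q)) //.
rewrite (@component_eq _ _ z p _ q _ (fun k => tr Q k q)) ?addrK //.
by apply: tensor_map_id => // x; rewrite tr_id.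
Qed.
Let incl_jncl c : incl (pr_Y c) + jncl (pr_Q c) = c.
Proof.
apply: functional_extensionality_dep => -[p q].
rewrite prodmDE inclE jnclE pr_YE pr_QE tensor_mapZ scalerA sgn_sq scale1r.
rewrite !tensor_map_comp.
have pr2'L k : linear (fun x : C k => (0, tr Q (k - 1) (q - 1) x.2) : C q).
  by move=> d x y; congr (_, _); rewrite /= ?scaler0 ?addr0 ?linearP.
transitivity (tensor_map (@idfun (P p)) (in1 q \o pr1 q) (c (p, q)) +
    tensor_map idfun (lin_of (@pr2'L q)) (c (p, q))); last first.
  have splitC : forall x : C q, idfun x = (in1 q \o pr1 q) x + lin_of (@pr2'L q) x.
    by move=> [y x]; rewrite lin_ofE /= tr_id; congr (_, _); rewrite ?addr0 ?add0r.
  by rewrite -(tensor_mapDr _ _ splitC) tensor_map_id.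
congr (_ + _).
rewrite (tensor_map_eq (f' := idfun) (g' := lin_of (@pr2'L (q - 1 + 1)))) //.
by rewrite (@component_eq _ _ c p _ q _ (fun k => lin_of (@pr2'L k))) ?subrK.
Qed.

Let diff_incl w : tensor_diff (incl w) = incl (tensor_diff w).
Proof.
apply: functional_extensionality_dep => -[p q].
rewrite inclE !tensor_diff_sgn !inclE tensor_mapD tensor_mapZ !tensor_map_comp.
congr (_ + _ *: _); apply: tensor_map_eq => // x /=.
by congr (_, _); rewrite !linear0 ?addr0 ?oppr0.
Qed.

Let diff_jncl z :
  tensor_diff (jncl z) = incl (tensor_right z) - jncl (tensor_diff z).
Proof.
apply: functional_extensionality_dep => -[p q].
have hL k : linear (fun x : Q k => (tr Y k q (f k x), - dif Q k (q - 1) x) : C q).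
  move=> d x y; congr (_, _); rewrite !linearP //=.
pose h k : {linear Q k -> C q} := lin_of (@hL k).
pose u := tensor_map (dif P (p + 1) p) (in2 q) (z (p + 1, q - 1)).
pose g k : {linear Q k -> C q} := in2 q \o dif Q k (q - 1).
pose v := tensor_map (@idfun (P p)) (g q) (z (p, q)).
have fE : tensor_map idfun (in1 q \o f q) (z (p, q)) =
    tensor_map idfun (h q) (z (p, q)) + v.
  apply: tensor_mapDr => x; rewrite /h lin_ofE /= tr_id.
  by congr (_, _); rewrite ?addr0 ?addNr.
have lhs : tensor_diff (jncl z) (p, q) =
    - (sgn p *: u) + tensor_map idfun (h q) (z (p, q)).
  rewrite tensor_diff_sgn !jnclE !tensor_mapZ !tensor_map_comp.
  rewrite scalerA sgn_sq scale1r sgnS scaleNr; congr (_ + _).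
  rewrite (tensor_map_eq (f' := idfun) (g' := h (q + 1 - 1))) //.
    by rewrite (@component_eq _ _ z p _ q _ h) ?addrK.
  by move=> x; rewrite /h lin_ofE /= linear0 add0r.
have rhs1 : incl (tensor_right z) (p, q) = tensor_map idfun (in1 q \o f q) (z (p, q)).
  by rewrite inclE tensor_rightE tensor_map_comp; apply: tensor_map_eq.
have rhs2 : jncl (tensor_diff z) (p, q) = sgn p *: u + v.
  rewrite jnclE tensor_diff_sgn tensor_mapD tensor_mapZ !tensor_map_comp.
  rewrite scalerDr scalerA sgn_sq scale1r; congr (_ *: _ + _).
  rewrite (tensor_map_eq (f' := idfun) (g' := g (q - 1 + 1))) //.
  by rewrite (@component_eq _ _ z p _ q _ g) ?subrK.
have -> : (incl (tensor_right z) - jncl (tensor_diff z)) (p, q) =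
  incl (tensor_right z) (p, q) - jncl (tensor_diff z) (p, q) by [].
by rewrite lhs rhs1 rhs2 fE opprD [RHS]addrC -addrA [- v + _]addrC addrK.
Qed.

Definition tensor_right_cmap n : {linear tensor_complex P Q n -> tensor_complex P Y n} :=
  restr (@tensor_right_deg n).
Lemma tensor_right_cmap_d i j x : tensor_right_cmap j (dif (tensor_complex P Q) i j x) =
  dif (tensor_complex P Y) i j (tensor_right_cmap i x).
Proof.
apply: val_inj; rewrite /= /tensor_dfun; case: eqP => _; last exact: linear0.
exact: tensor_right_diff.
Qed.
Definition tensor_right_map := ChainMap tensor_right_cmap_d.

(** A class witnessing a failure of injectivity or surjectivity gives a cycle of the
    tensor product with the cone of [f], which is acyclic. *)
Lemma K_flat_quasi_iso : K_flat P -> quasi_iso f -> quasi_iso tensor_right_map.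
Proof.
move=> flatP fQ; have PC := flatP _ (cone_acyclic fQ).
apply/quasi_isoP => n _ _ -> ->; split.
- move=> [z zn] /(congr1 val); rewrite tensor_dif_val' ?subrK //= => dz.
  move=> [[w wn]] /(congr1 val); rewrite tensor_dif_val => dw0.
  have {dw0}dw : tensor_diff w = tensor_right z := dw0.
  have [||c cn dc] := (iffLR (tensor_homologyP _ _ _) (PC (n + 1))) (jncl z - incl w).
  + by apply: submodB; [exact: jncl_deg | exact: incl_deg].
  + rewrite tensor_diffB diff_jncl diff_incl dz dw.
    by rewrite [jncl 0]linear0 subr0 subrr.
  have zE : z = tensor_diff (- pr_Q c).
    have := congr1 pr_Q dc; rewrite pr_QB pr_Q_jncl pr_Q_incl subr0 => <-.
    rewrite -{1}(incl_jncl c) tensor_diffD diff_incl diff_jncl.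
    by rewrite pr_QD pr_QB !pr_Q_incl pr_Q_jncl add0r sub0r tensor_diffN.
  have cn' : - pr_Q c \in tensor_obj P Q (n + 1) by apply/submodN/pr_Q_deg.
  by exists (subm_mk cn'); apply: val_inj; rewrite tensor_dif_val [RHS]zE.
- move=> [w wn] /(congr1 val); rewrite tensor_dif_val' ?subrK //= => dw.
  have [||c cn dc] := (iffLR (tensor_homologyP _ _ _) (PC n)) (incl w).
  + exact: incl_deg.
  + by rewrite diff_incl dw; exact: linear0.
  rewrite -(incl_jncl c) tensor_diffD diff_incl diff_jncl in dc.
  have dz : tensor_diff (pr_Q c) = 0.
    have := congr1 pr_Q dc; rewrite pr_QD pr_QB !pr_Q_incl pr_Q_jncl add0r sub0r.
    by move=> /eqP; rewrite oppr_eq0 => /eqP.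
  have wE : w = tensor_diff (pr_Y c) + tensor_right (pr_Q c).
    have := congr1 pr_Y dc.
    by rewrite pr_YD pr_YB !pr_Y_incl pr_Y_jncl subr0.
  exists (subm_mk (pr_Q_deg cn)).
    by apply: val_inj; rewrite tensor_dif_val' ?subrK.
  exists (subm_mk (pr_Y_deg cn)).
  apply: val_inj; rewrite tensor_dif_val /=.
  by apply/eqP; rewrite eq_sym subr_eq -wE.
Qed.
End TensorCone.
End TensorComplexes.

Section TensorSwap.
Variable R : comPzRingType.

Lemma tensor_swap_exists (M N : lmodType R) :
  exists F : {linear tensor M N -> tensor N M}, forall m n, F (tens m n) = tens n m.
Proof.
apply: (tensor_lift (f := fun m n => tens n m)).
  by move=> n c x y; rewrite tensDr tensZr.
by move=> m c x y; rewrite tensDl tensZl.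
Qed.
Definition tensor_swap (M N : lmodType R) := projT1 (cid (tensor_swap_exists M N)).
Lemma tensor_swapE (M N : lmodType R) (m : M) (n : N) :
  tensor_swap M N (tens m n) = tens n m.
Proof. by rewrite /tensor_swap; case: cid. Qed.

Lemma tensor_swapD (M N : lmodType R) x y :
  tensor_swap M N (x + y) = tensor_swap M N x + tensor_swap M N y.
Proof. exact: linearD. Qed.
Lemma tensor_swapZ (M N : lmodType R) c x : tensor_swap M N (c *: x) = c *: tensor_swap M N x.
Proof. exact: linearZ_LR. Qed.

Lemma tensor_swapK (M N : lmodType R) x : tensor_swap N M (tensor_swap M N x) = x.
Proof.
apply: (tensor_ext (f := tensor_swap N M \o tensor_swap M N) (g := idfun)) => m n.
by rewrite /= !tensor_swapE.
Qed.

Lemma tensor_swap_map (M N M' N' : lmodType R) (f : {linear M -> M'})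
    (g : {linear N -> N'}) x :
  tensor_swap M' N' (tensor_map f g x) = tensor_map g f (tensor_swap M N x).
Proof.
apply: (tensor_ext (f := tensor_swap M' N' \o tensor_map f g)
  (g := tensor_map g f \o tensor_swap M N)) => m n.
by rewrite /= tensor_map_tens !tensor_swapE tensor_map_tens.
Qed.

(* The Koszul sign of exchanging degrees p and q *)
Let ksgn (p q : int) : R := (-1) ^+ (absz p * absz q).
Let ksgn_sq p q : ksgn p q * ksgn q p = 1.
Proof. by rewrite /ksgn mulnC -expr2 sqrr_sign. Qed.
Let ksgnC p q : ksgn p q = ksgn q p.
Proof. by rewrite /ksgn mulnC. Qed.
Let ksgnS p q : ksgn p (q + 1) = sgn R p * ksgn p q.
Proof.
have sE : ksgn p (q + 1) = ksgn p q * sgn R p.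
  rewrite /ksgn /sgn !exprM; set s := (-1) ^+ _.
  have ss : s * s = 1 by rewrite -expr2 sqrr_sign.
  case: q => [k|k]; first by rewrite -PoszD /= addn1 exprSr.
  have -> : Negz k + 1 = - k%:Z by rewrite NegzE -addn1 PoszD opprD addrNK.
  by rewrite abszN /= exprSr -mulrA ss mulr1.
by rewrite sE mulrC.
Qed.

Section Swap.
Variables P Q : complex R.

Definition cswap (z : prodm (bimod P Q)) : prodm (bimod Q P) :=
  fun p => ksgn p.1 p.2 *: tensor_swap (P p.2) (Q p.1) (z (p.2, p.1)).
Lemma cswapE z q p : cswap z (q, p) = ksgn q p *: tensor_swap (P p) (Q q) (z (p, q)).
Proof. by []. Qed.
Lemma cswap_linear : linear cswap.
Proof.
move=> c x y; apply: functional_extensionality_dep => -[q p].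
rewrite cswapE prodmDE prodmZE tensor_swapD tensor_swapZ scalerDr scalerA mulrC.
by rewrite -scalerA.
Qed.
HB.instance Definition _ := GRing.isLinear.Build R _ _ *:%R cswap cswap_linear.

Lemma cswap_deg n z : z \in tensor_obj P Q n -> cswap z \in tensor_obj Q P n.
Proof.
apply: (dsum_shift (s := fun p => (p.2, p.1)) (t := fun p => (p.2, p.1))).
- by case.
- by move=> [p q] /=; rewrite addrC.
- by move=> x [q p] xp; rewrite cswapE xp linear0 scaler0.
Qed.

(** The Koszul sign compensates the sign of the second differential. *)
Lemma cswap_diff z : cswap (tensor_diff z) = tensor_diff (cswap z).
Proof.
apply: functional_extensionality_dep => -[q p].
rewrite cswapE !tensor_diff_sgn !cswapE tensor_swapD tensor_swapZ !tensor_mapZ.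
rewrite !tensor_swap_map.
rewrite [LHS]scalerDr [LHS]addrC !scalerA; congr (_ *: _ + _ *: _).
  by rewrite [RHS]ksgnC ksgnS mulrC [ksgn p q]ksgnC.
by rewrite ksgnS mulrA sgn_sq mul1r.
Qed.
End Swap.

Lemma cswapK P Q z : cswap (cswap z : prodm (bimod Q P)) = z :> prodm (bimod P Q).
Proof.
apply: functional_extensionality_dep => -[p q].
by rewrite !cswapE tensor_swapZ tensor_swapK scalerA ksgn_sq scale1r.
Qed.

Definition cswap_cmap P Q n : {linear tensor_complex P Q n -> tensor_complex Q P n} :=
  restr (@cswap_deg P Q n).
Lemma cswap_cmap_d P Q i j x : cswap_cmap P Q j (dif (tensor_complex P Q) i j x) =
  dif (tensor_complex Q P) i j (cswap_cmap P Q i x).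
Proof.
apply: val_inj; rewrite /= /tensor_dfun; case: eqP => _; last exact: linear0.
exact: cswap_diff.
Qed.
Definition cswap_map P Q := ChainMap (@cswap_cmap_d P Q).

Lemma cswap_quasi_iso P Q : quasi_iso (cswap_map P Q).
Proof.
apply/quasi_isoP => n _ _ -> ->; split=> [z dz [w wz]|w dw].
  exists (cswap_map Q P _ w); rewrite -cmap_d wz.
  by apply: val_inj; rewrite /= cswapK.
exists (cswap_map Q P _ w); first by rewrite -cmap_d dw linear0.
exists 0; rewrite linear0; apply: val_inj.
by rewrite linearB /= cswapK subrr.
Qed.
End TensorSwap.

(** * Bounded below complexes of finitely generated projective modules *)

Section FiniteProjective.
Variable R : comPzRingType.
Implicit Types M N A B C : lmodType R.

(** Finitely generated projective, by the dual basis lemma *)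
Definition fin_proj M : Prop :=
  exists (k : nat) (e : 'I_k -> M) (c : 'I_k -> {linear M -> R^o}),
    forall x, x = \sum_i (c i x : R) *: e i.

Lemma fin_proj_row k : fin_proj 'rV[R]_k.
Proof.
have lin (i : 'I_k) : linear (fun v : 'rV[R]_k => v 0 i : R^o).
  by move=> c u v; rewrite !mxE.
exists k, (fun i => delta_mx 0 i), (fun i => lin_of (lin i)) => x.
exact: row_sum_delta.
Qed.

Lemma fin_proj_trivial M : trivial_module M -> fin_proj M.
Proof. by move=> M0; exists 0%N, (fun=> 0), (fun=> \0) => x; rewrite [LHS]M0 big_ord0. Qed.

Lemma fin_proj_fg M : fin_proj M -> finitely_generated M.
Proof.
move=> [k [e [c ceE]]]; apply/fg_rowP; exists k.
have lin : linear (fun v : 'rV[R]_k => \sum_i v 0 i *: e i).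
  move=> a u v; rewrite scaler_sumr -big_split /=.
  by apply: eq_bigr => i _; rewrite !mxE scalerDl scalerA.
exists (lin_of lin) => x; exists (\row_i c i x); rewrite lin_ofE [RHS]ceE.
by apply: eq_bigr => i _; rewrite mxE.
Qed.

Lemma fin_proj_lift M A B (g : {linear A -> B}) (h : {linear M -> B}) :
  fin_proj M -> (forall x, exists y, g y = h x) ->
  exists k : {linear M -> A}, forall x, g (k x) = h x.
Proof.
move=> [k [e [c ceE]]] gh; have /choice[a aE] i : exists y, g y = h (e i) by [].
have lin : linear (fun x => \sum_i (c i x : R) *: a i).
  move=> r u v; rewrite scaler_sumr -big_split /=.
  by apply: eq_bigr => i _; rewrite linearP scalerDl scalerA.
exists (lin_of lin) => x; rewrite lin_ofE linear_sum [in RHS](ceE x) linear_sum.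
by apply: eq_bigr => i _; rewrite !linearZ_LR aE.
Qed.

(** Flatness, for a complex A -> B -> C whose homology is killed by [s]: check
    exactness coordinate by coordinate. *)
Lemma fin_proj_flat M A B C (g : {linear A -> B}) (h : {linear B -> C}) (s : R) :
  fin_proj M -> (forall b, h b = 0 -> exists a, g a = s *: b) ->
  forall z, tensor_map (@idfun M) h z = 0 ->
    exists w, tensor_map (@idfun M) g w = s *: z.
Proof.
move=> [k [e [c ceE]]] gh z hz.
have coord (i : 'I_k) (N : lmodType R) :
    exists F : {linear tensor M N -> N}, forall m n, F (tens m n) = (c i m : R) *: n.
  apply: (tensor_lift (f := fun m n => (c i m : R) *: n)).
    by move=> n r x y; rewrite linearP scalerDl scalerA.
  by move=> m r x y; rewrite scalerDr !scalerA mulrC.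
have /choice[F FE] (i : 'I_k) := coord i B.
have zE : z = \sum_i tens (e i) (F i z).
  have lin : linear (fun z => \sum_i tens (e i) (F i z)).
    move=> r x y; rewrite scaler_sumr -big_split /=.
    by apply: eq_bigr => i _; rewrite linearP tensDr tensZr.
  apply: (tensor_ext (f := idfun) (g := lin_of lin)) => m n.
  rewrite lin_ofE /= {1}(ceE m).
  have linl : linear (fun m : M => tens m n).
    by move=> r x y; rewrite tensDl tensZl.
  rewrite -[LHS]/(lin_of linl _) linear_sum; apply: eq_bigr => i _.
  by rewrite linearZ_LR FE tensZr.
have /choice[a aE] i : exists a, g a = s *: F i z.
  apply: gh; have [G GE] := coord i C.
  rewrite -[LHS]/((h \o F i) z) -(linear0 G) -hz.
  apply: (tensor_ext (f := h \o F i) (g := G \o tensor_map idfun h)) => m n.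
  by rewrite /= tensor_map_tens FE GE linearZ_LR.
exists (\sum_i tens (e i) (a i)); rewrite linear_sum /= [in RHS]zE scaler_sumr.
by apply: eq_bigr => i _; rewrite tensor_map_tens aE tensZr.
Qed.
End FiniteProjective.

Section KFlat.
Variable R : comPzRingType.
Implicit Types P A X : complex R.

Lemma kills_homologyP X (n m m' : int) (s : R) : m = n + 1 -> m' = n - 1 ->
  kills (homology X n) s <->
  forall z, dif X n m' z = 0 -> exists y, dif X m n y = s *: z.
Proof.
move=> -> ->; split=> [Xs z /eqP zc|Xs x].
  have /asboolP[y yz] : s *: (exist _ z zc : subm (cycles X n)) \in boundaries X n.
    by apply/quot_pi_eq0; rewrite linearZ_LR; exact: Xs.
  by exists y; rewrite -yz.
rewrite -(quot_reprK x) -linearZ_LR; apply/quot_pi_eq0/asboolP.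
have [y yz] := Xs (val (quot_repr x)) (eqP (valP (quot_repr x))).
by exists y; rewrite yz.
Qed.

Lemma tensor_trivial (M N : lmodType R) : trivial_module M -> trivial_module (tensor M N).
Proof.
move=> M0 x; apply: (tensor_ext (f := idfun) (g := \0)) => m n.
by rewrite /= (M0 m) tens0l.
Qed.

Lemma tensor_supp_bound P A n (z : prodm (bimod P A)) (b : int) :
  z \in tensor_obj P A n -> exists d : nat, forall p q, b + d%:Z <= p -> z (p, q) = 0.
Proof.
move=> /asboolP[/finite_seqP[t tE] _].
have [d dP] : exists d : nat, forall p, p \in t -> p.1 < b + d%:Z.
  elim: (t) => [|[p q] t' [d dP]]; first by exists 0%N.
  exists (d + absz (p - b)).+1 => x; rewrite in_cons => /orP[/eqP ->|/dP] /=; lia.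
exists d => p q bp; apply: contrapT => zpq.
have : [set p | z p <> 0] (p, q) by [].
by rewrite tE => /= /dP /=; lia.
Qed.

(** Tensoring with the flat modules [P i] one degree at a time, from the top:
    modulo boundaries and powers of [s], a cycle can be pushed below degree
    [b] of [P] as long as [s] kills the homology of [A] that is met. *)
Lemma push_down P A (s : R) (n b : int) (d : nat) :
  (forall i, fin_proj (P i)) ->
  (forall i, b <= i -> i < b + d%:Z -> kills (homology A (n - i)) s) ->
  forall z, z \in tensor_obj P A n -> tensor_diff z = 0 ->
  (forall p q, b + d%:Z <= p -> z (p, q) = 0) ->
  exists2 w, w \in tensor_obj P A (n + 1) &
    forall p q, b <= p -> (s ^+ d *: z - tensor_diff w) (p, q) = 0.
Proof.
move=> projP; elim: d => [|d IH] As z zn dz ztop.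
  exists 0; first exact: rpred0.
  by move=> p q bp; rewrite tensor_diff0 subr0 prodmZE ztop ?scaler0 //; lia.
pose m := b + d%:Z; pose q := n - m - 1.
have zm : tensor_map idfun (dif A (q + 1) q) (z (m, q + 1)) = 0.
  have : tensor_diff z (m, q) = 0 by rewrite dz.
  rewrite tensor_diff_sgn ztop ?tensor_map0 ?add0r; last by rewrite /m; lia.
  move=> /(congr1 (fun x => sgn R m *: x)).
  by rewrite scalerA sgn_sq scale1r scaler0.
have As_q : kills (homology A (q + 1)) s by rewrite subrK; apply: As; rewrite /m; lia.
have qE : q = q + 1 - 1 by rewrite addrK.
have [w0 w0E] := fin_proj_flat (projP m)
  (iffLR (kills_homologyP _ s erefl qE) As_q) zm.
pose w : prodm (bimod P A) := fun p => tr (bimod P A) (m, q + 1 + 1) p (sgn R m *: w0).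
have w_other p : p != (m, q + 1 + 1) -> w p = 0.
  by move=> pm; rewrite /w tr_neq // eq_sym.
have wn : w \in tensor_obj P A (n + 1).
  have wsupp : [set p | w p <> 0] `<=` [set (m, q + 1 + 1)].
    by move=> p /= wp; apply: contrapT => /eqP pm; apply/wp/w_other.
  apply/asboolP; split; first exact: sub_finite_set wsupp (finite_set1 _).
  by move=> p /wsupp -> /=; rewrite /q; lia.
pose z1 := s *: z - tensor_diff w.
have z1n : z1 \in tensor_obj P A n.
  by apply: submodB; [exact: rpredZ | exact: tensor_diff_deg].
have dz1 : tensor_diff z1 = 0.
  by rewrite /z1 tensor_diffB tensor_diffZ dz scaler0 tensor_diff_diff subr0.
have z1E p : z1 p = s *: z p - tensor_diff w p by [].
have z1top p q' : b + d%:Z <= p -> z1 (p, q') = 0.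
  move=> bp; have [pq|] := eqVneq (p + q') n; last by move=> pq; exact: (tensor_obj_deg z1n).
  rewrite z1E tensor_diff_sgn (w_other (p + 1, q')) ?tensor_map0 ?add0r; last first.
    by apply/eqP => -[pm _]; move: bp; rewrite -/m; lia.
  have [pm|pm] := eqVneq p m; last first.
    rewrite ztop; last by move: pm bp; rewrite -/m; lia.
    have wp : w (p, q' + 1) = 0 by apply: w_other; apply: contra pm => /eqP[->].
    by rewrite wp tensor_map0 !scaler0 subr0.
  have q'E : q' = q + 1 by rewrite /q -pq pm; lia.
  rewrite pm q'E /w tr_id tensor_mapZ w0E !scalerA sgn_sq mul1r.
  exact: subrr.
have [|w1 w1n w1E] := IH _ z1 z1n dz1 z1top; first by move=> i bi ib; apply: As; lia.
exists (s ^+ d *: w + w1); first by apply: rpredD => //; exact: rpredZ.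
have -> : s ^+ d.+1 *: z - tensor_diff (s ^+ d *: w + w1) =
    s ^+ d *: z1 - tensor_diff w1.
  by rewrite tensor_diffD tensor_diffZ scalerBr scalerA -exprSr opprD addrA.
exact: w1E.
Qed.

(** Push a cycle down, with [s = 1], below the first nonzero degree of [P]. *)
Lemma fin_proj_K_flat P (n0 : int) : (forall i, fin_proj (P i)) ->
  (forall i, i < n0 -> trivial_module (P i)) -> K_flat P.
Proof.
move=> projP P0 A acA n; apply/tensor_homologyP => z zn dz.
have [d ztop] := tensor_supp_bound n0 zn.
have [|w wn wE] := push_down (s := 1) projP _ zn dz ztop.
  by move=> i _ _ h; exact: acA.
exists w => //; apply: functional_extensionality_dep => -[p q].
have [np|pn] := leP n0 p; last by apply: etrans (tensor_trivial (P0 p pn) _) _;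
  apply/esym/(tensor_trivial (P0 p pn)).
have := wE p q np; rewrite expr1n scale1r => /eqP.
by rewrite [_ == 0]subr_eq0 => /eqP.
Qed.
End KFlat.

(** * Resolutions by finitely generated free modules *)

Lemma span_map_inv (R : pzRingType) (U V : lmodType R) (f : {linear U -> V})
    (s : seq U) y :
  y \in submod_span [set` map f s] ->
  exists2 x, x \in submod_span [set` s] & f x = y.
Proof.
have SP : submodule_set (fun y => exists2 x, x \in submod_span [set` s] & f x = y).
  split=> [|_ _ [u us <-] [v vs <-]|c _ [u us <-]].
  - by exists 0; rewrite ?rpred0 ?linear0.
  - by exists (u + v); rewrite ?rpredD ?linearD.
  - by exists (c *: u); rewrite ?rpredZ ?linearZ_LR.
move=> ys; apply/(sub_ofP SP); apply: span_sub ys => z /= /mapP[x xs ->].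
by apply/(sub_ofP SP); exists x => //; exact: mem_span.
Qed.

Lemma seq_choice (T U : eqType) (Q : T -> U -> Prop) (s : seq T) :
  (forall x, x \in s -> exists y, Q x y) ->
  exists2 t : seq (T * U), map fst t = s & forall p, p \in t -> Q p.1 p.2.
Proof.
elim: s => [|x s IH] h; first by exists [::].
have [y xy] := h x (mem_head _ _).
have [|t ts tQ] := IH; first by move=> z zs; apply: h; rewrite in_cons zs orbT.
exists ((x, y) :: t); first by rewrite /= ts.
by move=> p; rewrite in_cons => /orP[/eqP ->|/tQ].
Qed.

Section Resolution.
Variable R : comPzRingType.
Hypothesis noethR : noetherian R.

(** Finite generation of homology, in terms of representing cycles. *)
Lemma homology_generators (X : complex R) (n m m' : int) :
  m = n + 1 -> m' = n - 1 -> finitely_generated (homology X n) ->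
  exists2 c : seq (X n), forall y, y \in c -> dif X n m' y = 0 &
    forall x, dif X n m' x = 0 -> exists2 y, y \in submod_span [set` c] &
      exists w, dif X m n w = x - y.
Proof.
move=> -> -> [s sH]; have inL : linear (fun z : subm (cycles X n) => val z).
  by move=> c x y; exact: val_submP.
have reprK : map (quot_pi (boundaries X n)) (map (@quot_repr _ _ _) s) = s.
  by rewrite -map_comp map_id_in // => h _; exact: quot_reprK.
exists (map (lin_of inL) (map (@quot_repr _ _ _) s)) => [y /mapP[z _ ->]|x /eqP xc].
  exact/eqP/(valP z).
have := sH (quot_pi _ (exist _ x xc : subm (cycles X n))).
rewrite -{1}reprK => /span_map_inv[u us /quot_piP].
rewrite -[_ - _]opprB => /(submodN (N := boundaries X n)); rewrite opprK => /asboolP[w wE].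
by exists (val u); [exact: (span_map (lin_of inL) us) | exists w].
Qed.

Variables (X : complex R) (n0 : int).
Hypothesis X_fg : forall l, finitely_generated (homology X l).
Hypothesis X_bounded : forall l, l < n0 -> trivial_module (homology X l).

Let deg (k : nat) : int := n0 + k%:Z.
Let degS k : deg k.+1 = deg k + 1. Proof. by rewrite /deg; lia. Qed.

(** What has to be remembered of a partial resolution in order to continue it: its
    top module, the cycles there and the map to [X], which hits all homology
    classes. *)
Record stage (k : nat) := Stage {
  st_mod : lmodType R;
  st_cyc : submodClosed st_mod;
  st_map : {linear st_mod -> X (deg k)};
  st_proj : fin_proj st_mod;
  st_mapZ : forall z, z \in st_cyc -> dif X (deg k) (deg k - 1) (st_map z) = 0;
  st_surj : forall x, dif X (deg k) (deg k - 1) x = 0 ->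
    exists2 z, z \in st_cyc & exists w, dif X (deg k.+1) (deg k) w = x - st_map z }.

Definition next_spec k (S : stage k) (S' : stage k.+1)
    (d : {linear st_mod S' -> st_mod S}) : Prop :=
  [/\ forall b, d b \in st_cyc S,
      forall b, b \in st_cyc S' <-> d b = 0,
      forall b, dif X (deg k.+1) (deg k) (st_map S' b) = st_map S (d b) &
      forall z w, z \in st_cyc S -> dif X (deg k.+1) (deg k) w = st_map S z ->
        exists b, d b = z].

Lemma stage0 : exists S : stage 0, forall z, z \in st_cyc S.
Proof.
have [c cc cS] := homology_generators (degS 0) erefl (X_fg (deg 0)).
have TP : submodule_set (fun _ : 'rV[R]_(size c) => True) by [].
have inT z : z \in sub_of TP by apply/sub_ofP.
have mapZ z : z \in sub_of TP -> dif X (deg 0) (deg 0 - 1) (@lincomb _ _ c z) = 0.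
  move=> _; have: @lincomb _ _ c z \in submod_span [set` c].
    by apply/lincomb_span; exists z.
  suff h : forall y, y \in submod_span [set` c] -> y \in kerm (dif X (deg 0) (deg 0 - 1)).
    by move=> /h/eqP.
  by move=> y; apply: span_sub => x /= /cc xc; apply/eqP.
have srj x : dif X (deg 0) (deg 0 - 1) x = 0 ->
    exists2 z, z \in sub_of TP & exists w, dif X (deg 1) (deg 0) w = x - @lincomb _ _ c z.
  by move=> /cS[y /lincomb_span[v <-] yw]; exists v.
by exists (@Stage 0 _ _ (@lincomb _ _ c) (fin_proj_row _ _) mapZ srj).
Qed.

(** Next degree: generators that kill the cycles becoming boundaries in [X],
    and generators for the homology of [X]. *)
Lemma next_stage k (S : stage k) : exists (S' : stage k.+1) d, @next_spec k S S' d.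
Proof.
pose A := st_mod S; pose f := st_map S; pose D := dif X (deg k.+1) (deg k).
have LP : submodule_set (fun z : A => z \in st_cyc S /\ exists w, D w = f z).
  split=> [|z z' [zc [w wz]] [zc' [w' wz']]|c z [zc [w wz]]].
  - by split; [exact: rpred0 | exists 0; rewrite !linear0].
  - by split; [exact: rpredD | exists (w + w'); rewrite !linearD wz wz'].
  - by split; [exact: rpredZ | exists (c *: w); rewrite !linearZ_LR wz].
have [s sP] := fg_submodule noethR (sub_of LP) (fin_proj_fg (st_proj S)).
have [|t1 t1s t1P] := @seq_choice A (X (deg k.+1))
    (fun z w => z \in st_cyc S /\ D w = f z) s.
  move=> z zs; have /(sub_ofP LP)[zc [w wz]] : z \in sub_of LP.
    by rewrite sP; exact: mem_span.
  by exists w.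
have [c cc cS] := homology_generators (degS k.+1) erefl (X_fg (deg k.+1)).
have dk : deg k.+1 - 1 = deg k by rewrite degS addrK.
have inrL : linear (fun x : X (deg k.+1) => (0 : A, x)).
  by move=> r x y; congr (_, _); rewrite /= scaler0 addr0.
pose t : seq (A * X (deg k.+1))%type := t1 ++ map (lin_of inrL) c.
pose lc := @lincomb R (A * X (deg k.+1))%type t.
pose d := (fst : {linear (A * X (deg k.+1))%type -> A}) \o lc.
pose g := (snd : {linear (A * X (deg k.+1))%type -> X (deg k.+1)}) \o lc.
have TP : submodule_set (fun p : (A * X (deg k.+1))%type => p.1 \in st_cyc S /\ D p.2 = f p.1).
  split=> [|p q [pc pD] [qc qD]|r p [pc pD]] /=.
  - by rewrite rpred0 !linear0.
  - by rewrite rpredD // !linearD pD qD.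
  - by rewrite rpredZ // !linearZ_LR pD.
have tT p : p \in submod_span [set` t] -> p \in sub_of TP.
  apply: span_sub => q /=; rewrite mem_cat => /orP[/t1P h|/mapP[x /cc xc ->]].
    exact/(sub_ofP TP).
  apply/(sub_ofP TP); rewrite lin_ofE /= rpred0 linear0; split=> //.
  by rewrite /D -dk.
have dgT b : d b \in st_cyc S /\ D (g b) = f (d b).
  by apply: (sub_ofP TP (lc b) (tT _ _)); apply/lincomb_span; exists b.
have sub1 p : p \in submod_span [set` t1] -> p \in submod_span [set` t].
  by apply: span_sub => q /= qt; apply: mem_span; rewrite /= mem_cat qt.
have sub2 p : p \in submod_span [set` map (lin_of inrL) c] -> p \in submod_span [set` t].
  by apply: span_sub => q /= qt; apply: mem_span; rewrite /= mem_cat qt orbT.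
have mapZ b : b \in kerm d -> dif X (deg k.+1) (deg k.+1 - 1) (g b) = 0.
  move=> /eqP db; have [_ Dg] := dgT b.
  have : D (g b) = 0 by rewrite Dg -(linear0 f); congr (f _).
  by rewrite /D -dk.
have srj x : dif X (deg k.+1) (deg k.+1 - 1) x = 0 ->
    exists2 z, z \in kerm d & exists w, dif X (deg k.+2) (deg k.+1) w = x - g z.
  move=> /cS[y /(span_map (lin_of inrL))/sub2/lincomb_span[v vE] yw].
  exists v; first by apply/eqP; rewrite /d /= /lc vE.
  by rewrite /g /= /lc vE.
exists (@Stage k.+1 _ (kerm d) g (fin_proj_row _ _) mapZ srj), d; split.
- by move=> b; have [] := dgT b.
- by move=> b; split=> [/eqP //|h]; apply/eqP.
- by move=> b; have [] := dgT b.
- move=> z w zc wz; have : z \in sub_of LP by apply/sub_ofP; split=> //; exists w.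
  rewrite sP -t1s => /(@span_map_inv _ _ _ (fst : {linear (A * X (deg k.+1))%type -> A})).
  by move=> [p /sub1/lincomb_span[v vp] <-]; exists v; rewrite /d /= /lc vp.
Qed.

Let step k (S : stage k) := projT1 (cid (next_stage S)).
Let step_map k (S : stage k) : {linear st_mod (step S) -> st_mod S} :=
  projT1 (cid (projT2 (cid (next_stage S)))).
Let step_spec k (S : stage k) : next_spec (step_map S) :=
  projT2 (cid (projT2 (cid (next_stage S)))).

Let st0 := projT1 (cid stage0).
Fixpoint res_stage (k : nat) : stage k :=
  if k is k'.+1 then step (res_stage k') else st0.

Let A k := st_mod (res_stage k).
Let d k : {linear A k.+1 -> A k} := step_map (res_stage k).
Let d_spec k : next_spec (S' := res_stage k.+1) (d k) := step_spec (res_stage k).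
Let dn k l : {linear A k -> A l} := d l \o tr A k l.+1.

Definition pos_index (i : int) : option nat :=
  if i - n0 is Posz k then Some k else None.

Let pos_indexS i k : pos_index i = Some k -> i = deg k.
Proof. by rewrite /pos_index /deg; case E: (i - n0) => [q|q] // [<-]; lia. Qed.
Let pos_indexN i : pos_index i = None -> i < n0.
Proof. by rewrite /pos_index; case E: (i - n0) => [q|q] // _; lia. Qed.
Let pos_index_deg k : pos_index (deg k) = Some k.
Proof. by rewrite /pos_index /deg addrAC subrr add0r. Qed.

Let dn_shape i j k l : i != j + 1 ->
  pos_index i = Some k -> pos_index j = Some l -> forall x, dn k l x = 0.
Proof.
move=> ij /pos_indexS iE /pos_indexS jE x; rewrite /dn /= tr_neq ?linear0 //.
by apply: contra ij; rewrite iE jE -degS => /eqP ->.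
Qed.
Let dn_dn k l m x : dn l m (dn k l x) = 0.
Proof.
rewrite /dn /=; have [lm|lm] := eqVneq l m.+1; last by rewrite (tr_neq _ lm) linear0.
have [dS dZ _ _] := d_spec m; have [dS' _ _ _] := d_spec l.
by subst l; rewrite tr_id; apply/dZ/dS'.
Qed.

Let P : complex R := nat_complex dn_shape dn_dn.
Let oP (o : option nat) : lmodType R := if o is Some k then A k else 'cV[R]_0.
Let oD (o o' : option nat) : {linear oP o -> oP o'} :=
  match o, o' with Some k, Some l => dn k l | _, _ => \0 end.
Let F (o : option nat) (i : int) : {linear oP o -> X i} :=
  match o with Some k => tr X (deg k) i \o st_map (res_stage k) | None => \0 end.

Let cyc0 (z : A 0) : z \in st_cyc (res_stage 0).
Proof. exact: (projT2 (cid stage0)). Qed.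

Let F_comm i j o o' : pos_index i = o -> pos_index j = o' ->
  forall x : oP o, F o' j (oD o o' x) = dif X i j (F o i x).
Proof.
have [ij|ij] := eqVneq i (j + 1); last first.
  move=> io jo x; rewrite (dif_shape ij).
  case: o o' io jo x => [k|] [l|] io jo x //=; last by rewrite !linear0.
  by rewrite [X in st_map _ X](dn_shape ij io jo) !linear0.
case: o o' => [k|] [l|] /=.
- move=> /pos_indexS iE /pos_indexS jE x.
  have kl : k = l.+1 by move: ij; rewrite iE jE /deg; lia.
  clear ij; subst k j i; have [_ _ fd _] := d_spec l.
  by rewrite /dn /= !tr_id; exact: esym (fd x).
- move=> /pos_indexS iE /pos_indexN jn0 x.
  have k0 : k = 0%N by move: jn0 ij; rewrite iE /deg; lia.
  subst k; have jE : j = deg 0 - 1 by rewrite -iE ij addrK.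
  by clear ij; subst j i; rewrite tr_id st_mapZ ?cyc0.
- by move=> _ _ x; rewrite !linear0.
- by move=> _ _ x; rewrite linear0.
Qed.

Let f : chain_map P X :=
  @ChainMap R P X (fun i => F (pos_index i) i)
    (fun i j x => @F_comm i j _ _ erefl erefl x).

Lemma resolution_quasi_iso : quasi_iso f.
Proof.
apply/quasi_isoP => n m m' mE m'E.
have dP i j (x : P i) : dif P i j x = oD (pos_index i) (pos_index j) x by [].
case En : (pos_index n) => [k|]; last first.
  have nn0 := pos_indexN En.
  have triv : trivial_module (P n).
    by rewrite -[P n]/(oP (pos_index n)) En => x; exact: flatmx0.
  split=> [x _ _|y /(iffLR (homology_trivialP _ mE m'E) (X_bounded nn0))[w <-]].
    by exists 0; rewrite linear0 [x]triv.
  exists 0; first exact: linear0.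
  by exists w; have -> : f n 0 = 0; [exact: linear0 | rewrite subr0].
have nE := pos_indexS En.
have mk : m = deg k.+1 by rewrite mE nE degS.
have Em : pos_index m = Some k.+1 by rewrite mk pos_index_deg.
suff main : (forall x : oP (pos_index n), oD (pos_index n) (pos_index m') x = 0 ->
      (exists w, dif X m n w = F (pos_index n) n x) ->
      exists x', oD (pos_index m) (pos_index n) x' = x) /\
   (forall y, dif X n m' y = 0 -> exists2 x, oD (pos_index n) (pos_index m') x = 0 &
      exists w, dif X m n w = y - F (pos_index n) n x) by exact: main.
rewrite En Em /=.
have [dS dZ fd dsurj] := d_spec k.
clear mE; subst n m.
have cyc (x : A k) : oD (Some k) (pos_index m') x = 0 <-> x \in st_cyc (res_stage k).
  case: k dS dZ fd dsurj m'E En Em x => [|k] dS dZ fd dsurj m'E En Em x.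
    have -> : pos_index m' = None by rewrite /pos_index m'E /deg addr0 addrAC subrr.
    by split=> // _; exact: cyc0.
  have -> : pos_index m' = Some k by rewrite m'E degS addrK pos_index_deg.
  by have [_ dZ' _ _] := d_spec k; rewrite /= tr_id dZ'.
split=> [x /cyc xc [w]|y yc].
  by rewrite tr_id => /(dsurj _ _ xc)[b <-]; exists b; rewrite /dn /= tr_id.
rewrite m'E in yc; have [z zc [w wE]] := st_surj (res_stage k) yc.
by exists z; [exact/cyc | exists w; rewrite tr_id].
Qed.

Lemma resolution_exists : exists (P : complex R) (f : chain_map P X),
  [/\ quasi_iso f, forall i, fin_proj (P i) & forall i, i < n0 -> trivial_module (P i)].
Proof.
exists P, f; split=> [|i|i in0]; first exact: resolution_quasi_iso.
  rewrite -[P i]/(oP (pos_index i)); case: (pos_index i) => [k|] /=.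
    exact: st_proj.
  by apply: fin_proj_trivial => x; exact: flatmx0.
rewrite -[P i]/(oP (pos_index i)); case Ei: (pos_index i) => [k|] /=.
  by move: in0; rewrite (pos_indexS Ei) /deg; lia.
by move=> x; exact: flatmx0.
Qed.
End Resolution.

(** * Homology of tensor products and supports *)

Section Homotopy.
Variable R : comPzRingType.
Implicit Types P Q A : complex R.

(** Contract degree by degree from below.  In the next degree [m], the error [th] of
    the homotopy found so far takes values in cycles, so that [s *: th] takes values
    in boundaries and lifts through the differential by projectivity of [P m].  The
    homotopy is given for all pairs of degrees to avoid casts; only [h i (i + 1)]
    is meaningful. *)
Lemma kill_homotopy P (s : R) (n0 : int) :
  (forall i, fin_proj (P i)) -> (forall i, i < n0 -> trivial_module (P i)) ->
  forall d : nat, (forall i, i < n0 + d%:Z -> kills (homology P i) s) ->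
  exists N (h : forall i j, {linear P i -> P j}), forall i, i < n0 + d%:Z ->
    forall x, dif P (i + 1) i (h i (i + 1) x) + h (i - 1) i (dif P i (i - 1) x) =
              s ^+ N *: x.
Proof.
move=> projP P0; elim=> [|d IH] ks.
  exists 0%N, (fun i j => \0) => i; rewrite addr0 => in0 x.
  by rewrite (P0 i in0 x) !linear0 addr0.
have [|N [h hE]] := IH; first by move=> i ib; apply: ks; lia.
pose m := n0 + d%:Z.
pose th : {linear P m -> P m} :=
  homothety (s ^+ N) \- (h (m - 1) m \o dif P m (m - 1)).
have thE x : th x = s ^+ N *: x - h (m - 1) m (dif P m (m - 1) x) by [].
have thc x : dif P m (m - 1) (th x) = 0.
  have m1 : m - 1 < n0 + d%:Z by rewrite /m; lia.
  have := hE _ m1 (dif P m (m - 1) x); rewrite dif_dif linear0 addr0.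
  have mm : m - 1 + 1 = m by rewrite subrK.
  move: (m - 1 + 1) mm => k km; subst k => dh.
  by rewrite thE linearB dh linearZ_LR subrr.
have km : kills (homology P m) s by apply: ks; rewrite /m; lia.
have [x|k kE] := fin_proj_lift (g := dif P (m + 1) m) (h := homothety s \o th) (projP m).
  exact: (iffLR (kills_homologyP P s erefl erefl) km).
have {}kE x : dif P (m + 1) m (k x) = s *: th x := kE x.
pose km' i j : {linear P i -> P j} := tr P (m + 1) j \o (k \o tr P i m).
pose hs i j : {linear P i -> P j} := homothety s \o h i j.
pose h' i j : {linear P i -> P j} := if i == m then km' i j else hs i j.
exists N.+1, h' => i im x; have [iE|ni] := eqVneq i m.
  subst i; have E1 : h' m (m + 1) x = k x by rewrite /h' eqxx /km' /= !tr_id.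
  have E2 y : h' (m - 1) m y = s *: h (m - 1) m y.
    by rewrite /h' ifF //; apply/eqP; lia.
  rewrite E1 E2 kE -scalerDr thE subrK.
  by rewrite scalerA -exprS.
have E1 y : h' i (i + 1) y = s *: h i (i + 1) y by rewrite /h' (negbTE ni).
have E2 y : h' (i - 1) i y = s *: h (i - 1) i y.
  by rewrite /h' ifF //; apply/eqP; move: ni im; rewrite /m; lia.
rewrite E1 E2 linearZ_LR -scalerDr hE ?scalerA -?exprS //.
by move: ni im; rewrite /m; lia.
Qed.

(** The error of the homotopy below degree [t], as in the previous proof: it sends
    all of [P t] to cycles, multiplies cycles by [s ^+ N] modulo boundaries, and
    sends boundaries to boundaries. *)
Lemma class_extension P (s : R) (n0 t : int) :
  (forall i, fin_proj (P i)) -> (forall i, i < n0 -> trivial_module (P i)) ->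
  (forall i, i < t -> kills (homology P i) s) ->
  exists N (e : {linear P t -> homology P t}),
    (forall y, e (dif P (t + 1) t y) = 0) /\
    forall x : subm (cycles P t), e (val x) = s ^+ N *: quot_pi (boundaries P t) x.
Proof.
move=> projP P0 ks; pose n1 := Num.min n0 t.
have n1t : n1 <= t by rewrite /n1 ge_min lexx orbT.
have P1 i : i < n1 -> trivial_module (P i).
  by rewrite /n1 lt_min => /andP[/P0].
have tE : t = n1 + (absz (t - n1))%:Z by lia.
have [|N [h hE]] := @kill_homotopy P s n1 projP P1 (absz (t - n1)).
  by move=> i; rewrite -tE; exact: ks.
rewrite -tE in hE.
pose th : {linear P t -> P t} :=
  homothety (s ^+ N) \- (h (t - 1) t \o dif P t (t - 1)).
have thE x : th x = s ^+ N *: x - h (t - 1) t (dif P t (t - 1) x) by [].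
have thc x : th x \in cycles P t.
  have t1 : t - 1 < t by lia.
  have := hE _ t1 (dif P t (t - 1) x); rewrite dif_dif linear0 addr0.
  have tt : t - 1 + 1 = t by rewrite subrK.
  move: (t - 1 + 1) tt => k kt; subst k => dh.
  by apply/eqP; rewrite thE linearB dh linearZ_LR subrr.
have thL : linear (fun x => subm_mk (thc x)).
  by move=> c x y; apply: val_inj; rewrite val_submP; exact: (linearP th).
exists N, (quot_pi (boundaries P t) \o lin_of thL); split=> [y|x].
  apply/quot_pi0/asboolP; exists (s ^+ N *: y).
  by rewrite linearZ_LR -[LHS]/(th _) thE dif_dif linear0 subr0.
rewrite /= -linearZ_LR; congr quot_pi; apply: val_inj.
have /eqP xc := valP x.
by rewrite -[LHS]/(th _) thE xc linear0 subr0.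
Qed.

Lemma tensor_trivial_r (M N : lmodType R) : trivial_module N -> trivial_module (tensor M N).
Proof.
move=> N0 x; apply: (tensor_ext (f := idfun) (g := \0)) => m n.
by rewrite /= (N0 n) tens0r.
Qed.

Lemma tensor_mapDl (M N M' N' : lmodType R) (f g k : {linear M -> M'})
    (h : {linear N -> N'}) x : (forall m, f m = g m + k m) ->
  tensor_map f h x = tensor_map g h x + tensor_map k h x.
Proof.
move=> gE; have lin : linear (fun x => tensor_map g h x + tensor_map k h x).
  by move=> c u v; rewrite !tensor_mapD !tensor_mapZ addrACA -scalerDr.
apply: (tensor_ext (g := lin_of lin)) => m n.
by rewrite lin_ofE /= !tensor_map_tens gE tensDl.
Qed.

Lemma component_eq1 P A (x : prodm (bimod P A)) p p' q (W : lmodType R)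
    (h : forall p, {linear P p -> W}) : p = p' ->
  tensor_map (h p) idfun (x (p, q)) = tensor_map (h p') (@idfun (A q)) (x (p', q)).
Proof. by move=> ->. Qed.

(** Since [z] is a cycle, the two mixed terms of the tensored homotopy cancel. *)
Lemma tensor_homotopy P A (h : forall i j, {linear P i -> P j}) (t : int) (c : R) n z :
  (forall i, i < t -> forall x,
     dif P (i + 1) i (h i (i + 1) x) + h (i - 1) i (dif P i (i - 1) x) = c *: x) ->
  z \in tensor_obj P A n -> tensor_diff z = 0 ->
  (forall p q, t <= p -> z (p, q) = 0) ->
  exists2 w, w \in tensor_obj P A (n + 1) & tensor_diff w = c *: z.
Proof.
move=> hE zn dz ztop.
pose H (z : prodm (bimod P A)) : prodm (bimod P A) :=
  fun p => tensor_map (h (p.1 - 1) p.1) idfun (z (p.1 - 1, p.2)).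
have HE p q : H z (p, q) = tensor_map (h (p - 1) p) idfun (z (p - 1, q)) by [].
exists (H z).
  apply: (dsum_shift (s := fun p => (p.1 - 1, p.2)) (t := fun p => (p.1 + 1, p.2))) zn.
  - by move=> [p q] /=; rewrite subrK.
  - by move=> [p q] /= <-; rewrite addrAC subrK.
  - by move=> x [p q] xp; rewrite /H xp tensor_map0.
apply: functional_extensionality_dep => -[p q].
pose g k : {linear P k -> P p} := dif P (p + 1) p \o h k (p + 1).
pose g' k : {linear P k -> P p} := h (p - 1) p \o dif P k (p - 1).
have dz1 : tensor_map (g' p) idfun (z (p, q)) =
    sgn R p *: tensor_map (h (p - 1) p) (dif A (q + 1) q) (z (p - 1, q + 1)).
  have sp : sgn R p = - sgn R (p - 1) by rewrite -sgnS subrK.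
  have : tensor_diff z (p - 1, q) = 0 by rewrite dz.
  rewrite tensor_diff_sgn => /(congr1 (tensor_map (h (p - 1) p) (@idfun (A q)))).
  rewrite tensor_mapD tensor_mapZ !tensor_map_comp tensor_map0.
  rewrite [X in X + _ = _](tensor_map_eq (f' := g' (p - 1 + 1)) (g' := idfun)) //.
  rewrite (@component_eq1 _ _ z _ p q _ g') ?subrK // => /eqP.
  by rewrite addr_eq0 -scaleNr -sp => /eqP.
have -> : tensor_diff (H z) (p, q) =
    tensor_map (g p) idfun (z (p, q)) + tensor_map (g' p) idfun (z (p, q)).
  rewrite tensor_diff_sgn !HE !tensor_map_comp dz1; congr (_ + _).
  rewrite (tensor_map_eq (f' := g (p + 1 - 1)) (g' := idfun)) //.
  by rewrite (@component_eq1 _ _ z _ p q _ g) ?addrK.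
rewrite prodmZE; have [tp|pt] := leP t p; first by rewrite ztop // !tensor_map0 scaler0 addr0.
have hL : forall x : P p, homothety c x = g p x + g' p x by move=> x; rewrite /= hE.
rewrite -(tensor_mapDl _ _ hL).
apply: (tensor_ext (f := tensor_map (homothety c) idfun) (g := homothety c)) => x y.
by rewrite /= tensor_map_tens /homothety tensZl.
Qed.

Section Kill.
Variables (P Q : complex R) (n0 m0 : int).
Hypotheses (projP : forall i, fin_proj (P i)) (projQ : forall i, fin_proj (Q i)).
Hypotheses (P0 : forall i, i < n0 -> trivial_module (P i))
           (Q0 : forall i, i < m0 -> trivial_module (Q i)).

(** A cycle is first pushed below degree [t] in [P], where the homology of [Q] that is
    met is killed by [s]; there the homotopy of [P] makes a multiple of it a
    boundary.  The number of steps, hence the exponent, is bounded because [Q] is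
    bounded below. *)
Lemma kill_tensor_homology (s : R) (t l n : int) :
  (forall i, i < t -> kills (homology P i) s) ->
  (forall i, i < l -> kills (homology Q i) s) -> n < t + l ->
  exists N, kills (homology (tensor_complex P Q) n) (s ^+ N).
Proof.
move=> Ps Qs ntl; pose n1 := Num.min n0 t.
have n1t : n1 <= t by rewrite /n1 ge_min lexx orbT.
have P1 i : i < n1 -> trivial_module (P i).
  by rewrite /n1 lt_min => /andP[/P0].
have tE : t = n1 + (absz (t - n1))%:Z by lia.
have [|N [h hE]] := @kill_homotopy P s n1 projP P1 (absz (t - n1)).
  by move=> i; rewrite -tE; exact: Ps.
rewrite -tE in hE; pose d : nat := absz (n - m0 + 1 - t)%R.
have dle : n - m0 + 1 - t <= d%:Z by rewrite /d; lia.
exists (d + N)%N; apply/(kills_homologyP _ _ erefl erefl) => -[z zn] /(congr1 val).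
rewrite tensor_dif_val' ?subrK // => dz0; have {dz0}dz : tensor_diff z = 0 := dz0.
have [|p q|w wn wE] := push_down (A := Q) (s := s) (b := t) (d := d) projP _ zn dz.
- by move=> i ti _; apply: Qs; lia.
- move=> pd; have [pq|pq] := eqVneq (p + q) n; last exact: (tensor_obj_deg zn).
  by apply: tensor_trivial_r; apply: Q0 => /=; lia.
pose z1 := s ^+ d *: z - tensor_diff w.
have z1n : z1 \in tensor_obj P Q n.
  by apply: submodB; [exact: rpredZ | exact: tensor_diff_deg].
have dz1 : tensor_diff z1 = 0.
  by rewrite /z1 tensor_diffB tensor_diffZ dz scaler0 tensor_diff_diff subr0.
have [v vn vE] := tensor_homotopy hE z1n dz1 wE.
have yn : v + s ^+ N *: w \in tensor_obj P Q (n + 1).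
  by apply: rpredD => //; exact: rpredZ.
exists (subm_mk yn); apply: val_inj; rewrite tensor_dif_val.
have -> : val (subm_mk yn) = v + s ^+ N *: w by [].
rewrite tensor_diffD tensor_diffZ vE /z1 scalerBr subrK scalerA -exprD addnC.
by [].
Qed.

(** The extended classes [e] and [e'] of the two factors induce a map from the tensor
    product in degree [t + l] to the tensor product of homologies which kills
    boundaries, and which on a product of cycles gives back the product of their
    classes up to a power of [s]. *)
Lemma kill_bottom_tensor (s u : R) (t l : int) :
  (forall i, i < t -> kills (homology P i) s) ->
  (forall i, i < l -> kills (homology Q i) s) ->
  kills (homology (tensor_complex P Q) (t + l)) u ->
  exists N, kills (tensor (homology P t) (homology Q l)) (u * s ^+ N).
Proof.
move=> Ps Qs uW.
have [N [e [eB eZ]]] := class_extension projP P0 Ps.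
have [N' [e' [eB' eZ']]] := class_extension projQ Q0 Qs.
exists (N + N')%N.
have pure (x : subm (cycles P t)) (y : subm (cycles Q l)) :
    (u * s ^+ (N + N')) *: tens (quot_pi (boundaries P t) x) (quot_pi (boundaries Q l) y) = 0.
  have /eqP xc := valP x; have /eqP yc := valP y.
  pose z : prodm (bimod P Q) := fun p => tr (bimod P Q) (t, l) p (tens (val x) (val y)).
  have z_other p : p != (t, l) -> z p = 0 by move=> pt; rewrite /z tr_neq // eq_sym.
  have ztl : z (t, l) = tens (val x) (val y) by rewrite /z tr_id.
  have zn : z \in tensor_obj P Q (t + l).
    have zsupp : [set p | z p <> 0] `<=` [set (t, l)].
      by move=> p /= zp; apply: contrapT => /eqP pt; apply/zp/z_other.
    apply/asboolP; split; first exact: sub_finite_set zsupp (finite_set1 _).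
    by move=> p /zsupp ->.
  have dz : tensor_diff z = 0.
    apply: functional_extensionality_dep => -[p q]; rewrite tensor_diff_sgn.
    have -> : tensor_map (dif P (p + 1) p) idfun (z (p + 1, q)) = 0.
      have [[pt ql]|/z_other ->] := eqVneq (p + 1, q) (t, l); last exact: tensor_map0.
      have pE : p = t - 1 by rewrite -pt addrK.
      move: (p + 1) pt => k kt; subst k q p; rewrite ztl tensor_map_tens xc.
      exact: tens0l.
    have -> : tensor_map idfun (dif Q (q + 1) q) (z (p, q + 1)) = 0.
      have [[pt ql]|/z_other ->] := eqVneq (p, q + 1) (t, l); last exact: tensor_map0.
      have qE : q = l - 1 by rewrite -ql addrK.
      move: (q + 1) ql => k kl; subst k q p; rewrite ztl tensor_map_tens yc.
      exact: tens0r.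
    by rewrite scaler0 addr0.
  have [|w wz] := iffLR (kills_homologyP _ u erefl erefl) uW (subm_mk zn).
    by apply: val_inj; rewrite tensor_dif_val' ?subrK.
  have {wz} wz : tensor_diff (val w) = u *: z by rewrite -tensor_dif_val wz.
  have : tensor_map e e' (tensor_diff (val w) (t, l)) = u *: tensor_map e e' (z (t, l)).
    by rewrite wz prodmZE tensor_mapZ.
  rewrite ztl tensor_map_tens eZ eZ' tensZl tensZr !scalerA -?mulrA -exprD => <-.
  rewrite tensor_diff_sgn tensor_mapD tensor_mapZ !tensor_map_comp.
  rewrite !tensor_map_eq0 ?scaler0 ?addr0 // => m n /=.
    by rewrite eB' tens0r.
  by rewrite eB tens0l.
move=> v.
apply: (tensor_ext (f := homothety (u * s ^+ (N + N'))) (g := \0)) => m n.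
by rewrite -(quot_reprK m) -(quot_reprK n); exact: pure.
Qed.
End Kill.
End Homotopy.

Section FiniteHomology.
Variable R : comPzRingType.
Hypothesis noethR : noetherian R.

Lemma tensor_ind (M N : lmodType R) (S : submodClosed (tensor M N)) :
  (forall m n, tens m n \in S) -> forall x, x \in S.
Proof.
move=> St x; apply/quot_pi_eq0.
apply: (tensor_ext (f := quot_pi S) (g := \0)) => m n.
exact: quot_pi0.
Qed.

Lemma tensor_fg (M N : lmodType R) :
  finitely_generated M -> finitely_generated N -> finitely_generated (tensor M N).
Proof.
move=> [s sM] [t tN]; exists [seq tens x y | x <- s, y <- t].
apply: tensor_ind => m n; set S := submod_span _.
have Pr (x : M) : submodule_set (fun y : N => tens x y \in S).
  split=> [|y y' yS yS'|c y yS]; first by rewrite tens0r rpred0.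
    by rewrite tensDr rpredD.
  by rewrite tensZr rpredZ.
have Pl : submodule_set (fun x : M => tens x n \in S).
  split=> [|x x' xS xS'|c x xS]; first by rewrite tens0l rpred0.
    by rewrite tensDl rpredD.
  by rewrite tensZl rpredZ.
apply/(sub_ofP Pl); apply: span_sub (sM m) => x /= xs.
apply/(sub_ofP Pl)/(sub_ofP (Pr x)); apply: span_sub (tN n) => y /= yt.
by apply/(sub_ofP (Pr x)); apply: mem_span => /=; exact: allpairs_f.
Qed.

Variables (P Q : complex R) (n0 m0 : int).
Hypotheses (P_fg : forall i, finitely_generated (P i))
           (Q_fg : forall i, finitely_generated (Q i)).
Hypotheses (P0 : forall i, i < n0 -> trivial_module (P i))
           (Q0 : forall i, i < m0 -> trivial_module (Q i)).

Let single_linear p : linear (fun w : bimod P Q p =>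
  (fun p' => tr (bimod P Q) p p' w) : prodm (bimod P Q)).
Proof.
by move=> c x y; apply: functional_extensionality_dep => p'; rewrite linearP.
Qed.
Let single p : {linear bimod P Q p -> prodm (bimod P Q)} := lin_of (@single_linear p).

(** Both complexes being bounded below, only finitely many bidegrees matter; they are
    split off one by one. *)
Lemma tensor_obj_fg n : fg_sub (tensor_obj P Q n).
Proof.
have singleE p (w : bimod P Q p) p' : single p w p' = tr (bimod P Q) p p' w by [].
have single_deg p w : p.1 + p.2 = n -> single p w \in tensor_obj P Q n.
  move=> pn; have wsupp : [set p' | single p w p' <> 0] `<=` [set p].
    move=> p' wp; apply: contrapT => /eqP pp'; case: wp.
    by rewrite singleE tr_neq // eq_sym.
  apply/asboolP; split; first exact: sub_finite_set wsupp (finite_set1 _).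
  by move=> p' /wsupp ->.
have main (K : nat) : exists2 s : seq (prodm (bimod P Q)),
    forall x, x \in s -> x \in tensor_obj P Q n &
    forall z, z \in tensor_obj P Q n -> (forall p q, n0 + K%:Z <= p -> z (p, q) = 0) ->
      z \in submod_span [set` s].
  elim: K => [|K [s sn sK]].
    exists [::] => // z zn ztop; suff -> : z = 0 by exact: rpred0.
    apply: functional_extensionality_dep => -[p q].
    have [pn|np] := ltP p n0; first exact: (tensor_trivial (P0 pn)).
    by apply: ztop; lia.
  pose m := n0 + K%:Z; have [g gT] := tensor_fg (P_fg m) (Q_fg (n - m)).
  have mn : (m, n - m).1 + (m, n - m).2 = n by rewrite /= addrC subrK.
  exists (s ++ map (single (m, n - m)) g) => [x|z zn ztop].
    by rewrite mem_cat => /orP[/sn //|/mapP[w _ ->]]; exact: single_deg.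
  have sub1 x : x \in submod_span [set` s] ->
      x \in submod_span [set` s ++ map (single (m, n - m)) g].
    by apply: span_sub => y /= yt; apply: mem_span; rewrite /= mem_cat yt.
  have sub2 x : x \in submod_span [set` map (single (m, n - m)) g] ->
      x \in submod_span [set` s ++ map (single (m, n - m)) g].
    by apply: span_sub => y /= yt; apply: mem_span; rewrite /= mem_cat yt orbT.
  pose w := z (m, n - m).
  rewrite -[z](subrK (single (m, n - m) w)); apply: rpredD; last first.
    exact/sub2/span_map/gT.
  have zwn : z - single (m, n - m) w \in tensor_obj P Q n.
    by apply: submodB => //; exact: single_deg.
  apply/sub1/sK => // p q mp.
  have [pq|pq] := eqVneq (p + q) n; last exact: (tensor_obj_deg zwn).
  have -> : (z - single (m, n - m) w) (p, q) = z (p, q) - single (m, n - m) w (p, q) by [].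
  rewrite singleE; have [pm|pm] := eqVneq p m.
    have qE : q = n - m by lia.
    by subst p q; rewrite tr_id subrr.
  rewrite tr_neq ?ztop ?subr0 //; first by move: pm mp; rewrite -/m; lia.
  by apply: contra pm => /eqP[->].
have [s sn sK] := main (absz (n - m0 + 1 - n0)%R); exists s => x.
apply/idP/idP => [xn|]; last by apply: span_sub => y /= /sn.
apply: sK => // p q Kp; have [pq|pq] := eqVneq (p + q) n; last exact: (tensor_obj_deg xn).
by apply: tensor_trivial_r; apply: Q0 => /=; lia.
Qed.

Lemma tensor_homology_fg n : finitely_generated (homology (tensor_complex P Q) n).
Proof.
apply: (fg_image (@quot_pi_surj _ _ (boundaries (tensor_complex P Q) n))).
exact/(fg_subm_noeth noethR)/fg_subm/tensor_obj_fg.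
Qed.
End FiniteHomology.

(** * The supports of the homology of a derived tensor product *)

Section Supports.
Variable R : comPzRingType.
Implicit Types P Q : complex R.

Lemma supp_isom (p : ideal R) (M N : lmodType R) : isom M N -> supp p M -> supp p N.
Proof. by move=> /isom_surj[f _ f_inj]; exact: supp_inj f_inj. Qed.

Lemma supp_tensor_l (p : ideal R) (M N : lmodType R) : supp p (tensor M N) -> supp p M.
Proof.
move=> MNp r rM; apply: MNp => x.
apply: (tensor_ext (f := homothety r) (g := \0)) => m n.
by rewrite /= /homothety -tensZl rM tens0l.
Qed.

Lemma supp_tensor_r (p : ideal R) (M N : lmodType R) : supp p (tensor M N) -> supp p N.
Proof.
move=> MNp r rN; apply: MNp => x.
apply: (tensor_ext (f := homothety r) (g := \0)) => m n.
by rewrite /= /homothety -tensZr rN tens0r.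
Qed.

Section Prime.
Variable p : ideal R.
Hypothesis pp : prime_ideal p.

Lemma prime_pow (s : R) n : (s ^+ n : R^o) \in p -> (s : R^o) \in p.
Proof.
have [p1 pM] := pp; elim: n => [|n IH]; first by rewrite expr0 => /(negP p1).
by rewrite exprS => /pM[].
Qed.

Lemma supp_trivial (M : lmodType R) : trivial_module M -> ~ supp p M.
Proof. by move=> M0 Mp; have [/negP[]] := pp; apply: Mp => x; rewrite [LHS]M0. Qed.

Lemma first_supp P (n0 T : int) : (forall i, i < n0 -> trivial_module (homology P i)) ->
  (forall i, i <= T -> ~ supp p (homology P i)) \/
  exists2 t, t <= T /\ supp p (homology P t) &
    forall i, i < t -> ~ supp p (homology P i).
Proof.
move=> P0; have [TP|none] := pselect (exists d : nat,
    n0 + d%:Z <= T /\ `[< supp p (homology P (n0 + d%:Z)) >]).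
  right; have exd : exists d : nat,
      (n0 + d%:Z <= T) && `[< supp p (homology P (n0 + d%:Z)) >].
    by move: TP => [d [dT dP]]; exists d; rewrite dT.
  have [d /andP[dT /asboolP dP] dmin] := ex_minnP exd.
  exists (n0 + d%:Z) => // i id iP.
  have [in0|n0i] := ltP i n0; first exact: supp_trivial (P0 i in0) iP.
  have iE : i = n0 + (absz (i - n0)%R)%:Z by lia.
  have /dmin : (n0 + (absz (i - n0)%R)%:Z <= T) &&
      `[< supp p (homology P (n0 + (absz (i - n0)%R)%:Z)) >].
    by rewrite -iE; apply/andP; split; [lia | apply/asboolP].
  lia.
left=> i iT iP; have [in0|n0i] := ltP i n0; first exact: supp_trivial (P0 i in0) iP.
have iE : i = n0 + (absz (i - n0)%R)%:Z by lia.
apply: none; exists (absz (i - n0)%R); rewrite -iE; split=> //.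
exact/asboolP.
Qed.

(** A product, over the finitely many degrees below [t] with nonzero homology, of
    annihilators outside [p]. *)
Lemma common_killer P (n0 t : int) : (forall i, i < n0 -> trivial_module (homology P i)) ->
  (forall i, i < t -> ~ supp p (homology P i)) ->
  exists2 s : R, (s : R^o) \notin p & forall i, i < t -> kills (homology P i) s.
Proof.
move=> P0 Pt; have [p1 pM] := pp.
have main (d : nat) : n0 + d%:Z <= t ->
    exists2 s : R, (s : R^o) \notin p & forall i, i < n0 + d%:Z -> kills (homology P i) s.
  elim: d => [|d IH] dt.
    by exists 1 => // i; rewrite addr0 => /P0 Pi x; rewrite [LHS]Pi.
  have [|s sp sk] := IH; first by lia.
  have /existsNP[r /not_implyP[rk rp]] : ~ supp p (homology P (n0 + d%:Z)) by apply: Pt; lia.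
  exists (r * s) => [|i id x]; first by apply/negP => /pM[/rp //|]; exact/negP.
  have [iE|ni] := eqVneq i (n0 + d%:Z); first by subst i; rewrite mulrC -scalerA rk scaler0.
  by rewrite -scalerA sk ?scaler0 //; move: ni id; lia.
have [n0t|tn0] := leP n0 t.
  have tE : t = n0 + (absz (t - n0)%R)%:Z by lia.
  by rewrite tE; apply: main; rewrite -tE.
exists 1 => // i it x; rewrite [LHS]P0 //; exact: lt_trans it tn0.
Qed.
End Prime.

Section Cover.
Variables (P Q : complex R) (n0 m0 : int).
Hypotheses (projP : forall i, fin_proj (P i)) (projQ : forall i, fin_proj (Q i)).
Hypotheses (P0 : forall i, i < n0 -> trivial_module (P i))
           (Q0 : forall i, i < m0 -> trivial_module (Q i)).
Hypotheses (HP_fg : forall i, finitely_generated (homology P i))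
           (HQ_fg : forall i, finitely_generated (homology Q i)).
Let W := tensor_complex P Q.

Let homology_trivial (X : complex R) i : trivial_module (X i) -> trivial_module (homology X i).
Proof.
move=> X0; apply/(homology_trivialP X erefl erefl) => z _; exists 0.
by rewrite linear0 [z]X0.
Qed.
Let HP0 i (i0 : i < n0) : trivial_module (homology P i) := homology_trivial (P0 i0).
Let HQ0 i (i0 : i < m0) : trivial_module (homology Q i) := homology_trivial (Q0 i0).

Let mul_killer (s s' : R) P' i : kills (homology P' i) s -> kills (homology P' i) (s' * s).
Proof. by move=> sk x; rewrite -scalerA sk scaler0. Qed.

(** A common annihilator [s] outside [p] of the low homology of both factors has a
    power that kills the homology of the tensor product. *)
Let tensor_killer (p : ideal R) (t l n : int) : prime_ideal p ->
  (forall i, i < t -> ~ supp p (homology P i)) ->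
  (forall i, i < l -> ~ supp p (homology Q i)) -> n < t + l ->
  ~ supp p (homology W n).
Proof.
move=> pp Pt Ql ntl Wn; have [p1 pM] := pp.
have [s sp sk] := common_killer pp HP0 Pt; have [s' s'p s'k] := common_killer pp HQ0 Ql.
have [|||N WN] := @kill_tensor_homology R P Q n0 m0 projP P0 Q0 (s' * s) t l n.
- by move=> i it; apply/mul_killer/sk.
- by move=> i il; rewrite mulrC; apply/mul_killer/s'k.
- exact: ntl.
have /(prime_pow pp)/pM[] := Wn _ WN; exact/negP.
Qed.

(** In terms of the first degrees [t] and [l] where [p] supports the homology of the
    factors: the homology of the tensor product has no support at [p] below
    [t + l], and the tensor product of the homologies in degrees [t] and [l] has
    [p] in its support by Nakayama. *)
Lemma supp_homology_tensor (p : ideal R) n : prime_ideal p -> supp p (homology W n) ->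
  exists t l, t + l <= n /\ supp p (tensor (homology P t) (homology Q l)).
Proof.
move=> pp Wn.
have [Pn|[t [tn Pt] Pmin]] := first_supp pp (n - m0) HP0.
  exfalso; apply: (tensor_killer (t := n - m0 + 1) (l := m0) pp _ _ _ Wn).
  - by move=> i im; apply: Pn; lia.
  - by move=> i im; exact/supp_trivial/HQ0.
  - lia.
have [Qn|[l [ln Ql] Qmin]] := first_supp pp (n - t) HQ0.
  exfalso; apply: (tensor_killer (t := t) (l := n - t + 1) pp Pmin _ _ Wn).
  - by move=> i im; apply: Qn; lia.
  - lia.
by exists t, l; split; [lia | exact: supp_tensor].
Qed.

(** The witness is the sum of the first degrees where [p] supports the homology of
    the factors: there an annihilator [u] of the homology of the tensor product also
    kills, up to a power of some [s] outside [p], a module supported at [p]. *)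
Lemma supp_tensor_homology (p : ideal R) t l : prime_ideal p ->
  supp p (tensor (homology P t) (homology Q l)) ->
  exists2 n, n <= t + l & supp p (homology W n).
Proof.
move=> pp TQp; have [p1 pM] := pp.
have [Pn|[t0 [t0t Pt] Pmin]] := first_supp pp t HP0.
  by case: (Pn t _ (supp_tensor_l TQp)).
have [Qn|[l0 [l0l Ql] Qmin]] := first_supp pp l HQ0.
  by case: (Qn l _ (supp_tensor_r TQp)).
exists (t0 + l0) => [|u uW]; first exact: lerD.
have [s sp sk] := common_killer pp HP0 Pmin; have [s' s'p s'k] := common_killer pp HQ0 Qmin.
have [|||N uN] := @kill_bottom_tensor R P Q n0 m0 projP projQ P0 Q0 (s' * s) u t0 l0.
- by move=> i it; apply/mul_killer/sk.
- by move=> i il; rewrite mulrC; apply/mul_killer/s'k.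
- exact: uW.
have /pM[//|/(prime_pow pp)/pM[s'P|sP]] := supp_tensor pp (HP_fg t0) (HQ_fg l0) Pt Ql uN.
  by move: s'p; rewrite s'P.
by move: sp; rewrite sP.
Qed.
End Cover.
End Supports.

(** * Comparison of the two suprema *)

Section Ltensor.
Variables (R : comPzRingType) (noethR : noetherian R).

Lemma isom_fg (M N : lmodType R) : isom M N -> finitely_generated M -> finitely_generated N.
Proof. by move=> /isom_surj[f fS _]; exact: fg_image fS. Qed.

Lemma isom_trivial (M N : lmodType R) : isom M N -> trivial_module M -> trivial_module N.
Proof. by move=> /isom_surj[f fS _] M0 y; have [x <-] := fS y; rewrite [x]M0 linear0. Qed.

Lemma choose_complexP (S : complex R -> Prop) : (exists X, S X) -> S (choose_complex S).
Proof.
by move=> ex; rewrite /choose_complex; case: pselect => // h; case: cid.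
Qed.

Lemma Df_plus_resolution (X : complex R) : Df_plus X ->
  exists (P : complex R) (n0 : int) (f : chain_map P X), [/\ quasi_iso f,
    forall i, fin_proj (P i) & forall i, i < n0 -> trivial_module (P i)].
Proof.
move=> [[n0 X0] Xfg]; have [P [f [fq projP P0]]] := resolution_exists noethR Xfg X0.
by exists P, n0, f.
Qed.

(** The chosen K-flat resolution [K] of [X] is arbitrary.  It preserves the
    quasi-isomorphism from [Q] to [Y], and [Q], itself K-flat, preserves the one from
    a resolution [P] of [K]; the swap moves the factor that is tensored with to the
    left. *)
Lemma Ltensor_resolutions (X Y : complex R) : Df_plus X -> Df_plus Y ->
  exists (P Q : complex R) (n0 m0 : int),
  [/\ (forall i, fin_proj (P i)) /\ (forall i, fin_proj (Q i)),
      (forall i, i < n0 -> trivial_module (P i)) /\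
      (forall i, i < m0 -> trivial_module (Q i)),
      (forall t, isom (homology P t) (homology X t)) /\
      (forall l, isom (homology Q l) (homology Y l)) &
      forall n, isom (homology (tensor_complex P Q) n) (homology (Ltensor X Y) n)].
Proof.
move=> hX hY; pose K := choose_complex (K_flat_resolution X).
have [flatK [k kq]] : K_flat_resolution X K.
  apply: choose_complexP; have [P [n0 [f [fq projP P0]]]] := Df_plus_resolution hX.
  by exists P; split; [exact: fin_proj_K_flat projP P0 | exists f].
have KX t : isom (homology K t) (homology X t) by exists (homology_map k t); exact: kq.
have hK : Df_plus K.
  have [[n0 X0] Xfg] := hX; split.
    by exists n0 => l /X0; exact/isom_trivial/isom_sym.
  by move=> l; exact: isom_fg (isom_sym (KX l)) (Xfg l).
have [Q [m0 [g [gq projQ Q0]]]] := Df_plus_resolution hY.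
have [P [n0 [f [fq projP P0]]]] := Df_plus_resolution hK.
exists P, Q, n0, m0; split=> //.
  split=> [t|l]; last exact: quasi_iso_isom.
  exact: isom_trans (quasi_iso_isom t fq) (KX t).
move=> n; have flatQ := fin_proj_K_flat projQ Q0.
apply: isom_trans (quasi_iso_isom n (@cswap_quasi_iso R P Q)) _.
apply: isom_trans (quasi_iso_isom n (K_flat_quasi_iso flatQ fq)) _.
apply: isom_trans (quasi_iso_isom n (@cswap_quasi_iso R Q K)) _.
exact: quasi_iso_isom n (K_flat_quasi_iso flatK gq).
Qed.

Variable a : ideal R.

(** The bound on nonvanishing degrees makes the supremum a maximum unless the set is
    empty. *)
Lemma cd_cases (M : lmodType R) :
  (cd a M = -oo%E /\ forall k, van a k M) \/
  exists k : nat, [/\ cd a M = (k%:Z)%:E, ~ van a k M &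
                      forall j, ~ van a j M -> (j <= k)%N].
Proof.
have [n0 n0P] := van_bound noethR a.
pose S := [set i%:E | i in [set i : int | ~ trivial_module (local_cohomology a i M)]] :
  set (\bar int).
have SP e : S e <-> exists2 k : nat, ~ van a k M & e = (k%:Z)%:E.
  split=> [[[k|k] /= nt <-]|[k nv ->]].
  - by exists k => // /local_cohomology_van.
  - by case: nt; apply: local_cohomology_neg.
  - by exists k%:Z => //= /local_cohomology_van.
have [ex|all] := pselect (exists k, `[< ~ van a k M >]); last first.
  left; have van_all k : van a k M.
    by apply: contrapT => nv; apply: all; exists k; apply/asboolP.
  split=> //; rewrite /cd -/S; have -> : S = set0.
    by rewrite -subset0 => e /SP[k].
  by rewrite /sup_int /supremum eqxx.
have bnd k : `[< ~ van a k M >] -> (k <= n0)%N.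
  by move=> /asboolP nv; rewrite leqNgt; apply/negP => /n0P.
have [k /asboolP nv kmax] := ex_maxnP ex bnd.
right; exists k; split=> // [|j /asboolP]; last exact: kmax.
have ubk : ubound S (k%:Z)%:E.
  by move=> e /SP[j /asboolP/kmax jk ->]; rewrite lee_fin lez_nat.
have Sk : S (k%:Z)%:E by apply/SP; exists k.
rewrite /cd -/S /sup_int /supremum ifF; last first.
  by apply/negP => /eqP S0; rewrite S0 in Sk.
have supk : supremums S (k%:Z)%:E by split=> // e; apply.
have [ub lb] : supremums S (xget -oo%E (supremums S)) by apply: xgetPex; exists (k%:Z)%:E.
by apply/eqP; rewrite eq_le; apply/andP; split; [exact: lb | exact: ub].
Qed.

Lemma van_isom k (M N : lmodType R) : isom M N -> van a k M -> van a k N.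
Proof. by move=> [f fB]; exact: van_iso fB. Qed.

(** Nonemptiness matters, as the supremum of the empty set is set apart. *)
Lemma sup_int_eq (S T : set (\bar int)) : S !=set0 -> T !=set0 ->
  ubound S = ubound T -> sup_int S = sup_int T.
Proof.
move=> /set0P/negbTE S0 /set0P/negbTE T0 ST.
by rewrite /sup_int /supremum S0 T0 /supremums ST.
Qed.
End Ltensor.

Section Comparison.
Variables (R : comPzRingType) (noethR : noetherian R) (a : ideal R).
Variables (X Y : complex R) (hX : Df_plus X) (hY : Df_plus Y).
Let L := Ltensor X Y.
Let HT t l := tensor (homology X t) (homology Y l).

Lemma tensor_map_isom (M M' N N' : lmodType R) :
  isom M M' -> isom N N' -> isom (tensor M N) (tensor M' N').
Proof.
move=> [f [f' fK f'K]] [g [g' gK g'K]].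
have f'L : linear f' by move=> c x y; apply: (can_inj fK); rewrite linearP !f'K.
have g'L : linear g' by move=> c x y; apply: (can_inj gK); rewrite linearP !g'K.
exists (tensor_map f g); exists (tensor_map (lin_of f'L) (lin_of g'L)) => x /=;
  by rewrite tensor_map_comp tensor_map_id.
Qed.

(** Otherwise all H^j with [j >= k] would vanish on the tensor products of homologies
    in total degree at most [n], whose supports cover that of [homology L n]. *)
Lemma nonvanishing_Ltensor n k : ~ van a k (homology L n) ->
  exists t l j, [/\ t + l <= n, (k <= j)%N & ~ van a j (HT t l)].
Proof.
have [P [Q [n0 [m0 [[projP projQ] [P0 Q0] [PX QY] WL]]]]] := Ltensor_resolutions noethR hX hY.
have [_ Xfg] := hX; have [_ Yfg] := hY.
have Pfg i := isom_fg (isom_sym (PX i)) (Xfg i).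
have Qfg i := isom_fg (isom_sym (QY i)) (Yfg i).
move=> nv; apply: contrapT => none; apply: nv; apply: (van_isom (WL n)).
have PQ t l := tensor_map_isom (PX t) (QY l).
apply: (van_support noethR (Fam := fun M => exists t l, t + l <= n /\ M = HT t l)).
- by move=> M [t [l [_ ->]]]; exact: tensor_fg.
- move=> M j [t [l [tl ->]]] kj; apply: contrapT => nv.
  by apply: none; exists t, l, j.
- by apply: (tensor_homology_fg noethR _ _ P0 Q0 n) => // i; exact: fin_proj_fg.
- move=> p pp /(supp_homology_tensor projP P0 Q0 Pfg Qfg pp)[t [l [tl tlp]]].
  exists (HT t l); first by exists t, l.
  exact: supp_isom (PQ t l) tlp.
Qed.

(** The same argument, the homology of [L] in degrees at most [t + l] covering the
    support of [HT t l]. *)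
Lemma nonvanishing_tensor t l k : ~ van a k (HT t l) ->
  exists n j, [/\ n <= t + l, (k <= j)%N & ~ van a j (homology L n)].
Proof.
have [P [Q [n0 [m0 [[projP projQ] [P0 Q0] [PX QY] WL]]]]] := Ltensor_resolutions noethR hX hY.
have [_ Xfg] := hX; have [_ Yfg] := hY.
have Pfg i := isom_fg (isom_sym (PX i)) (Xfg i).
have Qfg i := isom_fg (isom_sym (QY i)) (Yfg i).
move=> nv; apply: contrapT => none; apply: nv.
have PQ := tensor_map_isom (PX t) (QY l).
apply: (van_support noethR (Fam := fun M => exists2 n, n <= t + l & M = homology L n)).
- move=> M [n _ ->]; apply: isom_fg (WL n) _.
  by apply: (tensor_homology_fg noethR _ _ P0 Q0 n) => // i; exact: fin_proj_fg.
- move=> M j [n ntl ->] kj; apply: contrapT => nv.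
  by apply: none; exists n, j.
- exact: tensor_fg.
- move=> p pp tlp.
  have [n ntl np] := supp_tensor_homology projP projQ P0 Q0 Pfg Qfg pp
      (supp_isom (isom_sym PQ) tlp).
  exists (homology L n); first by exists n.
  exact: supp_isom (WL n) np.
Qed.

Lemma cd_ge (M : lmodType R) j : ~ van a j M -> ((j%:Z)%:E <= cd a M)%E.
Proof.
case: (cd_cases noethR a M) => [[_ v] []|[k [-> _ kmax]] /kmax]; first exact: v.
by rewrite lee_fin lez_nat.
Qed.

Lemma cd_Ltensor : cdC a L =
  sup_int [set (cd a (HT t l) - l%:E - t%:E)%E | t in [set: int] & l in [set: int]].
Proof.
have shift (c c' : \bar int) (n m : int) : (c <= c')%E -> m <= n ->
    (c - n%:E <= c' - m%:E)%E.
  move: c c' => [c| |] [c'| |] //=; rewrite ?leey ?leNye // -!EFinB !lee_fin.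
  by move=> cc' mn; rewrite lerB.
apply: sup_int_eq; first by exists (cd a (homology L 0) - 0%:E)%E; exists 0.
  by exists (cd a (HT 0 0) - 0%:E - 0%:E)%E; exists 0 => //; exists 0.
have subA (c : \bar int) (l t : int) : (c - l%:E - t%:E = c - (t + l)%:E)%E.
  by case: c => [c| |] //=; rewrite -!EFinB opprD addrA addrAC.
apply/seteqP; split=> u ub.
- move=> _ [t _ [l _ <-]]; rewrite subA.
  case: (cd_cases noethR a (HT t l)) => [[-> _]|[k [-> nv _]]]; first by rewrite leNye.
  have [n [j [ntl kj nvj]]] := nonvanishing_tensor nv.
  apply: le_trans (ub _ (_ : _ (cd a (homology L n) - n%:E)%E)); last by exists n.
  apply: shift ntl; apply: le_trans (cd_ge nvj).
  by rewrite lee_fin lez_nat.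
- move=> _ [n _ <-].
  case: (cd_cases noethR a (homology L n)) => [[-> _]|[k [-> nv _]]]; first by rewrite leNye.
  have [t [l [j [tln kj nvj]]]] := nonvanishing_Ltensor nv.
  apply: le_trans (ub _ (_ : _ (cd a (HT t l) - l%:E - t%:E)%E)); last first.
    by exists t => //; exists l.
  rewrite subA; apply: shift tln; apply: le_trans (cd_ge nvj).
  by rewrite lee_fin lez_nat.
Qed.
End Comparison.

Unset Implicit Arguments.

Theorem theorem2p9 (R : comPzRingType) (noethR : noetherian R)
    (dimR : finite_krull_dim R) (a : ideal R) (X Y : complex R)
    (hX : Df_plus X) (hY : Df_plus Y) :
  cdC a (Ltensor X Y) =
  sup_int [set (cd a (tensor (homology X t) (homology Y l)) - l%:E - t%:E)%E
          | t in [set: int] & l in [set: int]].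
Proof. exact: cd_Ltensor. Qed.
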